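(* Let $(M,\mathcal D,g)$ be a contact sub-Riemannian manifold of dimension $2n+1$, with contact form $\omega$ normalized so that its Reeb vector field $X_0$ satisfies $\|X_0\|_{\mathcal D^2/\mathcal D}=1$, and let $J:\mathcal D\to\mathcal D$ be the associated linear map and $\mu$ the Popp volume. Let $\gamma(t)=\pi(e^{t\vec H}(\lambda))$ be a non-constant geodesic. Then, with $\rho$ the volume geodesic derivative computed with respect to $\mu$, $$\rho(\lambda)=\frac{d}{dt}\Big|_{t=0}\log\|J\dot\gamma(t)\|.$$ In particular, if $J^2=-1$ then $\rho=0$.
   Context: Contact structures. A contact sub-Riemannian manifold $(M,\mathcal D,g)$ of odd dimension $2n+1$ consists of a smooth manifold $M$ with a $1$-form $\omega$ such that $\mathcal D_x=\ker\omega_x$ for all $x\in M$ and $d\omega|_{\mathcal D}$ is non-degenerate, and a smooth inner product $g=\langle\cdot,\cdot\rangle$ on $\mathcal D$, with norm $\|\cdot\|$. The form $\omega$ is determined only up to multiplication by a non-vanishing smooth function. The Reeb vector field $X_0$ of $\omega$ is the unique vector field with $\omega(X_0)=1$ and $d\omega(X_0,\cdot)=0$; it is transversal to $\mathcal D$. Here $\mathcal D^2=TM$, and $\|\cdot\|_{\mathcal D^2/\mathcal D}$ is the norm induced by $g$ on $\mathcal D^2/\mathcal D=TM/\mathcal D$ as a quotient norm through the surjective linear map $\Lambda^2\mathcal D_x\to T_xM/\mathcal D_x$, $V\wedge W\mapsto[V,W]|_x\bmod\mathcal D_x$ ($V,W$ extended to sections of $\mathcal D$), where the elements $X_i\wedge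 X_j$, $i<j$, are orthonormal if $X_1,\dots,X_{2n}$ is an orthonormal basis of $\mathcal D_x$. The form $\omega$ is normalized so that $\|X_0\|_{\mathcal D^2/\mathcal D}=1$. The map $J:\mathcal D\to\mathcal D$ is the fiber-wise linear map defined by $\langle JX,Y\rangle=d\omega(X,Y)$ for $X,Y\in\mathcal D$. If $X_1,\dots,X_{2n}$ is a local orthonormal frame of $\mathcal D$ and $\nu^1,\dots,\nu^{2n},\nu^0$ is the frame dual to $X_1,\dots,X_{2n},X_0$, the Popp volume is $\mu=\nu^1\wedge\dots\wedge\nu^{2n}\wedge\nu^0$. Geodesics. The Hamiltonian is $H(p,x)=\frac12\sum_{i=1}^{2n}\langle p,X_i(x)\rangle^2$ on $T^*M$ (independent of the orthonormal frame), $\vec H=\sum_j\frac{\partial H}{\partial p_j}\frac{\partial}{\partial x_j}-\frac{\partial H}{\partial x_j}\frac{\partial}{\partial p_j}$ is its Hamiltonian vector field with flow $e^{t\vec H}$, and $\pi:T^*M\to M$ is the projection; a geodesic is a curve $\gamma(t)=\pi(e^{t\vec H}(\lambda))$, $\lambda\in T^*M$. Its flag is $\mathcal F^i_{\gamma(t)}=\mathrm{span}\{\mathcal L^j_{\mathsf T}(X)|_{\gamma(t)}: X\in\Gamma(\mathcal D),\ j\le i-1\}$, where $\Gamma(\mathcal D)$ is the set of smooth sections of $\mathcal D$, $\mathsf T\in\Gamma(\mathcal D)$ is any horizontal extension of $\dot\gamma$, and $\mathcal L_{\mathsf T}$ is the Lie derivative. On a contact manifold every non-constant geodesic is ample and equiregular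 (the dimensions of the flag do not depend on $t$ and the flag reaches the whole tangent space), with $\dim\mathcal F^1=2n$ and $\dim\mathcal F^2=2n+1$. With $d_i=\dim\mathcal F^i-\dim\mathcal F^{i-1}$ and $\mathcal F^0=\{0\}$, set $\mathcal N(\lambda)=\sum_i(2i-1)d_i=2n+3$. Volume geodesic derivative. For $\lambda\in T_x^*M$ let $\mathcal V_\lambda=T_\lambda(T_x^*M)\simeq T_x^*M$, and let $\mu_\lambda^*$ be the volume form on $\mathcal V_\lambda$ induced, through this identification, by the volume form $\mu_x^*$ on $T_x^*M$ with $\mu_x^*(\mu_x)=1$. Write $(\pi\circ e^{t\vec H})^*\mu|_{\mathcal V_\lambda}=f_\lambda(t)\mu^*_\lambda$; then $\rho(\lambda)=\frac{d}{dt}\big|_{t=0}\log\big(t^{-\mathcal N(\lambda)}f_\lambda(t)\big)$. *)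

(* Defs.v *)
From HB Require Import structures.
From mathcomp Require Export all_boot all_order all_algebra.
From mathcomp Require Export all_classical all_reals all_analysis.

Set Implicit Arguments.
Unset Strict Implicit.
Unset Printing Implicit Defensive.

Import Order.TTheory GRing.Theory Num.Theory numFieldNormedType.Exports.
Local Open Scope classical_set_scope.
Local Open Scope ring_scope.

(** * Smooth maps *)

(* Iterated directional derivatives; for finite-dimensional V and open A this
   is the usual class C^k on A. *)
Fixpoint is_Ck {R : realType} {V W : normedModType R} (k : nat) (A : set V)
    (f : V -> W) : Prop :=
  match k with
  | 0 => forall x, A x -> {for x, continuous f}
  | k'.+1 => (forall x, A x -> differentiable f x) /\
             (forall v, is_Ck k' A (fun x => 'D_v f x))
  end.

Definition is_smooth {R : realType} {V W : normedModType R} (A : set V)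
  (f : V -> W) : Prop := forall k, is_Ck k A f.

(** * Smooth manifolds *)

(* [chart_inv i] is only meaningful on the image of [dom i]; [chart_at] is an
   arbitrary choice of a chart around each point. *)
Record manifold (R : realType) (d : nat) := Manifold {
  point :> topologicalType;
  manifold_hausdorff : hausdorff_space point;
  manifold_second_countable : @second_countable point;
  chart_index : Type;
  dom : chart_index -> set point;
  chart : chart_index -> point -> 'rV[R]_d;
  chart_inv : chart_index -> 'rV[R]_d -> point;
  chart_at : point -> chart_index;
  dom_chart_at : forall x, dom (chart_at x) x;
  dom_open : forall i, open (dom i);
  image_open : forall i, open (chart i @` dom i);
  chartK : forall i x, dom i x -> chart_inv i (chart i x) = x;
  chart_continuous : forall i x, dom i x -> {for x, continuous (chart i)};
  chart_inv_continuous : forall i y, (chart i @` dom i) y ->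
    {for y, continuous (chart_inv i)};
  transition_smooth : forall i j,
    is_smooth (chart i @` (dom i `&` dom j)) (chart j \o chart_inv i)
}.

(* The tangent space T_xM is 'rV_d and the cotangent space T*_xM is 'cV_d, a
   (co)vector at x being given by its components in the chart [chart_at x]. *)

Definition vfield R d (M : manifold R d) := M -> 'rV[R]_d.

Definition cotangent R d (M : manifold R d) := (M * 'cV[R]_d)%type.

Definition pairing {R : realType} {d} (p : 'cV[R]_d) (v : 'rV[R]_d) : R :=
  (v *m p) 0 0.

Section Coordinates.
Context {R : realType} {d : nat} {M : manifold R d}.
Implicit Types (x : M) (i : chart_index M) (U : set M).

Definition vec_in i x (v : 'rV[R]_d) : 'rV[R]_d :=
  'd (chart i \o chart_inv (chart_at x)) (chart (chart_at x) x) v.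

(* Dual to [vec_in]:
   pairing (covec_in i x p) (vec_in i x v) = pairing p v if dom i x. *)
Definition covec_in i x (p : 'cV[R]_d) : 'cV[R]_d :=
  lin1_mx ('d (chart (chart_at x) \o chart_inv i) (chart i x)) *m p.

Definition vfield_in i (X : vfield M) (y : 'rV[R]_d) : 'rV[R]_d :=
  vec_in i (chart_inv i y) (X (chart_inv i y)).

Definition form_in i (w : M -> 'cV[R]_d) (y : 'rV[R]_d) : 'cV[R]_d :=
  covec_in i (chart_inv i y) (w (chart_inv i y)).

Definition cotangent_in i (l : cotangent M) : 'rV[R]_d * 'cV[R]_d :=
  (chart i l.1, covec_in i l.1 l.2).

(* The inverse of [cotangent_in i]. *)
Definition cotangent_of i (z : 'rV[R]_d * 'cV[R]_d) : cotangent M :=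
  let x := chart_inv i z.1 in
  (x, lin1_mx ('d (chart i \o chart_inv (chart_at x)) (chart (chart_at x) x))
        *m z.2).

Definition smooth_fun U (f : M -> R) : Prop :=
  forall i, is_smooth (chart i @` (U `&` dom i)) (f \o chart_inv i).

Definition smooth_vfield U (X : vfield M) : Prop :=
  forall i, is_smooth (chart i @` (U `&` dom i)) (vfield_in i X).

Definition smooth_form (w : M -> 'cV[R]_d) : Prop :=
  forall i, is_smooth (chart i @` dom i) (form_in i w).

(* [X, Y] f = X (Y f) - Y (X f). *)
Definition lie_bracket (X Y : vfield M) : vfield M := fun x =>
  let c := chart_at x in
  'D_(X x) (vfield_in c Y) (chart c x) - 'D_(Y x) (vfield_in c X) (chart c x).

(* dw (X, Y) = X (w Y) - Y (w X) - w [X, Y]. *)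
Definition ext_deriv (w : M -> 'cV[R]_d) x (u v : 'rV[R]_d) : R :=
  let c := chart_at x in
  pairing ('D_u (form_in c w) (chart c x)) v
  - pairing ('D_v (form_in c w) (chart c x)) u.

Definition velocity (c : R -> M) (t : R) : 'rV[R]_d :=
  'D_1 (chart (chart_at (c t)) \o c) t.

End Coordinates.

(** * Volume forms *)

(* (nu_1 /\ ... /\ nu_d) (v_1, ..., v_d) *)
Definition wedge {R : realType} {d} (nu : 'I_d -> 'cV[R]_d)
  (v : 'I_d -> 'rV[R]_d) : R := \det (\matrix_(i, j) pairing (nu i) (v j)).

(* The volume form m* on the dual space with m*(m) = 1, that is
   nu_1 /\ ... /\ nu_d = m*(nu_1, ..., nu_d) m; the two sides are compared on
   the standard basis. *)
Definition dual_volume {R : realType} {d} (m : ('I_d -> 'rV[R]_d) -> R)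
    (nu : 'I_d -> 'cV[R]_d) : R :=
  let e := fun i : 'I_d => delta_mx 0 i : 'rV[R]_d in wedge nu e / m e.

(** * Hamiltonian flows *)

Section HamiltonianFlow.
Context {R : realType} {d : nat} {M : manifold R d}.
Implicit Types (H : cotangent M -> R) (W : set (R * cotangent M)).

Definition ham_vfield H (i : chart_index M) (z : 'rV[R]_d * 'cV[R]_d) :
    'rV[R]_d * 'cV[R]_d :=
  (\row_j 'D_(delta_mx j 0) (fun q => H (cotangent_of i (z.1, q))) z.2,
   - \col_j 'D_(delta_mx 0 j) (fun y => H (cotangent_of i (y, z.2))) z.1).

(* W is the domain of the (not necessarily maximal) local flow Phi of the
   Hamiltonian vector field of H. The third condition says, in charts, that
   W is open and that Phi is smooth on W. *)
Definition is_ham_flow H W (Phi : R -> cotangent M -> cotangent M) : Prop :=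
  [/\ forall l, W (0, l) /\ Phi 0 l = l,
      forall l, is_interval [set t | W (t, l)],
      forall t l, W (t, l) -> forall i j, dom i l.1 -> dom j (Phi t l).1 ->
        exists Q : set (R * ('rV[R]_d * 'cV[R]_d)),
          [/\ open Q, Q (t, cotangent_in i l),
              forall s z, Q (s, z) -> [/\ (chart i @` dom i) z.1,
                W (s, cotangent_of i z) &
                dom j (Phi s (cotangent_of i z)).1] &
              is_smooth Q (fun sz =>
                cotangent_in j (Phi sz.1 (cotangent_of i sz.2)))] &
      forall t l, W (t, l) -> forall i, dom i (Phi t l).1 ->
        is_derive t 1 (fun s => cotangent_in i (Phi s l))
          (ham_vfield H i (cotangent_in i (Phi t l)))].

End HamiltonianFlow.

(** * Contact sub-Riemannian manifolds *)

Definition in_kernel {R : realType} {d} {M : manifold R d} (w : M -> 'cV[R]_d)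
  (x : M) (v : 'rV[R]_d) : Prop := pairing (w x) v = 0.

(* The contact distribution is D = ker contact_form; [metric x] is only
   meaningful on D_x. *)
Record contact_manifold (R : realType) (n : nat) := ContactManifold {
  contact_space :> manifold R n.*2.+1;
  contact_form : contact_space -> 'cV[R]_(n.*2.+1);
  metric : contact_space -> 'rV[R]_(n.*2.+1) -> 'rV[R]_(n.*2.+1) -> R;
  contact_form_smooth : smooth_form contact_form;
  contact_nondegenerate : forall x u, in_kernel contact_form x u ->
    (forall v, in_kernel contact_form x v -> ext_deriv contact_form x u v = 0) -> u = 0;
  metric_sym : forall x u v, in_kernel contact_form x u -> in_kernel contact_form x v ->
    metric x u v = metric x v u;
  metric_linear : forall x (a : R) u v w,
    in_kernel contact_form x u -> in_kernel contact_form x v ->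
    in_kernel contact_form x w ->
    metric x (a *: u + v) w = a * metric x u w + metric x v w;
  metric_pos : forall x u, in_kernel contact_form x u -> u != 0 ->
    0 < metric x u u;
  metric_smooth : forall (U : set contact_space) X Y, open U ->
    smooth_vfield U X -> smooth_vfield U Y ->
    (forall x, U x -> in_kernel contact_form x (X x)) ->
    (forall x, U x -> in_kernel contact_form x (Y x)) ->
    smooth_fun U (fun x => metric x (X x) (Y x))
}.

Section Contact.
Context {R : realType} {n : nat} {M : contact_manifold R n}.
Notation N := n.*2.+1.
Implicit Types (x : M) (U : set M).

Definition distr : M -> 'rV[R]_N -> Prop := in_kernel (contact_form (c:=M)).

Definition gnorm x (v : 'rV[R]_N) : R := Num.sqrt (metric x v v).

Definition section_on U (X : vfield M) : Prop :=
  [/\ open U, smooth_vfield U X & forall x, U x -> distr x (X x)].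

Definition orthonormal_basis x (e : 'I_(n.*2) -> 'rV[R]_N) : Prop :=
  (forall i, distr x (e i)) /\ forall i j, metric x (e i) (e j) = (i == j)%:R.

Definition is_reeb (X0 : vfield M) : Prop := forall x,
  pairing (contact_form x) (X0 x) = 1 /\
  forall v, ext_deriv (contact_form (c:=M)) x (X0 x) v = 0.

(* The norm of v mod D_x in T_xM / D_x: the infimum of the norms of the
   bivectors sum_(i < j) c_ij X_i /\ X_j of Lambda^2 D_x, for X orthonormal at
   x, which are mapped to v mod D_x by X_i /\ X_j |-> [X_i, X_j]. *)
Definition quotient_norm x (v : 'rV[R]_N) : R :=
  inf [set s | exists (U : set M) (X : 'I_(n.*2) -> vfield M)
                      (c : 'I_(n.*2) -> 'I_(n.*2) -> R),
    [/\ U x /\ (forall i, section_on U (X i)),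
        orthonormal_basis x (fun i => X i x),
        distr x (v - \sum_(i < n.*2) \sum_(j < n.*2 | (i < j)%N)
                       c i j *: lie_bracket (X i) (X j) x) &
        s = Num.sqrt (\sum_(i < n.*2) \sum_(j < n.*2 | (i < j)%N) c i j ^+ 2)]].

Definition is_J (J : M -> 'rV[R]_N -> 'rV[R]_N) : Prop :=
  forall x u, distr x u -> distr x (J x u) /\
    forall v, distr x v ->
      metric x (J x u) v = ext_deriv (contact_form (c:=M)) x u v.

(* X_1, ..., X_2n, X_0 *)
Definition adapted_frame (X0 : vfield M) (X : 'I_(n.*2) -> vfield M) x
    (k : 'I_N) : 'rV[R]_N :=
  if unlift ord_max k is Some i then X i x else X0 x.

(* The frame is only local: mu is a globally defined form which is locally
   nu^1 /\ ... /\ nu^2n /\ nu^0 (the sign of the latter depends on the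
   orientation of the frame). *)
Definition is_popp (X0 : vfield M) (mu : M -> ('I_N -> 'rV[R]_N) -> R) : Prop :=
  forall x, exists (U : set M) (X : 'I_(n.*2) -> vfield M),
    [/\ U x, forall i, section_on U (X i),
        forall y, U y -> orthonormal_basis y (fun i => X i y) &
        forall y, U y -> forall nu : 'I_N -> 'cV[R]_N,
          (forall i j, pairing (nu i) (adapted_frame X0 X y j) = (i == j)%:R) ->
          mu y =1 wedge nu].

Definition is_hamiltonian (H : cotangent M -> R) : Prop :=
  forall x p e, orthonormal_basis x e ->
    H (x, p) = 2^-1 * \sum_i pairing p (e i) ^+ 2.

(** ** The flag of a horizontal curve and the number N(lambda) *)

Definition horizontal_extension (c : R -> M) (t : R) (T : vfield M) : Prop :=
  (exists2 U, U (c t) & section_on U T) /\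
  \forall s \near t, T (c s) = velocity c s.

(* Sections are only required to be defined around the point. *)
Definition flag_gen x (T : vfield M) (i : nat) : set 'rV[R]_N :=
  [set v | exists U X j, [/\ U x, section_on U X, (j < i)%N &
                            v = iter j (lie_bracket T) X x]].

Definition is_span (S : set 'rV[R]_N) (F : {vspace 'rV[R]_N}) : Prop :=
  (forall v, S v -> v \in F) /\
  (forall G : {vspace 'rV[R]_N}, (forall v, S v -> v \in G) -> (F <= G)%VS).

Definition is_geodesic_dim (c : R -> M) (k : nat) : Prop :=
  exists (T : vfield M) (F : nat -> {vspace 'rV[R]_N}) (m : nat),
    [/\ horizontal_extension c 0 T,
        forall i, is_span (flag_gen (c 0) T i) (F i),
        F m = fullv &
        k = (\sum_(1 <= i < m.+1)
               (i.*2.-1 * (\dim (F i) - \dim (F i.-1))))%N].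

(** ** The volume geodesic derivative *)

(* The differential at p of q |-> pi (Phi_t (x, q)) on V_l = T*_xM. *)
Definition exp_diff (Phi : R -> cotangent M -> cotangent M) (l : cotangent M)
    (t : R) (a : 'cV[R]_N) : 'rV[R]_N :=
  'd (fun q : 'cV[R]_N =>
        chart (chart_at (Phi t l).1) (Phi t (l.1, q)).1) (l.2) a.

(* f is f_lambda; d/dt log (t^-k f(t)) at 0 is taken for the extension of
   t^-k f(t) by its limit C at 0. *)
Definition is_vol_geod_deriv (mu : M -> ('I_N -> 'rV[R]_N) -> R)
    (W : set (R * cotangent M)) (Phi : R -> cotangent M -> cotangent M)
    (k : nat) (l : cotangent M) (rho : R) : Prop :=
  exists (f : R -> R) (C : R),
    [/\ forall t, W (t, l) -> forall a : 'I_N -> 'cV[R]_N,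
          mu (Phi t l).1 (fun i => exp_diff Phi l t (a i))
          = f t * dual_volume (mu l.1) a,
        0 < C,
        (fun t => t ^- k * f t) @ 0^' --> C &
        is_derive (0 : R) 1
          (fun t => ln (if t == 0 then C else t ^- k * f t)) rho].

End Contact.

(* Main.v *)
(** Fix the chart at the initial point, and let the rows of b(t) be the
  components, in a frame (X_0, X_1, ..., X_2n) transported along the geodesic,
  of the derivatives of the projected flow in the 2n+1 momentum directions; let
  a(t) be the analogue for the position directions. Then f(t) = det b(t).
  Since the flow is symplectic and the Hamiltonian only sees D, the Wronskian
  a^T b' - b^T a' is the constant projection onto D. Since geodesics are
  horizontal, d/dt omega(xi) = d omega (gamma', xi) for every variation xi, so
  the X_0-column of b' is b w, with w_j = d omega (gamma', X_j). Differentiating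
  these identities at t = 0 gives the first coefficients of b, the X_0-column
  vanishing to order 2 (and its X_0-entry to order 3), whence
    f(t) = t^(2n+3) (|w(0)|^2 + t <w(0), w'(0)> + o(t)) / 12.
  As |w| = ||J gamma'||, the logarithmic derivative is that of ||J gamma'||.
  Finally |w(0)| <> 0 because d omega is non-degenerate on D and the energy of
  a non-constant geodesic is not zero; and J^2 = -1 makes J an isometry, so that
  ||J gamma'|| is then constant. *)

From HB Require Import structures.
Require Import Defs.
From mathcomp Require Import perm ring lra.
Set Implicit Arguments.
Unset Strict Implicit.
Unset Printing Implicit Defensive.
Import Order.TTheory GRing.Theory Num.Theory numFieldNormedType.Exports.
Local Open Scope classical_set_scope.
Local Open Scope ring_scope.

(** * Jets and the expansion of a degenerate determinant *)

Section Jets.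
Context {R : realType}.
Implicit Types f g : R -> R.

(** Dividing every entry of b(t) by its leading power of t amounts to rescaling rows and columns. It
    gives a matrix G with det G = det b / t^(2n+3) and G(0) invertible, so Jacobi's formula applies
    at t = 0, and each entry of b is needed to just one order beyond its leading one. G'(0) contains
    data that the identities do not determine: the D-block Y of a'(0), and the component of w(0)
    along the first frame vector. Only the skew part of Y enters, and it is traceless and null as a
    quadratic form; the component cancels between row 0 and column 0. The Reeb field is
    characterised pointwise, with no smoothness included, and [chart_at] may jump from point to
    point. All differentiations therefore take place in one fixed chart, and the first frame vector
    is the chart-constant vector X_0(gamma(0)), rescaled to have omega = 1. It agrees with the Reeb
    vector modulo D, so the determinant of the frame is the same. Finally f = det b holds exactly:
    the Popp densities at the two end points are, up to a common sign, the inverses of the frame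
    determinants. *)

Lemma near0P (P : R -> Prop) : (\forall t \near (0 : R), P t) <->
  exists2 r : R, 0 < r & forall t, `|t| < r -> P t.
Proof.
split=> [/nbhs_ballP[r /= r0 H]|[r r0 H]].
  by exists r => // t tr; apply: H; rewrite /ball /= sub0r normrN.
by apply/nbhs_ballP; exists r => //= t; rewrite /ball /= sub0r normrN; exact: H.
Qed.

(** That is, f(t) = (c + d t) t^m + o(t^(m+1)). This form passes to primitives ([jetS]), and it is
    what makes f / t^m, extended by c, differentiable at 0 with derivative d ([jet_quot]). *)
Definition jet (m : nat) (c d : R) f := forall e : R, 0 < e ->
  \forall t \near (0 : R), `|f t - (c + d * t) * t ^+ m| <= e * `|t| ^+ m.+1.

Lemma is_derive_mxP {V : normedModType R} m n (M : V -> 'M[R]_(m, n)) t v dM :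
  is_derive t v M dM <->
  forall i j, is_derive t v (fun x => M x i j) (dM i j).
Proof.
split=> [[Md <-] i j|H].
  by rewrite derive_mx// mxE; apply/derivableP; exact: (iffLR (derivable_mxP _ _ _) Md).
have Md : derivable M t v by apply/derivable_mxP => i j; have [] := H i j.
split=> //; rewrite derive_mx//; apply/matrixP => i j; rewrite mxE.
by have [] := H i j.
Qed.

Lemma is_derive_big_sum {V W : normedModType R} (I : Type) (r : seq I) (P : pred I)
    (F : I -> V -> W) (dF : I -> W) t v :
  (forall i, P i -> is_derive t v (F i) (dF i)) ->
  is_derive t v (fun x => \sum_(i <- r | P i) F i x) (\sum_(i <- r | P i) dF i).
Proof.
move=> H; elim: r => [|i r IH].
  have -> : (fun x => \sum_(j <- [::] | P j) F j x) = cst 0.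
    by apply/funext => x; rewrite big_nil.
  by rewrite big_nil; exact: is_derive_cst.
rewrite big_cons.
have -> : (fun x => \sum_(j <- i :: r | P j) F j x) =
   if P i then F i + (fun x => \sum_(j <- r | P j) F j x)
   else (fun x => \sum_(j <- r | P j) F j x).
  by apply/funext => x; rewrite big_cons; case: (P i).
by case: ifPn => // Pi; apply: is_deriveD; exact: H.
Qed.

Lemma is_derive_mul {V : normedModType R} (f g : V -> R) t v df dg :
  is_derive t v f df -> is_derive t v g dg ->
  is_derive t v (fun x => f x * g x) (df * g t + f t * dg).
Proof.
move=> Hf Hg; have H := is_deriveM Hf Hg.
apply: (is_derive_eq H).
by rewrite addrC /GRing.scale /= mulrC [RHS]addrC [RHS]addrC.
Qed.

Lemma is_derive_prod {V : normedModType R} (I : eqType) (r : seq I)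
    (F : I -> V -> R) (dF : I -> R) t v : uniq r ->
  (forall i, is_derive t v (F i) (dF i)) ->
  is_derive t v (fun x => \prod_(i <- r) F i x)
    (\sum_(i <- r) dF i * \prod_(j <- r | j != i) F j t).
Proof.
move=> + H; elim: r => [_|i r IH /= /andP[ir ur]].
  have -> : (fun x => \prod_(j <- [::]) F j x) = cst 1.
    by apply/funext => x; rewrite big_nil.
  by rewrite big_nil; exact: is_derive_cst.
have -> : (fun x => \prod_(j <- i :: r) F j x) =
   (fun x => F i x * \prod_(j <- r) F j x).
  by apply/funext => x; rewrite big_cons.
have := is_derive_mul (H i) (IH ur); move=> HH; apply: (is_derive_eq HH).
rewrite !big_cons eqxx /=; congr (_ * _ + _).
  rewrite big_seq [RHS]big_seq_cond; apply: eq_bigl => j.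
  by case: eqP => [->|]; rewrite ?andbT// (negbTE ir).
rewrite mulr_sumr [LHS]big_seq [RHS]big_seq; apply: eq_bigr => j jr.
rewrite big_cons; case: eqP => [ij|_ /=]; first by rewrite ij jr in ir.
by rewrite mulrCA.
Qed.

Lemma is_derive_mulmx {V : normedModType R} m n p (A : V -> 'M[R]_(m, n))
    (B : V -> 'M[R]_(n, p)) dA dB t v :
  is_derive t v A dA -> is_derive t v B dB ->
  is_derive t v (fun x => A x *m B x) (dA *m B t + A t *m dB).
Proof.
move=> /is_derive_mxP HA /is_derive_mxP HB; apply/is_derive_mxP => i j.
rewrite !mxE -big_split /=.
under eq_fun do rewrite mxE.
apply: is_derive_big_sum => k _.
exact: is_derive_mul (HA i k) (HB k j).
Qed.

Lemma is_derive_trmx {V : normedModType R} m n (A : V -> 'M[R]_(m, n)) dA t v :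
  is_derive t v A dA -> is_derive t v (fun x => (A x)^T) dA^T.
Proof.
move=> /is_derive_mxP HA; apply/is_derive_mxP => i j; rewrite mxE.
by under eq_fun do rewrite mxE.
Qed.

(** Jacobi's formula. The product rule on the Leibniz sum gives one determinant per row, with that
    row replaced by its derivative; expanding along this row leaves the cofactors of M. *)
Lemma is_derive_det {V : normedModType R} n (M : V -> 'M[R]_n) dM t v :
  is_derive t v M dM ->
  is_derive t v (fun x => \det (M x)) (\tr (dM *m \adj (M t))).
Proof.
move=> /is_derive_mxP HM.
have H : is_derive t v (fun x => \det (M x))
   (\sum_(s : 'S_n) (-1) ^+ s * (\sum_(i < n) dM i (s i) * \prod_(j | j != i) M t j (s j))).
  apply: is_derive_big_sum => s _.
  have := @is_derive_prod V _ (index_enum 'I_n) (fun i x => M x i (s i))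
    (fun i => dM i (s i)) t v (index_enum_uniq _) (fun i => HM i (s i)).
  by move=> /(is_deriveZ ((-1) ^+ s)).
apply: (is_derive_eq H).
pose Mi i := \matrix_(k, j) (if k == i then dM i j else M t k j).
transitivity (\sum_i \det (Mi i)).
  under eq_bigr do rewrite mulr_sumr.
  rewrite exchange_big /=; apply: eq_bigr => i _; apply: eq_bigr => s _.
  congr (_ * _); rewrite [RHS](bigD1 i)//= mxE eqxx; congr (_ * _).
  by apply: eq_bigr => j ji; rewrite mxE (negbTE ji).
rewrite /mxtrace; apply: eq_bigr => i _.
rewrite (expand_det_row _ i) !mxE; apply: eq_bigr => j _.
rewrite !mxE eqxx; congr (_ * _).
rewrite /cofactor; congr (_ * \det _); apply/matrixP => k l.
by rewrite !mxE eq_sym (negbTE (neq_lift _ _)).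
Qed.

Lemma jet0 f d : is_derive (0 : R) 1 f d -> jet 0 (f 0) d f.
Proof.
move=> [fd <-] e e0.
have /cvgrPdist_le/(_ _ e0) : (fun h : R => h^-1 *: (f (h *: 1 + 0) - f 0)) @ 0^' --> 'D_1 f 0.
  exact: fd.
rewrite near_withinE => D.
apply: filterS D => t H; rewrite expr0 mulr1 expr1.
have [->|t0] := eqVneq t 0; first by rewrite mulr0 addr0 subrr normr0 mulr0.
have {H} := H t0; rewrite /GRing.scale /= mulr1 addr0 => H.
rewrite -(@ler_pM2l _ `|t|^-1) ?invr_gt0 ?normr_gt0//.
rewrite -normfV -normrM mulrCA -normrM mulVf// normr1 mulr1.
rewrite distrC in H; apply: le_trans H; rewrite le_eqVlt; apply/orP; left.
by apply/eqP; congr `| _|; field.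
Qed.

Lemma jet_quot m c d f : jet m c d f ->
  is_derive (0 : R) 1 (fun t => if t == 0 then c else f t / t ^+ m) d.
Proof.
move=> H.
have C : (fun h : R => h^-1 *: ((if h *: 1 + 0 == 0 :> R then c else f (h *: 1 + 0) / (h *: 1 + 0) ^+ m) -
   (if 0 == 0 :> R then c else f 0 / 0 ^+ m))) @ 0^' --> (d : R).
  apply/cvgrPdist_le => e e0.
  rewrite near_withinE; apply: filterS (H _ e0) => t Ht t0.
  rewrite /GRing.scale /= mulr1 addr0 eqxx (negbTE t0).
  rewrite -(@ler_pM2l _ (`|t| ^+ m.+1)) ?exprn_gt0 ?normr_gt0//.
  rewrite [leRHS]mulrC; apply: le_trans Ht; rewrite -normrX -normrM distrC.
  rewrite le_eqVlt; apply/orP; left; apply/eqP; congr `| _|; rewrite exprS.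
  by have := expf_neq0 m t0; move: (t ^+ m) => u u0; field; rewrite u0.
split; first exact: (cvgP _ C).
exact: (cvg_lim _ C).
Qed.

(** The mean value theorem gives |f t| = |g c| |t| with |c| <= |t|; the factor 1/(m+1) of
    integration is lost, which little-o estimates tolerate. With e = 0 the conclusion is that f
    vanishes near 0, and constancy of first integrals is obtained in this way below. *)
Lemma mvt_bound f g (e r : R) m : 0 < r -> 0 <= e ->
  (forall t, `|t| < r -> is_derive (t : R) 1 f (g t)) ->
  (forall t, `|t| < r -> `|g t| <= e * `|t| ^+ m) -> f 0 = 0 ->
  forall t, `|t| < r -> `|f t| <= e * `|t| ^+ m.+1.
Proof.
move=> r0 e0 fd gb f0 t tr.
have fc s : `|s| < r -> {for s, continuous f}.
  by move=> sr; apply/differentiable_continuous/derivable1_diffP; have [] := fd s sr.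
have E : exists2 c, `|c| <= `|t| & `|f t| = `|g c| * `|t|.
  case: (ltgtP t 0) => [t0|t0|->].
  - have [|s|c] := @MVT _ f g t 0 t0.
    + move=> s; rewrite in_itv /= => /andP[ts s0]; apply: fd.
      by rewrite ltr0_norm//; rewrite ltr0_norm// in tr; lra.
    + apply: continuous_in_subspaceT => s'; rewrite inE /= in_itv /= => /andP[ts s0]; apply: fc.
      by rewrite ler0_norm//; rewrite ltr0_norm// in tr; lra.
    rewrite in_itv /= => /andP[tc c0] Hc; exists c.
      by rewrite !ltr0_norm//; lra.
    by rewrite f0 !sub0r in Hc; rewrite -normrN Hc normrM normrN.
  - have [|s|c] := @MVT _ f g 0 t t0.
    + move=> s; rewrite in_itv /= => /andP[ts s0]; apply: fd.
      by rewrite gtr0_norm//; rewrite gtr0_norm// in tr; lra.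
    + apply: continuous_in_subspaceT => s'; rewrite inE /= in_itv /= => /andP[ts s0]; apply: fc.
      by rewrite ger0_norm//; rewrite gtr0_norm// in tr; lra.
    rewrite in_itv /= => /andP[tc c0] Hc; exists c.
      by rewrite !gtr0_norm//; lra.
    by rewrite f0 !subr0 in Hc; rewrite Hc normrM.
  - by exists 0; rewrite // f0 normr0 mulr0.
have [c ct ->] := E; rewrite exprSr mulrA ler_wpM2r//.
apply: le_trans (gb _ (le_lt_trans ct tr)) _.
by rewrite ler_wpM2l// lerXn2r// ?nnegrE.
Qed.

(** Termwise integration: [mvt_bound] is applied to f minus the candidate expansion, whose
    derivative is the error term of g. *)
Lemma jetS m c d f g : (\forall t \near (0 : R), is_derive (t : R) 1 f (g t)) ->
  f 0 = 0 -> jet m c d g -> jet m.+1 (c / m.+1%:R) (d / m.+2%:R) f.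
Proof.
move=> fg f0 H e e0.
have {fg H} /near0P[r r0 Hr] : \forall t \near (0 : R), is_derive (t : R) 1 f (g t) /\
    `|g t - (c + d * t) * t ^+ m| <= e * `|t| ^+ m.+1.
  by near=> t; split; near: t; [|exact: H].
apply/near0P; exists r => // t tr.
pose f' s := f s - (c / m.+1%:R + d / m.+2%:R * s) * s ^+ m.+1.
apply: (@mvt_bound f' (fun s => g s - (c + d * s) * s ^+ m) e r) => //.
- exact: ltW.
- move=> s sr; have [Hs _] := Hr s sr.
  have D : is_derive s (1:R) (fun s : R => (c / m.+1%:R + d / m.+2%:R * s) * s ^+ m.+1)
    ((c + d * s) * s ^+ m).
    have H1 : is_derive s (1:R) (fun s : R => (c / m.+1%:R + d / m.+2%:R * s))
       (d / m.+2%:R).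
      have -> : (fun s : R => (c / m.+1%:R + d / m.+2%:R * s)) =
         cst (c / m.+1%:R) + (d / m.+2%:R) *: (id : R -> R) by apply/funext.
      have := is_deriveD (is_derive_cst (c / m.+1%:R) s 1) (is_deriveZ (d / m.+2%:R) (is_derive_id s 1)).
      by rewrite add0r /GRing.scale /= mulr1.
    have H2 : is_derive s (1:R) (fun s : R => s ^+ m.+1) (m.+1%:R * s ^+ m).
      have -> : (fun s : R => s ^+ m.+1) = (id : R -> R) ^+ m.+1.
        by apply/funext => x; rewrite fctE.
      have := @is_deriveX _ _ _ m.+1 _ _ _ (is_derive_id s (1 : R)).
      by rewrite /GRing.scale /= mulr1.
    apply: (is_derive_eq (is_derive_mul H1 H2)).
    rewrite exprS.
    have : m.+1%:R != 0 :> R by rewrite pnatr_eq0.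
    have : m.+2%:R != 0 :> R by rewrite pnatr_eq0.
    have -> : m.+2%:R = m.+1%:R + 1 :> R by rewrite -natr1.
    move: (m.+1%:R) (s ^+ m) => u v u1 u0; field; rewrite u0.
    by rewrite u1.
  exact: is_deriveB.
- by move=> s sr; have [] := Hr s sr.
- by rewrite /f' f0 expr0n /= mulr0 subrr.
Unshelve. all: by end_near. Qed.

(** An identity on a neighbourhood of 0 survives differentiation as an identity on a neighbourhood,
    so the step can be iterated. *)
Lemma near0_derive_eq {W : normedModType R} (F G F1 G1 : R -> W) :
  (\forall t \near (0 : R), F t = G t) ->
  (\forall t \near (0 : R), is_derive (t : R) 1 F (F1 t)) ->
  (\forall t \near (0 : R), is_derive (t : R) 1 G (G1 t)) ->
  \forall t \near (0 : R), F1 t = G1 t.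
Proof.
move=> /near_join FG HF HG; near=> t.
have [_ <-] : is_derive (t : R) 1 F (F1 t) by near: t.
have [_ <-] : is_derive (t : R) 1 G (G1 t) by near: t.
by apply: near_eq_derive; near: t.
Unshelve. all: by end_near. Qed.

Lemma jet1 f f1 d : (\forall t \near (0 : R), is_derive (t : R) 1 f (f1 t)) ->
  is_derive (0 : R) 1 f1 d -> f 0 = 0 -> jet 1 (f1 0) (d / 2) f.
Proof.
move=> H /jet0 H1 f0; have := jetS H f0 H1.
by rewrite divr1.
Qed.

Lemma jet2 f f1 f2 d : (\forall t \near (0 : R), is_derive (t : R) 1 f (f1 t)) ->
  (\forall t \near (0 : R), is_derive (t : R) 1 f1 (f2 t)) ->
  is_derive (0 : R) 1 f2 d -> f 0 = 0 -> f1 0 = 0 -> jet 2 (f2 0 / 2) (d / 6) f.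
Proof.
move=> H H1 H2 f0 f10; have := jetS H f0 (jet1 H1 H2 f10).
by congr jet; field.
Qed.

Lemma jet3 f f1 f2 f3 d : (\forall t \near (0 : R), is_derive (t : R) 1 f (f1 t)) ->
  (\forall t \near (0 : R), is_derive (t : R) 1 f1 (f2 t)) ->
  (\forall t \near (0 : R), is_derive (t : R) 1 f2 (f3 t)) ->
  is_derive (0 : R) 1 f3 d -> f 0 = 0 -> f1 0 = 0 -> f2 0 = 0 ->
  jet 3 (f3 0 / 6) (d / 24) f.
Proof.
move=> H H1 H2 H3 f0 f10 f20; have := jetS H f0 (jet2 H1 H2 H3 f10 f20).
by congr jet; field.
Qed.

End Jets.

(** * Linear algebra of the leading matrix and of the derivatives at 0 *)

Section JacobiDeterminant.
Context {R : realType} {m : nat}.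
Implicit Types (A B G : 'M[R]_(1 + m)).

Lemma det_scale n (r c : 'I_n -> R) (G : 'M[R]_n) :
  \det (\matrix_(i, j) (r i * G i j * c j)) = (\prod_i r i) * \det G * \prod_j c j.
Proof.
have -> : \matrix_(i, j) (r i * G i j * c j) =
    diag_mx (\row_i r i) *m G *m diag_mx (\row_j c j).
  by apply/matrixP => i j; rewrite mul_mx_diag mul_diag_mx !mxE.
rewrite !det_mulmx !det_diag.
by congr (_ * _ * _); apply: eq_bigr => i _; rewrite mxE.
Qed.

Definition corner_proj : 'M[R]_(1 + m) := block_mx 0 0 0 1%:M.

(* The coefficients of lowest order of the entries of b(t); the entry (i, j) has
   order 1 + [i = 0] + [j = 0]. *)
Definition leading_mx (w : 'cV[R]_m) : 'M[R]_(1 + m) :=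
  block_mx (- (6^-1 *: (w^T *m w))) (- (2^-1 *: w^T)) (2^-1 *: w) 1%:M.

(** Clearing the upper right block with the identity block leaves the scalar 1/4 - 1/6 = 1/12 times
    w^T w. *)
Lemma det_leading_mx w : \det (leading_mx w) = (w^T *m w) 0 0 / 12.
Proof.
have -> : leading_mx w = block_mx 1%:M (- (2^-1 *: w^T)) 0 1%:M *m
   block_mx (12^-1 *: (w^T *m w)) 0 (2^-1 *: w) 1%:M.
  rewrite mulmx_block !mul1mx !mul0mx !mulmx1 !add0r; congr block_mx.
  rewrite mulNmx -scalemxAl -scalemxAr scalerA -scaleNr -scalerBl.
  by congr (_ *: _); field.
rewrite det_mulmx det_ublock det_lblock !det1 det_mx11 !mxE !mul1r mulr1 mulrC.
by [].
Qed.

(** The right-hand side is det times the inverse, as given by the Schur complement of the identity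
    block. It is confirmed by multiplying with the leading matrix, using w^T w = 12 det. *)
Lemma adj_leading_mx w : \det (leading_mx w) != 0 -> \adj (leading_mx w) =
  block_mx 1%:M (2^-1 *: w^T) (- (2^-1 *: w))
    (\det (leading_mx w) *: 1%:M - 4^-1 *: (w *m w^T)).
Proof.
move=> d0; set C := block_mx _ _ _ _; set d := \det _ in d0 C *.
have ww : w^T *m w = (12 * d)%:M.
  apply/matrixP => i j; rewrite !ord1 /d det_leading_mx [RHS]mxE eqxx mulr1n.
  by rewrite mulrCA divff ?mulr1// pnatr_eq0.
have GC : leading_mx w *m C = d%:M.
  rewrite mulmx_block !mulmx1 !mul1mx (@scalar_mx_block _ 1 m d); congr block_mx.
  - rewrite mulNmx mulmxN opprK -scalemxAl -scalemxAr ww scalerA.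
    rewrite -scaleNr -scalerDl scale_scalar_mx; congr (_%:M).
    by field.
  - rewrite mulmxBr !mulNmx -!scalemxAl -!scalemxAr mulmx1 !mulmxA ww.
    rewrite !mul_scalar_mx !scalerA.
    move: (w^T) => p; apply/matrixP => i j; rewrite !mxE.
    by field.
  - by rewrite subrr.
  - rewrite -scalemxAl -scalemxAr scalerA.
    have -> : 2^-1 * 2^-1 = 4^-1 :> R by field.
    by rewrite addrC subrK scalemx1.
have := mul_adj_mx (leading_mx w).
move=> /(congr1 (mulmx^~ C)); rewrite -mulmxA GC.
rewrite mul_mx_scalar mul_scalar_mx -/d => H.
by apply: (scalerI d0); rewrite H.
Qed.

Lemma usubmx_mul A (x : 'cV[R]_(1 + m)) :
  usubmx (A *m x) = ulsubmx A *m usubmx x + ursubmx A *m dsubmx x.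
Proof. by rewrite -{1}[A]submxK -{1}[x]vsubmxK mul_block_col col_mxKu. Qed.

Lemma dsubmx_mul A (x : 'cV[R]_(1 + m)) :
  dsubmx (A *m x) = dlsubmx A *m usubmx x + drsubmx A *m dsubmx x.
Proof. by rewrite -{1}[A]submxK -{1}[x]vsubmxK mul_block_col col_mxKd. Qed.

Lemma usubmx11 (x : 'cV[R]_(1 + m)) : usubmx x = (x 0 0)%:M.
Proof. by rewrite [LHS]mx11_scalar mxE lshift0. Qed.

Lemma trmx11 (A : 'M[R]_1) : A^T = A.
Proof. by rewrite [A]mx11_scalar tr_scalar_mx. Qed.

Lemma dot_mxC (x y : 'cV[R]_m) : x^T *m y = y^T *m x.
Proof. by rewrite -[LHS]trmx11 trmx_mul trmxK. Qed.

Lemma skew_quad (Y : 'M[R]_m) (x : 'cV[R]_m) : x^T *m (Y - Y^T) *m x = 0.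
Proof.
rewrite mulmxBr mulmxBl; apply/eqP; rewrite subr_eq0; apply/eqP.
by rewrite -[LHS]trmx11 !trmx_mul trmxK mulmxA.
Qed.

(* [Ak], [Bk], [v], [v1], [v2] are the derivatives at 0 of the functions [a],
   [b] and [w] of Section DeterminantExpansion. *)
Variables (A1 A2 B1 B2 B3 B4 : 'M[R]_(1 + m)) (v v1 v2 : 'cV[R]_(1 + m)).
Let e0 : 'cV[R]_(1 + m) := col_mx 1%:M 0.
Hypothesis A1e : A1 *m e0 = v.
Hypothesis A2e : A2 *m e0 = A1 *m v + v1.
Hypothesis B1E : B1 = corner_proj.
Hypothesis B2E : A1^T *m B1 + B2 - B1^T *m A1 = 0.
Hypothesis B3E : A1^T *m B2 + B3 - B1^T *m A2 +
  (A2^T *m B1 + A1^T *m B2 - (B2^T *m A1 + B1^T *m A2)) = 0.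
Hypothesis B3e : B3 *m e0 = B2 *m v + 2 *: (B1 *m v1).
Hypothesis B4e : B4 *m e0 = B3 *m v + 3 *: (B2 *m v1) + 3 *: (B1 *m v2).

Let w := dsubmx v.
Let w1 := dsubmx v1.
Let Y := drsubmx A1.

Lemma first_jet : A1 = block_mx (usubmx v) (ursubmx A1) w Y.
Proof.
rewrite -[LHS]submxK; congr (block_mx _ _ _ _).
  by rewrite -A1e -[A1]submxK /e0 mul_block_col !mulmx1 !mulmx0 !addr0 col_mxKu block_mxKul.
by rewrite /w -A1e -[A1]submxK /e0 mul_block_col !mulmx1 !mulmx0 !addr0 col_mxKd block_mxKdl.
Qed.

(** Since [B1] is the corner projection, the differentiated Wronskian reads B2 = B1^T A1 - A1^T B1,
    so the undetermined block Y enters through its skew part only. *)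
Lemma second_jet : B2 = block_mx 0 (- w^T) w (Y - Y^T).
Proof.
have -> : B2 = B1^T *m A1 - A1^T *m B1.
  by apply/eqP; rewrite -subr_eq0 -[in X in _ == X]B2E; apply/eqP; rewrite opprB addrC addrAC.
rewrite B1E first_jet /corner_proj !tr_block_mx !mulmx_block !trmx0 !trmx1.
rewrite !(mul0mx, mulmx0, add0r, addr0, mul1mx, mulmx1) opp_block_mx add_block_mx.
by rewrite !(subr0, sub0r, oppr0).
Qed.

Let A2_dl : dlsubmx A2 = v 0 0 *: w + Y *m w + w1.
Proof.
have -> : dlsubmx A2 = dsubmx (A2 *m e0).
  by rewrite -[A2 in RHS]submxK /e0 mul_block_col !mulmx1 !mulmx0 !addr0 col_mxKd.
rewrite A2e -[v in A1 *m v]vsubmxK [in A1 *m _]first_jet mul_block_col -/w.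
rewrite raddfD /= col_mxKd; congr (_ + _ + _).
by rewrite [usubmx v]mx11_scalar mul_mx_scalar mxE lshift0.
Qed.

Let B3E' : B3 = 2 *: (B1^T *m A2) - A2^T *m B1 - 2 *: (A1^T *m B2) + B2^T *m A1.
Proof.
apply/eqP; rewrite -subr_eq0 -[in X in _ == X]B3E; apply/eqP.
by apply/matrixP => i j; rewrite !mxE; move: (\sum_k _) => *; ring.
Qed.

Lemma third_jet_ul : ulsubmx B3 = - (w^T *m w).
Proof.
rewrite B3E' second_jet B1E first_jet -[A2]submxK /corner_proj !tr_block_mx.
rewrite !mulmx_block !trmx0 !trmx1.
rewrite !(mul0mx, mulmx0, add0r, addr0, mul1mx, mulmx1) !scale_block_mx.
rewrite !opp_block_mx !add_block_mx block_mxKul.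
by rewrite !(subr0, sub0r, oppr0, scaler0, add0r) scaler_nat mulr2n opprD addrNK.
Qed.

Lemma third_jet_ur : ursubmx B3 = v 0 0 *: w^T - w1^T - w^T *m (Y - Y^T).
Proof.
rewrite B3E' second_jet B1E first_jet -[A2]submxK /corner_proj !tr_block_mx.
rewrite !mulmx_block !trmx0 !trmx1 A2_dl.
rewrite !(mul0mx, mulmx0, add0r, addr0, mul1mx, mulmx1) !scale_block_mx.
rewrite !opp_block_mx !add_block_mx block_mxKur.
rewrite !(subr0, sub0r, oppr0, scaler0, add0r) usubmx11.
rewrite tr_scalar_mx mul_scalar_mx !linearD /= linearZ /= trmx_mul.
rewrite !mulmxN.
move: (w^T *m Y) (w^T *m Y^T) (w^T) (w1^T) => r s p q.
by apply/matrixP => i j; rewrite !mxE; ring.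
Qed.

Lemma third_jet_dl : dlsubmx B3 = v 0 0 *: w + (Y - Y^T) *m w + 2 *: w1.
Proof.
have -> : dlsubmx B3 = dsubmx (B3 *m e0).
  by rewrite dsubmx_mul col_mxKu col_mxKd mulmx1 mulmx0 addr0.
rewrite B3e B1E second_jet !raddfD /= [dsubmx (2 *: _)]linearZ /= !dsubmx_mul.
rewrite /corner_proj !block_mxKdl !block_mxKdr usubmx11 mul_mx_scalar.
by rewrite mul0mx mul1mx add0r.
Qed.

(** Row 0 of the column identity for [B4]: the [v2] term drops because row 0 of [B1] is zero, the
    two [v 0 0] terms are opposite, and Y - Y^T vanishes against w on both sides. What remains is -1
    from the third derivative and -3 from the second. *)
Lemma fourth_jet_ul : ulsubmx B4 = - (4 *: (w^T *m w1)).
Proof.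
have -> : ulsubmx B4 = usubmx (B4 *m e0).
  by rewrite usubmx_mul col_mxKu col_mxKd mulmx1 mulmx0 addr0.
rewrite B4e !raddfD /= ![usubmx (3 *: _)]linearZ /= !usubmx_mul third_jet_ul third_jet_ur.
rewrite B1E second_jet /corner_proj !block_mxKul !block_mxKur !mul0mx !addr0 !add0r.
rewrite scaler0 addr0 usubmx11 mul_mx_scalar -/w -/w1 !mulmxBl -scalemxAl skew_quad.
rewrite (dot_mxC w1) mulNmx.
move: (v 0 0) (w^T *m w) (w^T *m w1) => p q r.
by apply/matrixP => i j; rewrite !mxE; ring.
Qed.

(** The corner, the rest of row 0 and the rest of column 0 contribute -1/6, 1/12 and 1/6 times w^T
    w1. The [v 0 0] terms of row 0 and column 0 are opposite, and Y - Y^T is traceless and null as a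
    quadratic form. *)
Lemma jacobi_leading_mx : \det (leading_mx w) != 0 ->
  \tr (block_mx (24^-1 *: ulsubmx B4) (6^-1 *: ursubmx B3)
                (6^-1 *: dlsubmx B3) (2^-1 *: drsubmx B2) *m \adj (leading_mx w)) =
  (w^T *m w1) 0 0 / 12.
Proof.
move=> d0; rewrite adj_leading_mx//.
rewrite fourth_jet_ul third_jet_ur third_jet_dl second_jet block_mxKdr.
rewrite mulmx_block (@mxtrace_block _ 1).
set d := \det _.
have wXw := skew_quad Y w; set X := Y - Y^T in wXw *.
have trX : \tr X = 0 by rewrite /X raddfB /= mxtrace_tr subrr.
have -> : \tr (6^-1 *: (v 0 0 *: w + X *m w + 2 *: w1) *m (2^-1 *: w^T) +
    2^-1 *: X *m (d *: 1%:M - 4^-1 *: (w *m w^T))) =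
    12^-1 * (v 0 0 * (w^T *m w) 0 0 + 2 * (w^T *m w1) 0 0).
  rewrite mxtraceD.
  have -> : \tr (2^-1 *: X *m (d *: 1%:M - 4^-1 *: (w *m w^T))) = 0.
    rewrite mulmxBr -!scalemxAl -!scalemxAr mulmx1 raddfB /= !mxtraceZ trX.
    by rewrite mulmxA mxtrace_mulC mulmxA wXw mxtrace0 !mulr0 subrr.
  rewrite addr0 -scalemxAl -scalemxAr !mxtraceZ mxtrace_mulC trace_mx11 !mulmxDr.
  rewrite -!scalemxAr mulmxA wXw addr0.
  by move: (w^T *m w) (w^T *m w1) => p q; rewrite !mxE; field.
rewrite trace_mx11 mulmx1 mulmxN -scalemxAl -scalemxAr !mulmxBl wXw -scalemxAl (dot_mxC w1).
by move: (w^T *m w) (w^T *m w1) => p q; rewrite !mxE; field.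
Qed.

End JacobiDeterminant.

(** * Differentiability at 0 of the rescaled determinant *)

Section DeterminantExpansion.
Context {R : realType} {m : nat}.
Variables (a a1 a2 a3 b b1 b2 b3 b4 : R -> 'M[R]_(1 + m)).
Variables (w w1 w2 w3 : R -> 'cV[R]_(1 + m)).
Let e0 : 'cV[R]_(1 + m) := col_mx 1%:M 0.
Hypothesis Ha : \forall t \near (0 : R), is_derive (t : R) 1 a (a1 t).
Hypothesis Ha1 : \forall t \near (0 : R), is_derive (t : R) 1 a1 (a2 t).
Hypothesis Ha2 : \forall t \near (0 : R), is_derive (t : R) 1 a2 (a3 t).
Hypothesis Hb : \forall t \near (0 : R), is_derive (t : R) 1 b (b1 t).
Hypothesis Hb1 : \forall t \near (0 : R), is_derive (t : R) 1 b1 (b2 t).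
Hypothesis Hb2 : \forall t \near (0 : R), is_derive (t : R) 1 b2 (b3 t).
Hypothesis Hb3 : \forall t \near (0 : R), is_derive (t : R) 1 b3 (b4 t).
Hypothesis Hw : \forall t \near (0 : R), is_derive (t : R) 1 w (w1 t).
Hypothesis Hw1 : \forall t \near (0 : R), is_derive (t : R) 1 w1 (w2 t).
Hypothesis Hw2 : \forall t \near (0 : R), is_derive (t : R) 1 w2 (w3 t).
Hypothesis a0 : a 0 = 1%:M.
Hypothesis b0 : b 0 = 0.
Hypothesis wronskian : \forall t \near (0 : R),
  (a t)^T *m b1 t - (b t)^T *m a1 t = corner_proj.
Hypothesis a_col : \forall t \near (0 : R), a1 t *m e0 = a t *m w t.
Hypothesis b_col : \forall t \near (0 : R), b1 t *m e0 = b t *m w t.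

Let mulD n (A : R -> 'M[R]_(1 + m)) (B : R -> 'M[R]_(1 + m, n)) A' B' :
  (\forall t \near (0 : R), is_derive (t : R) 1 A (A' t)) ->
  (\forall t \near (0 : R), is_derive (t : R) 1 B (B' t)) ->
  \forall t \near (0 : R),
    is_derive (t : R) 1 (fun t => A t *m B t) (A' t *m B t + A t *m B' t).
Proof. by move=> HA HB; near=> t; apply: is_derive_mulmx; near: t.
Unshelve. all: by end_near. Qed.

Let trD (A A' : R -> 'M[R]_(1 + m)) :
  (\forall t \near (0 : R), is_derive (t : R) 1 A (A' t)) ->
  \forall t \near (0 : R), is_derive (t : R) 1 (fun t => (A t)^T) (A' t)^T.
Proof. by move=> HA; near=> t; apply: is_derive_trmx; near: t.
Unshelve. all: by end_near. Qed.

Let addD n (A B A' B' : R -> 'M[R]_(1 + m, n)) :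
  (\forall t \near (0 : R), is_derive (t : R) 1 A (A' t)) ->
  (\forall t \near (0 : R), is_derive (t : R) 1 B (B' t)) ->
  \forall t \near (0 : R), is_derive (t : R) 1 (fun t => A t + B t) (A' t + B' t).
Proof. by move=> HA HB; near=> t; apply: is_deriveD; near: t.
Unshelve. all: by end_near. Qed.

Let subD n (A B A' B' : R -> 'M[R]_(1 + m, n)) :
  (\forall t \near (0 : R), is_derive (t : R) 1 A (A' t)) ->
  (\forall t \near (0 : R), is_derive (t : R) 1 B (B' t)) ->
  \forall t \near (0 : R), is_derive (t : R) 1 (fun t => A t - B t) (A' t - B' t).
Proof. by move=> HA HB; near=> t; apply: is_deriveB; near: t.
Unshelve. all: by end_near. Qed.

Let cstD n (A : 'M[R]_(1 + m, n)) :
  \forall t \near (0 : R), is_derive (t : R) 1 (fun=> A) 0.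
Proof. by near=> t; exact: is_derive_cst.
Unshelve. all: by end_near. Qed.

(** The column identities and the Wronskian are differentiated as often as the algebra above
    requires. The product rule keeps the terms in which the derivative falls on the constant [e0];
    they are products by 0, whence the arguments [cstD 0]. *)
Let a_col1 := near0_derive_eq a_col (mulD Ha1 (cstD e0)) (mulD Ha Hw).
Let b_col1 := near0_derive_eq b_col (mulD Hb1 (cstD e0)) (mulD Hb Hw).
Let b_col2 := near0_derive_eq b_col1
  (addD (mulD Hb2 (cstD e0)) (mulD Hb1 (cstD 0)))
  (addD (mulD Hb1 Hw) (mulD Hb Hw1)).
Let b_col3 := near0_derive_eq b_col2
  (addD (addD (mulD Hb3 (cstD e0)) (mulD Hb2 (cstD 0)))
    (addD (mulD Hb2 (cstD 0)) (mulD Hb1 (cstD 0))))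
  (addD (addD (mulD Hb2 Hw) (mulD Hb1 Hw1)) (addD (mulD Hb1 Hw1) (mulD Hb Hw2))).
Let wronskian1 := near0_derive_eq wronskian
  (subD (mulD (trD Ha) Hb1) (mulD (trD Hb) Ha1)) (cstD _).
Let wronskian2 := near0_derive_eq wronskian1
  (subD (addD (mulD (trD Ha1) Hb1) (mulD (trD Ha) Hb2))
        (addD (mulD (trD Hb1) Ha1) (mulD (trD Hb) Ha2))) (cstD _).

Let A1e : a1 0 *m e0 = w 0.
Proof. by rewrite (nbhs_singleton a_col) a0 mul1mx. Qed.

Let A2e : a2 0 *m e0 = a1 0 *m w 0 + w1 0.
Proof. by have := nbhs_singleton a_col1; rewrite mulmx0 addr0 a0 mul1mx. Qed.

Let B1E : b1 0 = corner_proj.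
Proof.
have := nbhs_singleton wronskian.
by rewrite a0 b0 !trmx0 trmx1 mul1mx mul0mx subr0.
Qed.

Let B2E : (a1 0)^T *m b1 0 + b2 0 - (b1 0)^T *m a1 0 = 0.
Proof.
have := nbhs_singleton wronskian1.
by rewrite a0 b0 !trmx0 trmx1 mul1mx mul0mx addr0.
Qed.

Let B3E : (a1 0)^T *m b2 0 + b3 0 - (b1 0)^T *m a2 0 +
  ((a2 0)^T *m b1 0 + (a1 0)^T *m b2 0 -
   ((b2 0)^T *m a1 0 + (b1 0)^T *m a2 0)) = 0.
Proof.
have := nbhs_singleton wronskian2.
rewrite a0 b0 !trmx0 trmx1 mul1mx mul0mx addr0 => <-.
by rewrite opprD !addrA; move: (_ *m _) (_ *m _) => *; apply/matrixP => i j; rewrite !mxE; ring.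
Qed.

Let B3e : b3 0 *m e0 = b2 0 *m w 0 + 2 *: (b1 0 *m w1 0).
Proof.
have := nbhs_singleton b_col2; rewrite b0 !mulmx0 mul0mx !addr0 => ->.
by rewrite scaler_nat mulr2n addrA.
Qed.

Let B4e : b4 0 *m e0 = b3 0 *m w 0 + 3 *: (b2 0 *m w1 0) + 3 *: (b1 0 *m w2 0).
Proof.
have := nbhs_singleton b_col3; rewrite b0 !mulmx0 mul0mx !addr0 => ->.
by apply/matrixP => i j; rewrite !mxE; ring.
Qed.

Let v0 := dsubmx (w 0).

Let order (i j : 'I_(1 + m)) := ((i == ord0) + (j == ord0) + 1)%N.

(** Division by 0 would give 0 at t = 0, so the limit is inserted by hand. The exponent is the sum
    of a row part 1 + [i = 0] and a column part [j = 0], hence for t <> 0 the matrix is a rescaling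
    of b(t) by rows and columns. *)
Let G t := \matrix_(i, j) (if t == 0 then leading_mx v0 i j
                           else b t i j / t ^+ order i j).

Let is_derive_G : is_derive (0 : R) 1 G
  (block_mx (24^-1 *: ulsubmx (b4 0)) (6^-1 *: ursubmx (b3 0))
            (6^-1 *: dlsubmx (b3 0)) (2^-1 *: drsubmx (b2 0))).
Proof.
have Db (c c' : R -> 'M[R]_(1 + m)) i j :
    (\forall t \near (0 : R), is_derive (t : R) 1 c (c' t)) ->
    (\forall t \near (0 : R), is_derive (t : R) 1 (fun s => c s i j) (c' t i j)).
  by move=> Hc; near=> t; apply: (iffLR (is_derive_mxP _ _ _ _)); near: t.
have K := second_jet A1e B1E B2E.
have L := third_jet_ul A1e B1E B2E B3E.
apply/is_derive_mxP => i j.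
have bij : b 0 i j = 0 by rewrite b0 mxE.
(* One jet per entry suffices: of order 3 at the corner, 2 on the rest of row 0 and column 0, 1
   elsewhere. The lower derivatives that must vanish do so by [B1E] and [K]. *)
suff J : exists c d, [/\ jet (order i j) c d (fun t => b t i j),
    c = leading_mx v0 i j & d = block_mx (24^-1 *: ulsubmx (b4 0))
    (6^-1 *: ursubmx (b3 0)) (6^-1 *: dlsubmx (b3 0)) (2^-1 *: drsubmx (b2 0)) i j].
  have [c [d [Jc cE dE]]] := J; rewrite -dE; have := jet_quot Jc.
  by congr is_derive; apply/funext => t; rewrite mxE -cE.
have N0 k : (rshift 1 k == ord0 :> 'I_(1 + m)) = false by [].
have E0 k : lshift m k == ord0 :> 'I_(1 + m) by rewrite ord1.
have [i' iE|i' iE] := split_ordP i; have [j' jE|j' jE] := split_ordP j;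
  rewrite iE jE in bij *; rewrite /order ?E0 ?N0.
- exists (b3 0 (lshift m i') (lshift m j') / 6), (b4 0 (lshift m i') (lshift m j') / 24).
  split.
  + have z1 : b1 0 (lshift m i') (lshift m j') = 0 by rewrite B1E block_mxEul mxE.
    have z2 : b2 0 (lshift m i') (lshift m j') = 0 by rewrite K block_mxEul mxE.
    exact: (jet3 (Db _ _ _ _ Hb) (Db _ _ _ _ Hb1) (Db _ _ _ _ Hb2)
             (nbhs_singleton (Db _ _ _ _ Hb3)) bij z1 z2).
  + rewrite block_mxEul -[b3 0]submxK block_mxEul L !mxE mulrC mulrN.
    by congr (- (_ * _)).
  + by rewrite block_mxEul !mxE mulrC.
- exists (b2 0 (lshift m i') (rshift 1 j') / 2), (b3 0 (lshift m i') (rshift 1 j') / 6).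
  split.
  + have z1 : b1 0 (lshift m i') (rshift 1 j') = 0 by rewrite B1E block_mxEur mxE.
    exact: (jet2 (Db _ _ _ _ Hb) (Db _ _ _ _ Hb1)
             (nbhs_singleton (Db _ _ _ _ Hb2)) bij z1).
  + by rewrite block_mxEur K block_mxEur !mxE mulrC mulrN.
  + by rewrite block_mxEur !mxE mulrC.
- exists (b2 0 (rshift 1 i') (lshift m j') / 2), (b3 0 (rshift 1 i') (lshift m j') / 6).
  split.
  + have z1 : b1 0 (rshift 1 i') (lshift m j') = 0 by rewrite B1E block_mxEdl mxE.
    exact: (jet2 (Db _ _ _ _ Hb) (Db _ _ _ _ Hb1)
             (nbhs_singleton (Db _ _ _ _ Hb2)) bij z1).
  + by rewrite block_mxEdl K block_mxEdl !mxE mulrC.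
  + by rewrite block_mxEdl !mxE mulrC.
- exists (b1 0 (rshift 1 i') (rshift 1 j')), (b2 0 (rshift 1 i') (rshift 1 j') / 2).
  split.
  + exact: (jet1 (Db _ _ _ _ Hb) (nbhs_singleton (Db _ _ _ _ Hb1)) bij).
  + by rewrite block_mxEdr B1E block_mxEdr.
  + by rewrite block_mxEdr !mxE mulrC.
Unshelve. all: by end_near. Qed.

Lemma is_derive_det_expansion :
  (v0^T *m v0) 0 0 != 0 ->
  is_derive (0 : R) 1
    (fun t => if t == 0 then (v0^T *m v0) 0 0 / 12 else \det (b t) / t ^+ (m + 3))
    ((v0^T *m dsubmx (w1 0)) 0 0 / 12).
Proof.
move=> s0; have := is_derive_det is_derive_G.
have G0 : G 0 = leading_mx v0 by apply/matrixP => i j; rewrite mxE eqxx.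
rewrite G0 (jacobi_leading_mx A1e A2e B1E B2E B3E B3e B4e); last first.
  by rewrite det_leading_mx mulf_neq0// invr_eq0 pnatr_eq0.
congr is_derive; apply/funext => t; case: eqVneq => [->|t0].
  by rewrite G0 det_leading_mx.
have -> : G t = \matrix_(i, j) (t ^- ((i == ord0) + 1) * b t i j * t ^- (j == ord0)).
  apply/matrixP => i j; rewrite !mxE (negbTE t0) /order addnAC exprD invfM.
  by rewrite mulrCA mulrA.
rewrite (det_scale (fun i => t ^- ((i == ord0) + 1)) (fun j => t ^- (j == ord0))).
(* The 1 + m rows give one power of t each and row 0 gives one more; column 0 supplies the last of
   the m + 3 powers. *)
have -> : \prod_(i < 1 + m) t ^- ((i == ord0) + 1) = t ^- (2 + m).
  rewrite big_split_ord /= big_ord1 /= [in RHS]exprD [in RHS]invfM; congr (_ * _).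
  under eq_bigr do rewrite add0n expr1.
  by rewrite big_const_ord iter_mulr mulr1 exprVn.
have -> : \prod_(j < 1 + m) t ^- (j == ord0) = t^-1.
  rewrite big_split_ord /= big_ord1 big1 ?mulr1 ?expr1// => j _.
  by rewrite expr0 invr1.
rewrite !exprD exprS expr1.
have := expf_neq0 m t0; move: (t ^+ m) (\det _) => u d u0.
by field; rewrite ?t0 ?u0.
Qed.

End DeterminantExpansion.

(** * Directional derivatives and smooth curves *)

Section DirectionalDerivatives.
Context {R : realType}.
Implicit Types U V W : normedModType R.

Lemma is_derive_diff V W (f : V -> W) x v : differentiable f x ->
  is_derive x v f ('D_v f x).
Proof. by move=> fx; apply/derivableP; exact: diff_derivable. Qed.

Lemma near_derive_eq V W (f g : V -> W) x v :
  (\forall y \near x, f y = g y) -> 'D_v f x = 'D_v g x.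
Proof. exact: near_eq_derive. Qed.

Lemma diff_boundP V W (f : V -> W) x : differentiable f x ->
  forall e : R, 0 < e ->
    \forall h \near (0 : V), `|f (x + h) - f x - 'd f x h| <= e * `|h|.
Proof.
move=> /diff_locally fd e e0; have := fd; move=> /eqaddoP/(_ _ e0).
by apply: filterS => h; rewrite !fctE /= opprD addrA (addrC h).
Qed.

Lemma differentiable_bound V W (f : V -> W) x (df : {linear V -> W}) :
  continuous df ->
  (forall e : R, 0 < e -> \forall h \near (0 : V), `|f (x + h) - f x - df h| <= e * `|h|) ->
  differentiable f x /\ 'd f x = df :> (V -> W).
Proof.
move=> dfc H.
have E : f \o shift x = cst (f x) + df +o_ (0 : V) id.
  apply/eqaddoP => e e0; apply: filterS (H e e0) => h.
  by rewrite !fctE /= opprD addrA (addrC h).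
have dE := diff_unique dfc E.
by split=> //; apply/diff_locallyP; rewrite dE.
Qed.

Lemma near_translate V (P : V -> Prop) x :
  (\forall y \near x, P y) -> \forall h \near (0 : V), P (x + h).
Proof.
rewrite (near_shift 0) => H.
by apply: filterS H => h /=; rewrite subr0 addrC.
Qed.

Lemma near_differentiable V W (f g : V -> W) x :
  (\forall y \near x, f y = g y) -> differentiable f x -> differentiable g x.
Proof.
move=> fg fd; apply: (@differentiable_bound _ _ g x ('d f x) _ _).1.
  exact: diff_continuous.
move=> e e0; near=> h; rewrite -(nbhs_singleton fg).
have <- : f (x + h) = g (x + h).
  by near: h; exact: near_translate fg.
by near: h; exact: diff_boundP.
Unshelve. all: by end_near. Qed.

Lemma is_derive_line V (x v : V) (t : R) : is_derive (t : R) 1 (fun s : R => x + s *: v) v.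
Proof.
have -> : (fun s : R => x + s *: v) = cst x + (fun s : R => s *: v) by apply/funext.
rewrite -{2}[v]add0r; apply: is_deriveD.
have C : (fun h : R => h^-1 *: ((h *: 1 + t) *: v - t *: v)) @ 0^' --> v.
  apply: cvg_near_cst; near=> h.
  have h0 : h != 0 by near: h; exact: nbhs_dnbhs_neq.
  have -> : h *: (1 : R) = h by rewrite /GRing.scale /= mulr1.
  by rewrite -scalerBl addrK scalerA mulVf// scale1r.
split; first exact: (cvgP _ C).
exact: (cvg_lim _ C).
Unshelve. all: by end_near. Qed.

Lemma is_derive_comp V W (y : R -> V) (f : V -> W) t y' :
  is_derive (t : R) 1 y y' -> differentiable f (y t) ->
  is_derive (t : R) 1 (f \o y) ('D_y' f (y t)).
Proof.
move=> [yd <-] fd; have yD : differentiable y t by apply/derivable1_diffP.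
have cD : differentiable (f \o y) t by exact: differentiable_comp.
apply: is_derive_eq; first exact: is_derive_diff.
by rewrite deriveE// diff_comp//= -deriveE// -deriveE.
Qed.

Lemma derive_comp U V W (g : U -> V) (f : V -> W) x v :
  differentiable g x -> differentiable f (g x) ->
  'D_v (f \o g) x = 'D_('D_v g x) f (g x).
Proof.
move=> gd fd; rewrite deriveE; last exact: differentiable_comp.
by rewrite diff_comp//= -deriveE// -deriveE.
Qed.

Lemma derive_dirD V W (f : V -> W) x u v : differentiable f x ->
  'D_(u + v) f x = 'D_u f x + 'D_v f x.
Proof. by move=> fd; rewrite !deriveE// linearD. Qed.

Lemma derive_dirZ V W (f : V -> W) x (a : R) v : differentiable f x ->
  'D_(a *: v) f x = a *: 'D_v f x.
Proof. by move=> fd; rewrite !deriveE// linearZ. Qed.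

Lemma derive_dir_sum V W (f : V -> W) x (I : Type) (r : seq I) (P : pred I) (v : I -> V) :
  differentiable f x ->
  'D_(\sum_(i <- r | P i) v i) f x = \sum_(i <- r | P i) 'D_(v i) f x.
Proof.
by move=> fd; rewrite deriveE// linear_sum; apply: eq_bigr => i _; rewrite deriveE.
Qed.

Lemma is_derive_linear U V W (L : {linear V -> W}) (f : U -> V) x v df :
  continuous L -> is_derive x v f df -> is_derive x v (L \o f) (L df).
Proof.
move=> Lc [/cvg_ex[l fl] fE].
have lE : l = df by rewrite -fE; apply/esym/cvg_lim.
have C : (fun h : R => h^-1 *: ((L \o f) (h *: v + x) - (L \o f) x)) @ 0^' --> L df.
  have -> : (fun h : R => h^-1 *: ((L \o f) (h *: v + x) - (L \o f) x)) =
      L \o (fun h : R => h^-1 *: (f (h *: v + x) - f x)).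
    by apply/funext => h /=; rewrite /= -raddfB -linearZ.
  by rewrite -lE; apply: continuous_cvg => //; exact: Lc.
split; first exact: (cvgP _ C).
exact: (cvg_lim _ C).
Qed.

(** Schwarz's argument: for fixed t the mean value estimate is applied in s to f(x + s u + t v) -
    f(x + s u). Its s-derivative is controlled by the differentiability of D_u f at the single point
    x. *)
Let second_difference V (f : V -> R) (A : set V) x u v : open A -> A x ->
  (forall y, A y -> differentiable f y) -> differentiable ('D_u f) x ->
  forall e : R, 0 < e -> \forall t \near (0 : R),
    `|f (x + t *: u + t *: v) - f (x + t *: u) - (f (x + t *: v) - f x)
      - 'D_v ('D_u f) x * t ^+ 2| <= e * t ^+ 2.
Proof.
move=> oA Ax fd du e e0.
pose N := `|u| + `|v| + 1.
have N0 : 0 < N by rewrite ltr_wpDl// addr_ge0.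
(* Two error terms, taken at points within 2 N |t| of x, have to add up to at most e |t|. *)
have e'0 : 0 < e / (4 * N) by rewrite divr_gt0// mulr_gt0.
have [d d0 Hd] : exists2 d : R, 0 < d & forall h : V, `|h| < d -> A (x + h) /\
   `|'D_u f (x + h) - 'D_u f x - 'd ('D_u f) x h| <= e / (4 * N) * `|h|.
  have nA : \forall h \near (0 : V), A (x + h).
    by apply: near_translate; exact: open_nbhs_nbhs.
  have /nbhs_ballP[d /= d0 Hd] : \forall h \near (0 : V), A (x + h) /\
     `|'D_u f (x + h) - 'D_u f x - 'd ('D_u f) x h| <= e / (4 * N) * `|h|.
    by near=> h; split; near: h => //; exact: diff_boundP.
  by exists d => // h hd; apply: Hd; rewrite -ball_normE /ball_ /= sub0r normrN.
apply/near0P; exists (d / (2 * N)); first by rewrite divr_gt0// mulr_gt0.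
move=> t td; have [->|t0] := eqVneq t 0.
  by rewrite !scale0r !addr0 !subrr expr0n /= !mulr0 subr0 normr0.
have t0' : 0 < `|t| by rewrite normr_gt0.
have bnd s : `|s| < 2 * `|t| ->
   `|s *: u + t *: v| <= 2 * N * `|t| /\ `|s *: u| <= 2 * N * `|t|.
  move=> st; have Hu : `|s *: u| <= 2 * `|t| * `|u|.
    by rewrite normrZ ler_wpM2r// ltW.
  have Hv : `|t *: v| = `|t| * `|v| by rewrite normrZ.
  have u0 := normr_ge0 u; have v0 := normr_ge0 v.
  split; last by apply: le_trans Hu _; rewrite /N; nra.
  apply: le_trans (ler_normD _ _) _; rewrite Hv.
  by apply: le_trans (lerD Hu (lexx _)) _; rewrite /N; nra.
have tN : 2 * N * `|t| < d by rewrite mulrC -ltr_pdivlMr// mulr_gt0.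
pose k s := f (x + s *: u + t *: v) - f (x + s *: u) - (f (x + t *: v) - f x)
   - 'D_v ('D_u f) x * (t * s).
pose k' s := 'D_u f (x + s *: u + t *: v) - 'D_u f (x + s *: u) - 'D_v ('D_u f) x * t.
have -> : f (x + t *: u + t *: v) - f (x + t *: u) - (f (x + t *: v) - f x)
   - 'D_v ('D_u f) x * t ^+ 2 = k t by rewrite /k expr2.
have -> : e * t ^+ 2 = e * `|t| * `|t| ^+ 1.
  by rewrite expr1 -mulrA -expr2 real_normK// num_real.
(* The radius is 2 |t| because the estimate is evaluated at t itself, which must lie strictly
   inside. *)
apply: (@mvt_bound _ k k' (e * `|t|) (2 * `|t|) 0).
- by rewrite mulr_gt0.
- by rewrite mulr_ge0// ltW.
- move=> s st; have [B1 B2] := bnd s st.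
  have [A1 _] := Hd _ (le_lt_trans B1 tN); have [A2 _] := Hd _ (le_lt_trans B2 tN).
  have D1 : is_derive (s : R) 1 (fun s : R => f (x + s *: u + t *: v)) ('D_u f (x + s *: u + t *: v)).
    have L : is_derive (s : R) 1 (fun s : R => x + s *: u + t *: v) u.
      have -> : (fun s : R => x + s *: u + t *: v) = (fun s : R => (x + t *: v) + s *: u).
        by apply/funext => ?; rewrite addrAC.
      exact: is_derive_line.
    apply: (is_derive_comp L); rewrite -addrA; exact: fd.
  have D2 : is_derive (s : R) 1 (fun s : R => f (x + s *: u)) ('D_u f (x + s *: u)).
    by apply: (is_derive_comp (is_derive_line _ _ _)); exact: fd.
  have D3 : is_derive (s : R) 1 (fun s : R => 'D_v ('D_u f) x * (t * s)) ('D_v ('D_u f) x * t).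
    have -> : (fun s : R => 'D_v ('D_u f) x * (t * s)) = (fun s : R => 0 + s *: ('D_v ('D_u f) x * t)).
      by apply/funext => r; rewrite add0r /GRing.scale /=; ring.
    exact: is_derive_line.
  have := is_deriveB (is_deriveB (is_deriveB D1 D2) (is_derive_cst (f (x + t *: v) - f x) s 1)) D3.
  by rewrite subr0.
- move=> s st; rewrite expr0 mulr1; have [B1 B2] := bnd s st.
  have [_ E1] := Hd _ (le_lt_trans B1 tN); have [_ E2] := Hd _ (le_lt_trans B2 tN).
  have -> : k' s = ('D_u f (x + (s *: u + t *: v)) - 'D_u f x - 'd ('D_u f) x (s *: u + t *: v))
     - ('D_u f (x + s *: u) - 'D_u f x - 'd ('D_u f) x (s *: u)).
    rewrite /k' addrA linearD /= linearZ /= [X in _ = _ - X - _]addrC.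
    rewrite [in 'd _ _ (t *: v)]linearZ /= (deriveE v du) /GRing.scale /=; ring.
  apply: le_trans (ler_normB _ _) _.
  apply: le_trans (lerD E1 E2) _; rewrite -mulrDr.
  have e4 : 0 < e / (4 * N) := e'0.
  have -> : e * `|t| = e / (4 * N) * (2 * N * `|t| + 2 * N * `|t|).
    by field; rewrite gt_eqF.
  by rewrite ler_wpM2l//; [exact: ltW|exact: lerD].
- by rewrite /k scale0r addr0 subrr mulr0 mulr0 subr0.
- by rewrite ltr_pMl// ltr1n.
Unshelve. all: by end_near. Qed.

(** Young's form of the symmetry theorem: the second difference is symmetric in u and v, so both
    mixed derivatives, multiplied by t^2, lie within e t^2 / 2 of the same number. *)
Lemma derive_comm V (f : V -> R) (A : set V) x u v : open A -> A x ->
  (forall y, A y -> differentiable f y) -> differentiable ('D_u f) x ->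
  differentiable ('D_v f) x -> 'D_u ('D_v f) x = 'D_v ('D_u f) x.
Proof.
move=> oA Ax fd du dv; apply/eqP; rewrite -subr_eq0 -normr_le0.
apply/ler_addgt0Pr => e e0; rewrite add0r.
have e2 : 0 < e / 2 by rewrite divr_gt0.
have /near0P[r r0 Hr] := second_difference v oA Ax fd du e2.
have /near0P[r' r'0 Hr'] := second_difference u oA Ax fd dv e2.
pose t := Num.min r r' / 2.
have m0 : 0 < Num.min r r' by rewrite lt_min r0.
have t0 : 0 < t by rewrite divr_gt0.
have tm : `|t| < Num.min r r' by rewrite gtr0_norm// ltr_pdivrMr// ltr_pMr// ltr1n.
move: tm; rewrite lt_min => /andP[/Hr H1 /Hr' H2].
rewrite -(@ler_pM2r _ (t ^+ 2)) ?exprn_gt0//.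
have -> : e * t ^+ 2 = e / 2 * t ^+ 2 + e / 2 * t ^+ 2 by field.
apply: le_trans (lerD H1 H2); rewrite -{1}(ger0_norm (sqr_ge0 t)) -normrM.
apply: le_trans (ler_normB _ _); rewrite le_eqVlt; apply/orP; left; apply/eqP.
congr `| _|; rewrite (addrAC x (t *: v)).
move: ('D_u ('D_v f) x) ('D_v ('D_u f) x) (f (x + t *: u + t *: v))
  (f (x + t *: u)) (f (x + t *: v)) (f x) (t ^+ 2) => p q r1 r2 r3 r4 s.
by ring.
Qed.

End DirectionalDerivatives.

(** * Stability properties of the classes C^k *)

Section SmoothFunctions.
Context {R : realType}.
Implicit Types U V W : normedModType R.

Lemma open_near V (A : set V) x : open A -> A x -> \forall y \near x, A y.
Proof. by move=> oA Ax; exact: open_nbhs_nbhs. Qed.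

Lemma is_CkW V W k (A : set V) (f : V -> W) : is_Ck k.+1 A f -> is_Ck k A f.
Proof.
elim: k f => [|k IH] f [fd fC].
  by move=> x Ax; exact/differentiable_continuous/fd.
by split=> // v; exact: IH (fC v).
Qed.

Lemma is_Ck_eq V W k (A : set V) (f g : V -> W) : open A ->
  (forall x, A x -> f x = g x) -> is_Ck k A f -> is_Ck k A g.
Proof.
move=> oA; elim: k f g => [|k IH] f g fg.
  move=> fc x Ax; have : \forall y \near x, f y = g y.
    by apply: filterS (open_near oA Ax) => y; exact: fg.
  move=> fgx; rewrite /prop_for /continuous_at -(fg _ Ax).
  by apply: cvg_trans (fc x Ax); apply: near_eq_cvg; apply: filterS fgx => y ->.
move=> [fd fC]; split=> [x Ax|v].
  apply: near_differentiable (fd x Ax).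
  by apply: filterS (open_near oA Ax) => y; exact: fg.
apply: IH (fC v) => x Ax; apply: near_derive_eq.
by apply: filterS (open_near oA Ax) => y; exact: fg.
Qed.

Lemma is_Ck_cst V W k (A : set V) (c : W) : is_Ck k A (fun=> c).
Proof.
elim: k c => [|k IH] c; first by move=> x _; exact: cst_continuous.
split=> [x _|v]; first exact: differentiable_cst.
have -> : (fun x => 'D_v (fun=> c) x) = fun=> (0 : W).
  by apply/funext => x; exact: derive_cst.
exact: IH.
Qed.

Lemma is_CkD V W k (A : set V) (f g : V -> W) : open A ->
  is_Ck k A f -> is_Ck k A g -> is_Ck k A (fun x => f x + g x).
Proof.
move=> oA; elim: k f g => [|k IH] f g.
  by move=> fc gc x Ax; apply: cvgD; [exact: fc|exact: gc].
move=> [fd fC] [gd gC]; split=> [x Ax|v].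
  by apply: differentiableD; [exact: fd|exact: gd].
apply: is_Ck_eq (IH _ _ (fC v) (gC v)) => // x Ax.
have [_ ->//] := is_deriveD (is_derive_diff v (fd x Ax)) (is_derive_diff v (gd x Ax)).
Qed.

Lemma is_CkM V k (A : set V) (f g : V -> R) : open A ->
  is_Ck k A f -> is_Ck k A g -> is_Ck k A (fun x => f x * g x).
Proof.
move=> oA; elim: k f g => [|k IH] f g.
  by move=> fc gc x Ax; apply: cvgM; [exact: fc|exact: gc].
move=> fC gC; have fC' := is_CkW fC; have gC' := is_CkW gC.
have [fd fDC] := fC; have [gd gDC] := gC; split=> [x Ax|v].
  by apply: differentiableM; [exact: fd|exact: gd].
apply: is_Ck_eq (is_CkD oA (IH _ _ (fDC v) gC') (IH _ _ fC' (gDC v))) => // x Ax.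
have H := is_derive_mul (is_derive_diff v (fd x Ax)) (is_derive_diff v (gd x Ax)).
by rewrite (@derive_val _ _ _ _ _ _ _ H).
Qed.

Lemma is_Ck_sum V W k (A : set V) (I : Type) (r : seq I) (P : pred I) (f : I -> V -> W) :
  open A -> (forall i, P i -> is_Ck k A (f i)) ->
  is_Ck k A (fun x => \sum_(i <- r | P i) f i x).
Proof.
move=> oA fC; elim: r => [|i r IH].
  by under eq_fun do rewrite big_nil; exact: is_Ck_cst.
under eq_fun do rewrite big_cons.
by case: (boolP (P i)) => // Pi; apply: is_CkD => //; exact: fC.
Qed.

Lemma is_Ck_linear V W k (A : set V) (L : {linear V -> W}) : continuous L ->
  is_Ck k A L.
Proof.
move=> Lc; case: k => [|k]; first by move=> x _; exact: Lc.
split=> [x _|v]; first exact: linear_differentiable.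
have -> : (fun x => 'D_v L x) = fun=> L v.
  apply/funext => x; rewrite deriveE; last exact: linear_differentiable.
  by rewrite diff_lin.
exact: is_Ck_cst.
Qed.

Lemma is_Ck_precomp U V W k (A : set V) (L : {linear U -> V}) (f : V -> W) : open A ->
  continuous L -> is_Ck k A f -> is_Ck k (L @^-1` A) (f \o L).
Proof.
move=> oA Lc; have oB : open (L @^-1` A) by apply: open_comp.
elim: k f => [|k IH] f.
  move=> fc x Ax; apply: continuous_comp; [exact: Lc|exact: fc].
move=> [fd fC]; have Ld x : differentiable L x by exact: linear_differentiable.
split=> [x Ax|v]; first by apply: differentiable_comp => //; exact: fd.
apply: is_Ck_eq (IH _ (fC (L v))) => // x Ax /=.
by rewrite derive_comp ?deriveE ?diff_lin//; exact: fd.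
Qed.

Lemma is_Ck_postcomp V U W k (A : set V) (L : {linear U -> W}) (f : V -> U) : open A ->
  continuous L -> is_Ck k A f -> is_Ck k A (L \o f).
Proof.
move=> oA Lc; elim: k f => [|k IH] f.
  move=> fc x Ax; apply: continuous_comp; [exact: fc|exact: Lc].
move=> [fd fC]; have Ld x : differentiable L x by exact: linear_differentiable.
split=> [x Ax|v]; first by apply: differentiable_comp => //; exact: fd.
apply: is_Ck_eq (IH _ (fC v)) => // x Ax.
by have [_ ->] := is_derive_linear Lc (is_derive_diff v (fd x Ax)).
Qed.

End SmoothFunctions.

(** Each level carries the derivative as a witness valid on a whole neighbourhood of 0: taking
    [dnear 4] apart hands over the functions [b1], ..., [b4] on which the determinant expansion is
    based. *)
Fixpoint dnear {R : realType} {W : normedModType R} (k : nat) (f : R -> W) : Prop :=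
  if k is k'.+1 then
    exists2 g : R -> W, \forall t \near (0 : R), is_derive (t : R) 1 f (g t) & dnear k' g
  else True.

Section SmoothCurves.
Context {R : realType}.
Implicit Types U V W : normedModType R.

Lemma dnear_cst W k (c : W) : dnear k (fun=> c).
Proof.
elim: k c => // k IH c; exists (fun=> 0); last exact: IH.
by near=> t; exact: is_derive_cst.
Unshelve. all: by end_near. Qed.

Lemma dnearW W k (f : R -> W) : dnear k.+1 f -> dnear k f.
Proof. by elim: k f => // k IH f [g fg /IH gk]; exists g. Qed.

Lemma dnearD W k (f g : R -> W) : dnear k f -> dnear k g ->
  dnear k (fun t => f t + g t).
Proof.
elim: k f g => // k IH f g [f' Hf f'k] [g' Hg g'k].
exists (fun t => f' t + g' t); last exact: IH.
by near=> t; apply: is_deriveD; near: t.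
Unshelve. all: by end_near. Qed.

Lemma dnearM k (f g : R -> R) : dnear k f -> dnear k g ->
  dnear k (fun t => f t * g t).
Proof.
elim: k f g => // k IH f g fk gk.
have fk' := dnearW fk; have gk' := dnearW gk.
have [f' Hf f'k] := fk; have [g' Hg g'k] := gk.
exists (fun t => f' t * g t + f t * g' t); last first.
  by apply: dnearD; exact: IH.
by near=> t; apply: is_derive_mul; near: t.
Unshelve. all: by end_near. Qed.

Lemma dnear_sum W k (I : Type) (r : seq I) (P : pred I) (f : I -> R -> W) :
  (forall i, P i -> dnear k (f i)) -> dnear k (fun t => \sum_(i <- r | P i) f i t).
Proof.
move=> H; elim: r => [|i r IH].
  by under eq_fun do rewrite big_nil; exact: dnear_cst.
under eq_fun do rewrite big_cons.
by case: (boolP (P i)) => // Pi; apply: dnearD => //; exact: H.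
Qed.

Lemma dnear_prod k (I : Type) (r : seq I) (P : pred I) (f : I -> R -> R) :
  (forall i, P i -> dnear k (f i)) -> dnear k (fun t => \prod_(i <- r | P i) f i t).
Proof.
move=> H; elim: r => [|i r IH].
  by under eq_fun do rewrite big_nil; exact: dnear_cst.
under eq_fun do rewrite big_cons.
by case: (boolP (P i)) => // Pi; apply: dnearM => //; exact: H.
Qed.

Lemma dnear_eq W k (f g : R -> W) : (\forall t \near (0 : R), f t = g t) ->
  dnear k f -> dnear k g.
Proof.
case: k => // k /near_join fg [f' ff' f'k]; exists f' => //.
by apply: filterS2 fg ff' => t; exact: near_eq_is_derive.
Qed.

Lemma dnear_cvg W k (f : R -> W) : dnear k.+1 f -> f @ (0 : R) --> f 0.
Proof.
move=> [g /nbhs_singleton [fd _] _].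
by apply/differentiable_continuous/derivable1_diffP.
Qed.

Lemma dnearV k (f : R -> R) : f 0 != 0 -> dnear k f -> dnear k (fun t => (f t)^-1).
Proof.
move=> f0; elim: k => // k IH fk.
have fk' := dnearW fk; have [f' Hf f'k] := fk.
exists (fun t => - ((f t)^-1 * (f t)^-1) * f' t); last first.
  apply: dnearM => //; have -> : (fun t => - ((f t)^-1 * (f t)^-1)) =
     fun t => -1 * ((f t)^-1 * (f t)^-1) by apply/funext => t; rewrite mulN1r.
  by apply: dnearM; [exact: dnear_cst|apply: dnearM; exact: IH].
have fn0 : \forall t \near (0 : R), f t != 0 by exact: (cvgr_neq0 _ (dnear_cvg fk)).
near=> t; have ft : f t != 0 by near: t.
have [fd <-] : is_derive (t : R) 1 f (f' t) by near: t.
split; first exact: derivableV.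
by rewrite deriveV// /GRing.scale /= expr2 invfM.
Unshelve. all: by end_near. Qed.

Lemma dnear_mx k m n (M : R -> 'M[R]_(m, n)) :
  (forall i j, dnear k (fun t => M t i j)) -> dnear k M.
Proof.
elim: k M => // k IH M H.
have /choice[g Hg] : forall ij : 'I_m * 'I_n, exists g : R -> R,
   (\forall t \near (0 : R), is_derive (t : R) 1 (fun t => M t ij.1 ij.2) (g t)) /\ dnear k g.
  by move=> [i j]; have [g] := H i j; exists g.
exists (fun t => \matrix_(i, j) g (i, j) t); last first.
  by apply: IH => i j; under eq_fun do rewrite mxE; exact: (Hg (i, j)).2.
have : \forall t \near (0 : R), forall ij, is_derive (t : R) 1 (fun t => M t ij.1 ij.2) (g ij t).
  by exact: (@filter_forall R ('I_m * 'I_n)%type (fun ij t => is_derive (t : R) 1 (fun t => M t ij.1 ij.2) (g ij t)) (nbhs (0 : R)) _ (fun ij => (Hg ij).1)).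
apply: filterS => t Ht; apply/is_derive_mxP => i j; rewrite mxE.
exact: (Ht (i, j)).
Qed.

Lemma dnear_entry k m n (M : R -> 'M[R]_(m, n)) i j :
  dnear k M -> dnear k (fun t => M t i j).
Proof.
elim: k M => // k IH M [M' H M'k]; exists (fun t => M' t i j); last exact: IH.
by apply: filterS H => t /is_derive_mxP.
Qed.

Lemma dnear_mulmx k m n p (A : R -> 'M[R]_(m, n)) (B : R -> 'M[R]_(n, p)) :
  dnear k A -> dnear k B -> dnear k (fun t => A t *m B t).
Proof.
move=> HA HB; apply: dnear_mx => i j; under eq_fun do rewrite mxE.
by apply: dnear_sum => l _; apply: dnearM; exact: dnear_entry.
Qed.

Lemma dnear_det k n (A : R -> 'M[R]_n) : dnear k A -> dnear k (fun t => \det (A t)).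
Proof.
move=> HA; apply: dnear_sum => s _; apply: dnearM; first exact: dnear_cst.
by apply: dnear_prod => i _; exact: dnear_entry.
Qed.

Lemma near_unitmx n (A : R -> 'M[R]_n) : A 0 \in unitmx -> dnear 1 A ->
  \forall t \near (0 : R), A t \in unitmx.
Proof.
move=> A0 /dnear_det /dnear_cvg detc.
have A0' : \det (A 0) != 0 by rewrite -unitfE.
by apply: filterS (cvgr_neq0 _ detc A0') => t; rewrite unitmxE unitfE.
Qed.

Lemma dnear_invmx k n (A : R -> 'M[R]_n) : A 0 \in unitmx ->
  dnear k A -> dnear k (fun t => invmx (A t)).
Proof.
case: k => // k A0 Ak.
have A1 : dnear 1 A by have [g] := Ak; exists g.
(* [invmx] is defined by cases and agrees with the smooth expression adj / det only where the matrix
   is invertible, that is near 0. *)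
apply: (@dnear_eq _ _ (fun t => (\det (A t))^-1 *: \adj (A t))).
  apply: filterS (near_unitmx A0 A1) => t At.
  by rewrite /invmx At.
apply: dnear_mx => i j; under eq_fun do rewrite mxE.
apply: dnearM; first by apply: dnearV; [rewrite -unitfE|exact: dnear_det].
under eq_fun do rewrite mxE; apply: dnearM; first exact: dnear_cst.
apply: dnear_det; apply: dnear_mx => i' j'; under eq_fun do rewrite !mxE.
exact: dnear_entry.
Qed.

Lemma derive_coord n W (f : 'rV[R]_n -> W) x v : differentiable f x ->
  'D_v f x = \sum_j v 0 j *: 'D_(delta_mx 0 j) f x.
Proof.
move=> fx; rewrite {1}[v]row_sum_delta derive_dir_sum//.
by apply: eq_bigr => j _; rewrite derive_dirZ.
Qed.

Lemma dnear_comp k n (A : set 'rV[R]_n) (f : 'rV[R]_n -> R) (y : R -> 'rV[R]_n) :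
  (\forall t \near (0 : R), A (y t)) -> is_Ck k A f -> dnear k y -> dnear k (f \o y).
Proof.
move=> Ay; elim: k f => // k IH f [fd fC] yk.
have [y' Hy y'k] := yk.
exists (fun t => \sum_j y' t 0 j * 'D_(delta_mx 0 j) f (y t)); last first.
  apply: dnear_sum => j _; apply: dnearM; first exact: dnear_entry.
  exact: (IH _ (fC _) (dnearW yk)).
near=> t; have yt : is_derive (t : R) 1 y (y' t) by near: t.
have At : A (y t) by near: t.
have := is_derive_comp yt (fd _ At); rewrite derive_coord//.
exact: fd.
Unshelve. all: by end_near. Qed.

Lemma is_derive_line1 V W (f : R * V -> W) (t : R) z : differentiable f (t, z) ->
  is_derive (t : R) 1 (fun s => f (s, z)) ('D_(1, 0) f (t, z)).
Proof.
move=> fd; have L := @is_derive_line R (R * V)%type (0, z) (1, 0) t.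
have E : (fun s : R => (0, z) + s *: (1, 0)) = fun s : R => (s, z) :> (R * V)%type.
  apply/funext => s; congr (_, _) => /=.
    by rewrite add0r /GRing.scale /= mulr1.
  by rewrite scaler0 addr0.
by rewrite E in L; exact: (is_derive_comp L).
Qed.

Lemma dnear_line k V W (Q : set (R * V)) (f : R * V -> W) z :
  (\forall t \near (0 : R), Q (t, z)) -> is_Ck k Q f -> dnear k (fun t => f (t, z)).
Proof.
move=> Qz; elim: k f => // k IH f [fd fC].
exists (fun t => 'D_(1, 0) f (t, z)); last exact: IH (fC _).
by apply: filterS Qz => t Qt; apply: is_derive_line1; exact: fd.
Qed.

End SmoothCurves.

(** * Vectors, covectors and forms in charts *)

Section Pairing.
Context {R : realType}.
Implicit Types V W : normedModType R.

Definition entry m n (i : 'I_m) (j : 'I_n) (A : 'M[R]_(m, n)) : R := A i j.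

Lemma entry_is_linear m n (i : 'I_m) (j : 'I_n) : linear (entry i j).
Proof. by move=> a A B; rewrite /entry !mxE. Qed.

HB.instance Definition _ m n (i : 'I_m) (j : 'I_n) :=
  GRing.isLinear.Build R 'M[R]_(m, n) R *%R (entry i j) (entry_is_linear i j).

Lemma entry_continuous m n (i : 'I_m) (j : 'I_n) : continuous (entry i j).
Proof. exact: coord_continuous. Qed.

Lemma is_Ck_entry V k (A : set V) m n (f : V -> 'M[R]_(m, n)) i j : open A ->
  is_Ck k A f -> is_Ck k A (fun x => f x i j).
Proof.
move=> oA fC.
exact: (@is_Ck_postcomp _ _ _ _ k A (entry i j) f oA (@entry_continuous _ _ i j) fC).
Qed.

Lemma derive_comm_mx V (A : set V) m n (f : V -> 'M[R]_(m, n)) x u v :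
  open A -> A x -> is_Ck 2 A f -> 'D_u ('D_v f) x = 'D_v ('D_u f) x.
Proof.
move=> oA Ax [fd fC].
have fdv w : differentiable ('D_w f) x by have [/(_ _ Ax)] := fC w.
have E w w' i j : ('D_w ('D_w' f) x) i j = 'D_w ('D_w' (fun y => f y i j)) x.
  rewrite derive_mx; last exact: diff_derivable.
  rewrite mxE; apply: near_derive_eq.
  apply: filterS (open_near oA Ax) => y Ay; rewrite derive_mx ?mxE//.
  exact/diff_derivable/fd.
apply/matrixP => i j; transitivity ('D_u ('D_v (fun y => f y i j)) x); first exact: E.
transitivity ('D_v ('D_u (fun y => f y i j)) x); last exact/esym/E.
have [gd gC] := is_Ck_entry i j oA (conj fd fC : is_Ck 2 A f).
by apply: (derive_comm oA Ax) => //; [have [+ _] := gC u|have [+ _] := gC v]; exact.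
Qed.

Lemma pairingDr d (p : 'cV[R]_d) u v : pairing p (u + v) = pairing p u + pairing p v.
Proof. by rewrite /pairing mulmxDl mxE. Qed.
Lemma pairingZr d (p : 'cV[R]_d) a u : pairing p (a *: u) = a * pairing p u.
Proof. by rewrite /pairing -scalemxAl mxE. Qed.
Lemma pairingDl d (p q : 'cV[R]_d) u : pairing (p + q) u = pairing p u + pairing q u.
Proof. by rewrite /pairing mulmxDr mxE. Qed.
Lemma pairingZl d (p : 'cV[R]_d) a u : pairing (a *: p) u = a * pairing p u.
Proof. by rewrite /pairing -scalemxAr mxE. Qed.
Lemma pairing0r d (p : 'cV[R]_d) : pairing p 0 = 0.
Proof. by rewrite /pairing mul0mx mxE. Qed.
Lemma pairing0l d (u : 'rV[R]_d) : pairing 0 u = 0.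
Proof. by rewrite /pairing mulmx0 mxE. Qed.
Lemma pairingNr d (p : 'cV[R]_d) u : pairing p (- u) = - pairing p u.
Proof. by rewrite -scaleN1r pairingZr mulN1r. Qed.
Lemma pairing_sumr d (p : 'cV[R]_d) (I : Type) (r : seq I) (P : pred I) (u : I -> 'rV[R]_d) :
  pairing p (\sum_(i <- r | P i) u i) = \sum_(i <- r | P i) pairing p (u i).
Proof. by rewrite /pairing mulmx_suml summxE. Qed.

Lemma pairing_delta d (p : 'cV[R]_d) j : pairing p (delta_mx 0 j) = p j 0.
Proof. by rewrite /pairing -rowE mxE. Qed.

Lemma pairing_inj d (p q : 'cV[R]_d) : (forall v, pairing p v = pairing q v) -> p = q.
Proof.
move=> H; apply/matrixP => i j; rewrite ord1.
by rewrite -!pairing_delta.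
Qed.

Lemma is_derive_pairing V d (p : V -> 'cV[R]_d) (u : V -> 'rV[R]_d) dp du x v :
  is_derive x v p dp -> is_derive x v u du ->
  is_derive x v (fun y => pairing (p y) (u y)) (pairing dp (u x) + pairing (p x) du).
Proof.
move=> Hp Hu; have /is_derive_mxP /(_ 0 0) := is_derive_mulmx Hu Hp.
by rewrite mxE addrC.
Qed.

End Pairing.

Section Charts.
Context {R : realType} {d : nat} {M : manifold R d}.
Implicit Types (x : M) (i j k : chart_index M) (U : set M) (v : 'rV[R]_d) (p : 'cV[R]_d).

Lemma image_chart_open i U : open U -> open (chart i @` (U `&` dom i)).
Proof.
move=> oU; rewrite openE => y [x [Ux ix] <-]; rewrite /interior.
have ny : nbhs (chart i x) (chart i @` dom i).
  by apply: open_nbhs_nbhs; split; [exact: image_open|exists x].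
have nU : nbhs (chart i x) (chart_inv i @^-1` U).
  apply: (@chart_inv_continuous _ _ M i (chart i x)); first by exists x.
  by rewrite chartK//; exact: open_nbhs_nbhs.
apply: filterS2 ny nU => _ [x' ix' <-] /=; rewrite chartK// => Ux'.
by exists x'.
Qed.

Lemma overlap_open i j : open (chart i @` (dom i `&` dom j)).
Proof. by rewrite setIC; apply: image_chart_open; exact: dom_open. Qed.

Lemma transition_diff i j x : dom i x -> dom j x ->
  differentiable (chart j \o chart_inv i) (chart i x).
Proof.
move=> ix jx; have [] := @transition_smooth _ _ M i j 1; move=> + _; apply.
by exists x.
Qed.

Lemma transition_id i x v : dom i x -> 'D_v (chart i \o chart_inv i) (chart i x) = v.
Proof.
move=> ix; rewrite -[RHS](derive_id (chart i x) v); apply: near_derive_eq.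
have : nbhs (chart i x) (chart i @` dom i).
  by apply: open_nbhs_nbhs; split; [exact: image_open|exists x].
by apply: filterS => _ [x' ix' <-] /=; rewrite chartK.
Qed.

Lemma transition_comp i j k x v : dom i x -> dom j x -> dom k x ->
  'D_v (chart k \o chart_inv i) (chart i x) =
  'D_('D_v (chart j \o chart_inv i) (chart i x)) (chart k \o chart_inv j) (chart j x).
Proof.
move=> ix jx kx.
have -> : 'D_v (chart k \o chart_inv i) (chart i x) =
  'D_v ((chart k \o chart_inv j) \o (chart j \o chart_inv i)) (chart i x).
  apply: near_derive_eq.
  have : nbhs (chart i x) (chart i @` (dom i `&` dom j)).
    by apply: open_nbhs_nbhs; split; [exact: overlap_open|exists x].
  by apply: filterS => _ [x' [ix' jx'] <-] /=; rewrite !chartK.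
by rewrite derive_comp /= ?chartK//; apply: transition_diff.
Qed.

Lemma vec_inE i x v : dom i x ->
  vec_in i x v = 'D_v (chart i \o chart_inv (chart_at x)) (chart (chart_at x) x).
Proof.
by move=> ix; rewrite deriveE//; apply: transition_diff => //; exact: dom_chart_at.
Qed.

Lemma vec_in_at x v : vec_in (chart_at x) x v = v.
Proof. by rewrite vec_inE ?transition_id//; exact: dom_chart_at. Qed.

Lemma vec_inZ i x a v : vec_in i x (a *: v) = a *: vec_in i x v.
Proof. exact: linearZ. Qed.
Lemma vec_in_sum i x (I : Type) (r : seq I) (P : pred I) (v : I -> 'rV[R]_d) :
  vec_in i x (\sum_(k <- r | P k) v k) = \sum_(k <- r | P k) vec_in i x (v k).
Proof. exact: linear_sum. Qed.

Lemma vec_in_transition i j x v : dom i x -> dom j x ->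
  'D_(vec_in i x v) (chart j \o chart_inv i) (chart i x) = vec_in j x v.
Proof.
move=> ix jx; rewrite !vec_inE// -transition_comp//; exact: dom_chart_at.
Qed.

Lemma vec_inK i x v : dom i x ->
  'D_(vec_in i x v) (chart (chart_at x) \o chart_inv i) (chart i x) = v.
Proof. by move=> ix; rewrite vec_in_transition ?vec_in_at//; exact: dom_chart_at. Qed.

Lemma vec_in_inv i x v : dom i x ->
  vec_in i x ('D_v (chart (chart_at x) \o chart_inv i) (chart i x)) = v.
Proof.
move=> ix; rewrite vec_inE// -transition_comp ?transition_id//; exact: dom_chart_at.
Qed.

Lemma pairing_covec_in i x p v : dom i x ->
  pairing (covec_in i x p) v = pairing p ('D_v (chart (chart_at x) \o chart_inv i) (chart i x)).
Proof.
move=> ix; rewrite /pairing /covec_in mulmxA mul_rV_lin1 deriveE//.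
by apply: transition_diff => //; exact: dom_chart_at.
Qed.

Lemma covec_inE i x p v : dom i x -> pairing (covec_in i x p) (vec_in i x v) = pairing p v.
Proof. by move=> ix; rewrite pairing_covec_in// vec_inK. Qed.

Lemma covec_in_at x p : covec_in (chart_at x) x p = p.
Proof.
have ix := dom_chart_at x.
by apply: pairing_inj => v; rewrite pairing_covec_in// transition_id.
Qed.

Lemma cotangent_of_chart i x p : dom i x ->
  exists2 p', cotangent_of i (chart i x, p) = (x, p') &
    forall v, pairing p' v = pairing p (vec_in i x v).
Proof.
move=> ix; rewrite /cotangent_of /= chartK//; eexists; first by [].
by move=> v; rewrite /pairing mulmxA mul_rV_lin1.
Qed.

Lemma cotangent_inK i (l : cotangent M) : dom i l.1 -> cotangent_of i (cotangent_in i l) = l.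
Proof.
case: l => x p /= ix; rewrite /cotangent_in /=.
have [p' -> H] := cotangent_of_chart (covec_in i x p) ix.
by congr pair; apply: pairing_inj => v; rewrite H covec_inE.
Qed.

Lemma cotangent_ofK i z : (chart i @` dom i) z.1 -> cotangent_in i (cotangent_of i z) = z.
Proof.
case: z => y q /= [x ix <-]; have [p' -> H] := cotangent_of_chart q ix.
rewrite /cotangent_in /=; congr pair; apply: pairing_inj => v.
by rewrite pairing_covec_in// H vec_in_inv.
Qed.

Lemma vfield_in_chart i (X : vfield M) x : dom i x ->
  vfield_in i X (chart i x) = vec_in i x (X x).
Proof. by move=> ix; rewrite /vfield_in chartK. Qed.

Lemma form_in_chart i (w : M -> 'cV[R]_d) x : dom i x ->
  form_in i w (chart i x) = covec_in i x (w x).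
Proof. by move=> ix; rewrite /form_in chartK. Qed.

Local Opaque derive pairing form_in covec_in vec_in.

Definition dform (w : 'rV[R]_d -> 'cV[R]_d) (y u v : 'rV[R]_d) : R :=
  pairing ('D_u w y) v - pairing ('D_v w y) u.

(** Pulling w back by the transition map tau adds the term w(D_u D_v tau). It is symmetric in u and
    v, so the antisymmetrisation removes it, and dw may be computed in any chart although
    [ext_deriv] refers to [chart_at x]. *)
Lemma ext_deriv_chart (w : M -> 'cV[R]_d) i x u v : smooth_form w -> dom i x ->
  ext_deriv w x u v = dform (form_in i w) (chart i x) (vec_in i x u) (vec_in i x v).
Proof.
move=> ws ix; set c := chart_at x; have cx : dom c x := dom_chart_at x.
pose tau := chart i \o chart_inv c.
have taus := @transition_smooth _ _ M c i : is_smooth _ tau.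
have oA : open (chart c @` (dom c `&` dom i)) by exact: overlap_open.
have Ax : (chart c @` (dom c `&` dom i)) (chart c x) by exists x.
have wd k x' : dom k x' -> differentiable (form_in k w) (chart k x').
  by move=> kx'; have [+ _] := ws k 1; apply; exists x'.
have taud v' y : (chart c @` (dom c `&` dom i)) y -> differentiable ('D_v' tau) y.
  by have [_ /(_ v')[+ _]] := taus 2; exact.
have tau1 y : (chart c @` (dom c `&` dom i)) y -> differentiable tau y.
  by have [+ _] := taus 2; exact.
(* Near the point, w_c(v') = (w_i o tau)(D_v' tau), where v' is constant in the chart c; this
   identity is differentiated along u'. *)
have E u' v' : pairing ('D_u' (form_in c w) (chart c x)) v' =
    pairing ('D_(vec_in i x u') (form_in i w) (chart i x)) (vec_in i x v') +
    pairing (form_in i w (chart i x)) ('D_u' ('D_v' tau) (chart c x)).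
  have H1 := is_derive_pairing (is_derive_diff u' (wd _ _ cx)) (is_derive_cst v' (chart c x) u').
  rewrite pairing0r addr0 in H1; have [_ <-] := H1.
  have -> : 'D_u' (fun y => pairing (form_in c w y) (cst v' y)) (chart c x) =
     'D_u' (fun y => pairing ((form_in i w \o tau) y) ('D_v' tau y)) (chart c x).
    apply: near_derive_eq.
    apply: filterS (open_near oA Ax) => _ [x' [cx' ix'] <-] /=.
    have -> : tau (chart c x') = chart i x' by rewrite /tau /= chartK.
    rewrite (form_in_chart w cx') (form_in_chart w ix').
    transitivity (pairing (w x') ('D_v' (chart (chart_at x') \o chart_inv c) (chart c x'))).
      exact: pairing_covec_in.
    rewrite (transition_comp v' cx' ix' (dom_chart_at x')); symmetry.
    exact: pairing_covec_in.
  have tc : tau (chart c x) = chart i x by rewrite /tau /= chartK.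
  have wtd : differentiable (form_in i w \o tau) (chart c x).
    by apply: differentiable_comp; [exact: tau1|rewrite tc; exact: wd].
  have [_ ->] := is_derive_pairing (is_derive_diff u' wtd) (is_derive_diff u' (taud v' _ Ax)).
  rewrite derive_comp ?tc; [|exact: tau1|exact: wd].
  by rewrite -!vec_inE//= tc.
transitivity (pairing ('D_u (form_in c w) (chart c x)) v -
    pairing ('D_v (form_in c w) (chart c x)) u); first by [].
have Eu := E u v; have Ev := E v u.
have C := derive_comm_mx u v oA Ax (taus 2).
apply: (etrans (f_equal2 (fun a b : R => a - b) Eu Ev)).
have cancel (a b s : R) : a + s - (b + s) = a - b.
  by rewrite opprD addrACA subrr addr0.
by rewrite C; exact: cancel.
Qed.

End Charts.

(** * Hamiltonian flows in coordinates *)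

Section PhaseSpace.
Context {R : realType}.
Implicit Types U V W : normedModType R.

Lemma derive_linear V W (L : {linear V -> W}) x v : continuous L -> 'D_v L x = L v.
Proof.
move=> Lc; rewrite deriveE; last exact: linear_differentiable.
by rewrite diff_lin.
Qed.

Lemma differentiable_mx V m n (f : V -> 'M[R]_(m, n)) x :
  (forall i j, differentiable (fun y => f y i j) x) -> differentiable f x.
Proof.
move=> H; have -> : f = fun y => \sum_i \sum_j f y i j *: delta_mx i j.
  by apply/funext => y; exact: matrix_sum_delta.
have sumE (I : finType) (g : I -> V -> 'M[R]_(m, n)) :
    (fun y => \sum_i g i y) = \sum_i g i by apply/funext => y; rewrite fct_sumE.
have Hsum k (g : 'I_k -> V -> 'M[R]_(m, n)) : (forall i, differentiable (g i) x) ->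
    differentiable (fun y => \sum_i g i y) x.
  by move=> gd; rewrite sumE; exact: differentiable_sum.
apply: (Hsum) => i; apply: (Hsum) => j.
exact: differentiableZl.
Qed.

Definition xcoord d (j : 'I_d) (z : 'rV[R]_d * 'cV[R]_d) : R := z.1 0 j.
Definition pcoord d (j : 'I_d) (z : 'rV[R]_d * 'cV[R]_d) : R := z.2 j 0.

Lemma xcoord_is_linear d (j : 'I_d) : linear (xcoord j).
Proof. by move=> a z z'; rewrite /xcoord /= !mxE. Qed.
Lemma pcoord_is_linear d (j : 'I_d) : linear (pcoord j).
Proof. by move=> a z z'; rewrite /pcoord /= !mxE. Qed.

HB.instance Definition _ d (j : 'I_d) :=
  GRing.isLinear.Build R ('rV[R]_d * 'cV[R]_d)%type R *%R (xcoord j) (xcoord_is_linear j).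
HB.instance Definition _ d (j : 'I_d) :=
  GRing.isLinear.Build R ('rV[R]_d * 'cV[R]_d)%type R *%R (pcoord j) (pcoord_is_linear j).

Definition position d (z : 'rV[R]_d * 'cV[R]_d) : 'rV[R]_d := z.1.

Lemma position_is_linear d : linear (@position d).
Proof. by []. Qed.

HB.instance Definition _ d :=
  GRing.isLinear.Build R ('rV[R]_d * 'cV[R]_d)%type 'rV[R]_d *:%R (@position d)
    (@position_is_linear d).

Lemma position_continuous d : continuous (@position d).
Proof. by move=> z; exact: cvg_fst. Qed.

Lemma xcoord_continuous d (j : 'I_d) : continuous (xcoord j).
Proof.
move=> z; apply: (@continuous_comp _ _ _ fst (entry 0 j)); first exact: cvg_fst.
exact: entry_continuous.
Qed.

Lemma pcoord_continuous d (j : 'I_d) : continuous (pcoord j).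
Proof.
move=> z; apply: (@continuous_comp _ _ _ snd (entry j 0)); first exact: cvg_snd.
exact: entry_continuous.
Qed.

Lemma derive_snd U V W (f : U * V -> W) y q w :
  'D_w (fun q => f (y, q)) q = 'D_((0, w)) f (y, q).
Proof.
have E : (fun h : R => h^-1 *: (((fun q => f (y, q)) \o shift q) (h *: w) - f (y, q))) =
    (fun h : R => h^-1 *: ((f \o shift (y, q)) (h *: ((0, w) : U * V)) - f (y, q))).
  apply/funext => h /=; congr (_ *: (_ - _)).
  by congr (f (_, _)) => /=; rewrite scaler0 add0r.
by rewrite /derive E.
Qed.

Lemma derive_fst U V W (f : U * V -> W) y q w :
  'D_w (fun y => f (y, q)) y = 'D_((w, 0)) f (y, q).
Proof.
have E : (fun h : R => h^-1 *: (((fun y => f (y, q)) \o shift y) (h *: w) - f (y, q))) =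
    (fun h : R => h^-1 *: ((f \o shift (y, q)) (h *: ((w, 0) : U * V)) - f (y, q))).
  apply/funext => h /=; congr (_ *: (_ - _)).
  by congr (f (_, _)) => /=; rewrite scaler0 add0r.
by rewrite /derive E.
Qed.

Lemma pairingE d (p : 'cV[R]_d) (v : 'rV[R]_d) : pairing p v = \sum_j v 0 j * p j 0.
Proof. by rewrite /pairing mxE. Qed.

End PhaseSpace.

(** * The sub-Riemannian energy of a local frame *)

Section Hamiltonian.
Context {R : realType} {d m : nat}.
Variables (Om : set 'rV[R]_d) (X : 'I_m -> 'rV[R]_d -> 'rV[R]_d) (om : 'rV[R]_d -> 'cV[R]_d).
Hypothesis Om_open : open Om.
Hypothesis X_smooth : forall k, is_smooth Om (X k).
Hypothesis om_smooth : is_smooth Om om.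
Hypothesis om_X : forall k y, Om y -> pairing (om y) (X k y) = 0.
Implicit Types (z : 'rV[R]_d * 'cV[R]_d).

Let Om2 : set ('rV[R]_d * 'cV[R]_d) := [set z | Om z.1].

Definition frame_coord k z : R := pairing z.2 (X k z.1).
Definition energy z : R := 2^-1 * \sum_k frame_coord k z ^+ 2.
Definition energy_p z : 'rV[R]_d := \sum_k frame_coord k z *: X k z.1.

Lemma phase_open : open Om2.
Proof. by apply: open_comp => // z _; exact: cvg_fst. Qed.

Lemma frame_entry_smooth k j l : is_Ck l Om2 (fun z => X k z.1 0 j).
Proof.
apply: (@is_Ck_precomp _ _ _ _ l Om (@position R d) (fun y => X k y 0 j)) => //.
  exact: position_continuous.
apply: is_Ck_entry => //; exact: X_smooth.
Qed.

Lemma pcoord_smooth j l : is_Ck l Om2 (@pcoord R d j).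
Proof. by apply: is_Ck_linear; exact: pcoord_continuous. Qed.

Lemma frame_coord_smooth k l : is_Ck l Om2 (frame_coord k).
Proof.
have -> : frame_coord k = fun z => \sum_j X k z.1 0 j * pcoord j z.
  by apply/funext => z; rewrite /frame_coord pairingE.
have oO := phase_open.
apply: is_Ck_sum => // j _; apply: is_CkM => //; first exact: frame_entry_smooth.
exact: pcoord_smooth.
Qed.

Lemma energy_smooth l : is_Ck l Om2 energy.
Proof.
have oO := phase_open.
apply: is_CkM => //; first exact: is_Ck_cst.
apply: is_Ck_sum => // k _; under eq_fun do rewrite expr2.
by apply: is_CkM => //; exact: frame_coord_smooth.
Qed.

Lemma energy_p_entry_smooth j l : is_Ck l Om2 (fun z => energy_p z 0 j).
Proof.
have oO := phase_open.
have -> : (fun z => energy_p z 0 j) = fun z => \sum_k frame_coord k z * X k z.1 0 j.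
  by apply/funext => z; rewrite /energy_p summxE; apply: eq_bigr => k _; rewrite mxE.
apply: is_Ck_sum => // k _; apply: is_CkM => //; first exact: frame_coord_smooth.
exact: frame_entry_smooth.
Qed.

Lemma energy_p_diff z : Om z.1 -> differentiable energy_p z.
Proof.
move=> Oz; apply: differentiable_mx => i j; rewrite ord1.
by have [+ _] := energy_p_entry_smooth j 1; exact.
Qed.

Lemma derive_frame_coord_p k z (w : 'cV[R]_d) :
  'D_((0, w)) (frame_coord k) z = pairing w (X k z.1).
Proof.
case: z => y q; rewrite -derive_snd /frame_coord /=.
have [_ ->] := is_derive_pairing (is_derive_id q w) (is_derive_cst (X k y) q w).
by rewrite pairing0r addr0.
Qed.

Lemma derive_energy_p z (w : 'cV[R]_d) : Om z.1 ->
  'D_((0, w)) energy z = pairing w (energy_p z).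
Proof.
move=> Oz; have fd k : differentiable (frame_coord k) z.
  by have [+ _] := frame_coord_smooth k 1; exact.
have D k : is_derive z ((0, w) : 'rV[R]_d * 'cV[R]_d) (fun z => frame_coord k z ^+ 2)
   (2 * (frame_coord k z * pairing w (X k z.1))).
  have := is_derive_mul (is_derive_diff (0, w) (fd k)) (is_derive_diff (0, w) (fd k)).
  rewrite derive_frame_coord_p.
  have -> : (fun z => frame_coord k z ^+ 2) = fun z => frame_coord k z * frame_coord k z.
    by apply/funext => ?; rewrite expr2.
  by congr is_derive; ring.
have DS := @is_derive_big_sum R _ _ _ (index_enum 'I_m) xpredT _ _ z (0, w) (fun k _ => D k).
have [_ E] := is_deriveZ 2^-1 DS.
rewrite /energy; apply: (etrans E); rewrite /energy_p pairing_sumr scaler_sumr.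
apply: eq_bigr => k _; rewrite pairingZr.
by apply: (mulKf (_ : 2 != 0 :> R)); rewrite pnatr_eq0.
Qed.

Lemma derive_energy_pp z (w : 'cV[R]_d) : Om z.1 ->
  'D_((0, w)) energy_p z = \sum_k pairing w (X k z.1) *: X k z.1.
Proof.
case: z => y q Oz; rewrite -derive_snd /energy_p /=.
have D k : is_derive q w (fun q => frame_coord k (y, q) *: X k y) (pairing w (X k y) *: X k y).
  have E : is_derive q w (fun q => frame_coord k (y, q)) (pairing w (X k y)).
    have := is_derive_pairing (is_derive_id q w) (is_derive_cst (X k y) q w).
    by rewrite pairing0r addr0.
  apply/is_derive_mxP => i j; rewrite mxE.
  under eq_fun do rewrite mxE.
  have := is_derive_mul E (is_derive_cst (X k y i j) q w).
  by rewrite mulr0 addr0.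
by have [_ ->] := @is_derive_big_sum R _ _ _ (index_enum 'I_m) xpredT _ _ q w (fun k _ => D k).
Qed.

Lemma om_energy_p z : Om z.1 -> pairing (om z.1) (energy_p z) = 0.
Proof.
move=> Oz; rewrite pairing_sumr big1 // => k _.
by rewrite pairingZr om_X// mulr0.
Qed.

(** Differentiates om([energy_p]) = 0, which holds over all of Om. A derivative of the velocity is
    thus traded for a derivative of om, which becomes the second half of d om in
    [is_derive_om_variation]. *)
Lemma om_derive_energy_p z (v : 'rV[R]_d * 'cV[R]_d) : Om z.1 ->
  pairing (om z.1) ('D_v energy_p z) = - pairing ('D_(v.1) om z.1) (energy_p z).
Proof.
move=> Oz; apply/eqP; rewrite -addr_eq0 addrC; apply/eqP.
pose L : {linear ('rV[R]_d * 'cV[R]_d)%type -> 'rV[R]_d} := @position R d.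
have Lc : continuous L by exact: position_continuous.
have omd : differentiable om (L z) by have [+ _] := om_smooth 1; exact.
have Ld : differentiable L z by exact: linear_differentiable.
have E1 : is_derive z v (om \o L) ('D_(v.1) om z.1).
  have Lv : 'D_v L z = v.1 by exact: derive_linear.
  have := derive_comp v Ld omd; rewrite Lv => <-.
  by apply: is_derive_diff; exact: differentiable_comp.
have E := is_derive_pairing E1 (is_derive_diff v (energy_p_diff Oz)).
have [_ <-] := E.
have -> : (0 : R) = 'D_v (cst 0 : _ -> R) z by rewrite derive_cst.
apply: near_derive_eq; apply: filterS (open_near phase_open Oz) => z' Oz' /=.
exact: om_energy_p.
Qed.

End Hamiltonian.

Section SecondDerivative.
Context {R : realType} {V : normedModType R}.
Variables (A : set V) (f : V -> R) (x : V).
Hypothesis oA : open A.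
Hypothesis Ax : A x.
Hypothesis fC : is_Ck 2 A f.

Lemma derive2_diff w : differentiable ('D_w f) x.
Proof. by have [_ /(_ w)[+ _]] := fC; exact. Qed.

Lemma derive2C a b : 'D_a ('D_b f) x = 'D_b ('D_a f) x.
Proof.
apply: (derive_comm oA Ax); [|exact: derive2_diff|exact: derive2_diff].
by have [+ _] := fC; exact.
Qed.

(** Linearity in the inner direction is obtained by swapping it to the outside, where
    differentiability at the one point x suffices. *)
Lemma derive2D a b c : 'D_a ('D_(b + c) f) x = 'D_a ('D_b f) x + 'D_a ('D_c f) x.
Proof.
by rewrite derive2C derive_dirD ?(derive2C a)//; exact: derive2_diff.
Qed.

Lemma derive2_sum (I : finType) (c : I -> R) (w : I -> V) a :
  \sum_i c i * 'D_a ('D_(w i) f) x = 'D_a ('D_(\sum_i c i *: w i) f) x.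
Proof.
rewrite derive2C derive_dir_sum; last exact: derive2_diff.
by apply: eq_bigr => i _; rewrite derive_dirZ ?(derive2C a)//; exact: derive2_diff.
Qed.

End SecondDerivative.

Section PairBasis.
Context {R : realType} {d : nat}.
Implicit Types a : 'rV[R]_d * 'cV[R]_d.

Let sum_pair (I : finType) (f : I -> 'rV[R]_d * 'cV[R]_d) :
  \sum_i f i = (\sum_i (f i).1, \sum_i (f i).2).
Proof.
rewrite [LHS]surjective_pairing; congr pair.
  exact: (big_morph fst (fun _ _ => erefl) erefl).
exact: (big_morph snd (fun _ _ => erefl) erefl).
Qed.

Lemma momentum_sum_delta (w : 'cV[R]_d) :
  (0, w) = \sum_j w j 0 *: ((0, delta_mx j 0) : 'rV[R]_d * 'cV[R]_d).
Proof.
rewrite sum_pair; congr pair => /=.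
  by rewrite big1// => j _; rewrite scaler0.
rewrite [LHS]matrix_sum_delta; apply: eq_bigr => j _.
by rewrite big_ord1.
Qed.

Lemma position_sum_delta (v : 'rV[R]_d) :
  (v, 0) = \sum_j v 0 j *: ((delta_mx 0 j, 0) : 'rV[R]_d * 'cV[R]_d).
Proof.
rewrite sum_pair; congr pair => /=.
  by rewrite [LHS]matrix_sum_delta big_ord1.
by rewrite big1// => j _; rewrite scaler0.
Qed.

Lemma phase_split a : a = (a.1, 0) + (0, a.2).
Proof. by case: a => a b; congr pair => /=; rewrite ?addr0 ?add0r. Qed.

End PairBasis.

(** * The linearised Hamiltonian flow *)

Section Variations.
Context {R : realType} {d m : nat}.
Variables (Om : set 'rV[R]_d) (X : 'I_m -> 'rV[R]_d -> 'rV[R]_d) (om : 'rV[R]_d -> 'cV[R]_d).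
Hypothesis Om_open : open Om.
Hypothesis X_smooth : forall k, is_smooth Om (X k).
Hypothesis om_smooth : is_smooth Om om.
Hypothesis om_X : forall k y, Om y -> pairing (om y) (X k y) = 0.
Variables (Q : set (R * ('rV[R]_d * 'cV[R]_d)))
  (Psi : R * ('rV[R]_d * 'cV[R]_d) -> 'rV[R]_d * 'cV[R]_d) (z0 : 'rV[R]_d * 'cV[R]_d).
Local Opaque derive.
Local Notation energy := (energy X).
Local Notation energy_p := (energy_p X).

Definition ham_at (z : 'rV[R]_d * 'cV[R]_d) : 'rV[R]_d * 'cV[R]_d :=
  (\row_j 'D_((0, delta_mx j 0)) energy z, - \col_j 'D_((delta_mx 0 j, 0)) energy z).

Hypothesis Q_open : open Q.
Hypothesis Q0 : Q (0, z0).
Hypothesis Psi_smooth : is_smooth Q Psi.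
Hypothesis Psi_Om : forall sz, Q sz -> Om (Psi sz).1.
Hypothesis Psi0 : forall z, Q (0, z) -> Psi (0, z) = z.
Hypothesis Psi_ham : forall s z, Q (s, z) ->
  is_derive (s : R) 1 (fun s => Psi (s, z)) (ham_at (Psi (s, z))).

Let Om2 : set ('rV[R]_d * 'cV[R]_d) := [set z | Om z.1].
Let Om2_open : open Om2 := phase_open Om_open.

Definition extremal (t : R) := Psi (t, z0).
Definition variation (v : 'rV[R]_d * 'cV[R]_d) (t : R) := 'D_((0, v)) Psi (t, z0).

Let domain_line t : Q (t, z0) -> \forall s \near t, Q (s, z0).
Proof.
move=> Qt; have L := @is_derive_line1 R _ _ id t z0.
have [|D _] := L; first by [].
have C : {for t, continuous (fun s : R => (s, z0))}.
  by apply/differentiable_continuous/derivable1_diffP.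
exact: (C _ (open_near Q_open Qt)).
Qed.

Lemma near_domain : \forall t \near (0 : R), Q (t, z0).
Proof. exact: domain_line. Qed.

Lemma Psi_diff sz : Q sz -> differentiable Psi sz.
Proof. by have [+ _] := Psi_smooth 1; exact. Qed.

Let xcoord_ham j z : xcoord j (ham_at z) = 'D_((0, delta_mx j 0)) energy z.
Proof. by rewrite /xcoord mxE. Qed.

Let pcoord_ham j z : pcoord j (ham_at z) = - 'D_((delta_mx 0 j, 0)) energy z.
Proof. by rewrite /pcoord !mxE. Qed.

Lemma hamE1 z : Om z.1 -> (ham_at z).1 = energy_p z.
Proof.
move=> Oz; apply/matrixP => i j; rewrite ord1 mxE (derive_energy_p Om_open X_smooth)//.
rewrite pairingE (bigD1 j)//= big1 ?mxE ?eqxx ?mulr1 ?addr0// => k kj.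
by rewrite mxE (negbTE kj) mulr0.
Qed.

Lemma is_derive_extremal t : Q (t, z0) ->
  is_derive (t : R) 1 extremal (ham_at (extremal t)).
Proof. exact: Psi_ham. Qed.

Lemma is_derive_position t : Q (t, z0) ->
  is_derive (t : R) 1 (fun t => (extremal t).1) (energy_p (extremal t)).
Proof.
move=> Qt; rewrite -hamE1; last exact: Psi_Om.
exact: (@is_derive_linear _ _ _ _ (@position R d) extremal t 1 _
  (@position_continuous R d) (is_derive_extremal Qt)).
Qed.

Lemma variation0 v : variation v 0 = v.
Proof.
rewrite /variation -derive_snd -[RHS](derive_id z0 v); apply: near_derive_eq.
have C : {for z0, continuous (fun z => (0 : R, z))}.
  apply: differentiable_continuous; apply: differentiable_pair => //.
have N : \forall z \near z0, Q (0, z) by exact: (C _ (open_near Q_open Q0)).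
by apply: filterS N => z; exact: Psi0.
Qed.

(** The variational equation: the derivatives in time and in the initial direction v commute, and
    the time derivative of L o Psi is g o Psi. It is stated for scalar coordinates L because the
    symmetry theorem is. *)
Let coord_variation (L : {linear ('rV[R]_d * 'cV[R]_d)%type -> R})
    (g : 'rV[R]_d * 'cV[R]_d -> R) v t :
  continuous L -> (forall z, Om z.1 -> L (ham_at z) = g z) ->
  (forall z, Om z.1 -> differentiable g z) -> Q (t, z0) ->
  is_derive (t : R) 1 (fun t => L (variation v t)) ('D_(variation v t) g (extremal t)).
Proof.
move=> Lc Lg gd Qt; pose f sz := L (Psi sz).
have fC k : is_Ck k Q f by apply: is_Ck_postcomp => //; exact: Psi_smooth.
have fd sz : Q sz -> differentiable f sz by have [+ _] := fC 1; exact.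
have f1 sz : Q sz -> 'D_((1, 0)) f sz = g (Psi sz).
  case: sz => s z Qsz; have [_ <-] := is_derive_line1 (fd _ Qsz).
  have [_ ->] := is_derive_linear Lc (Psi_ham Qsz).
  by apply: Lg; exact: (Psi_Om Qsz).
have fv : differentiable ('D_((0, v)) f) (t, z0) by exact: (derive2_diff Qt (fC 2)).
have D := is_derive_line1 fv.
have G : 'D_((1, 0)) ('D_((0, v)) f) (t, z0) = 'D_(variation v t) g (extremal t).
  rewrite (derive2C Q_open Qt (fC 2)).
  rewrite /variation /extremal -derive_comp; [|exact: Psi_diff|].
    apply: near_derive_eq; apply: filterS (open_near Q_open Qt) => sz Qsz.
    exact: f1.
  by apply: gd; exact: (Psi_Om Qt).
rewrite G in D; apply: near_eq_is_derive D.
apply: filterS (domain_line Qt) => s Qs.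
by have [_ ->] := is_derive_linear Lc (is_derive_diff (0, v) (Psi_diff Qs)).
Qed.

Let De w z : Om z.1 -> differentiable (fun z => 'D_w energy z) z.
Proof.
move=> Oz; apply: (@derive2_diff _ _ Om2 _ _ Oz).
exact: energy_smooth.
Qed.

Lemma is_derive_variation_x v j t : Q (t, z0) ->
  is_derive (t : R) 1 (fun t => xcoord j (variation v t))
    ('D_(variation v t) ('D_((0, delta_mx j 0)) energy) (extremal t)).
Proof.
apply: (@coord_variation (@xcoord R d j)); first exact: xcoord_continuous.
- by move=> z Oz; exact: xcoord_ham.
- by move=> z Oz; exact: De.
Qed.

Lemma is_derive_variation_p v j t : Q (t, z0) ->
  is_derive (t : R) 1 (fun t => pcoord j (variation v t))
    (- 'D_(variation v t) ('D_((delta_mx 0 j, 0)) energy) (extremal t)).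
Proof.
move=> Qt; have dE := De (delta_mx 0 j, 0) (Psi_Om Qt).
have [_ <-] := is_deriveN (is_derive_diff (variation v t) dE).
apply: (@coord_variation (@pcoord R d j)) => //; first exact: pcoord_continuous.
- by move=> z Oz; exact: pcoord_ham.
- by move=> z Oz; apply: differentiableN; exact: De.
Qed.

Lemma is_derive_variation v t : Q (t, z0) ->
  is_derive (t : R) 1 (fun t => (variation v t).1)
    ('D_(variation v t) energy_p (extremal t)).
Proof.
move=> Qt; apply/is_derive_mxP => i j; rewrite ord1.
have Ot : Om2 (extremal t) by exact: (Psi_Om Qt).
have -> : ('D_(variation v t) energy_p (extremal t)) 0 j =
   'D_(variation v t) ('D_((0, delta_mx j 0)) energy) (extremal t).
  rewrite derive_mx ?mxE; last exact/diff_derivable/(energy_p_diff Om_open X_smooth).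
  apply: near_derive_eq; apply: filterS (open_near Om2_open Ot) => z Oz.
  by rewrite -hamE1//= mxE.
exact: (is_derive_variation_x v j Qt).
Qed.

Definition symplectic (a b : 'rV[R]_d * 'cV[R]_d) : R :=
  pairing b.2 a.1 - pairing a.2 b.1.

Let is_derive_pairing_variation u v t : Q (t, z0) ->
  is_derive (t : R) 1 (fun t => pairing (variation v t).2 (variation u t).1)
    ('D_(variation u t) ('D_((0, (variation v t).2)) energy) (extremal t) -
     'D_(variation v t) ('D_(((variation u t).1, 0)) energy) (extremal t)).
Proof.
move=> Qt; have Ot : Om2 (extremal t) by exact: (Psi_Om Qt).
have eC : is_Ck 2 Om2 energy by exact: energy_smooth.
have E : (fun t => pairing (variation v t).2 (variation u t).1) =
   fun t => \sum_j xcoord j (variation u t) * pcoord j (variation v t).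
  by apply/funext => s; rewrite pairingE.
rewrite E.
have D : is_derive (t : R) 1 (fun t => \sum_j xcoord j (variation u t) * pcoord j (variation v t))
   (\sum_j ('D_(variation u t) ('D_((0, delta_mx j 0)) energy) (extremal t) * pcoord j (variation v t)
     + xcoord j (variation u t) * - 'D_(variation v t) ('D_((delta_mx 0 j, 0)) energy) (extremal t))).
  apply: is_derive_big_sum => j _; apply: is_derive_mul.
    exact: is_derive_variation_x.
  exact: is_derive_variation_p.
apply: (is_derive_eq D); rewrite big_split /=; congr (_ + _).
- under eq_bigr do rewrite mulrC.
  have H := derive2_sum Om2_open Ot eC (fun j => pcoord j (variation v t))
    (fun j => (0, delta_mx j 0)) (variation u t).
  apply: (etrans H); apply: (f_equal (fun w => 'D_(variation u t) ('D_w energy) (extremal t))).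
  exact/esym/momentum_sum_delta.
- under eq_bigr do rewrite mulrN.
  rewrite sumrN; congr (- _).
  have H := derive2_sum Om2_open Ot eC (fun j => xcoord j (variation u t))
    (fun j => (delta_mx 0 j, 0)) (variation v t).
  apply: (etrans H); apply: (f_equal (fun w => 'D_(variation v t) ('D_w energy) (extremal t))).
  exact/esym/position_sum_delta.
Qed.

(** The time derivative is a difference of two values of the Hessian of the energy at the same pair
    of variations, so its symmetry makes the derivative vanish; [mvt_bound] with e = 0 then gives
    constancy. *)
Lemma symplectic_variation u v : \forall t \near (0 : R),
  symplectic (variation u t) (variation v t) = symplectic u v.
Proof.
have /near0P[r r0 Hr] := near_domain.
apply/near0P; exists r => // t tr.
apply/eqP; rewrite -subr_eq0 -normr_le0.
rewrite -(mul0r (`|t| ^+ 1)).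
apply: (@mvt_bound R (fun t => symplectic (variation u t) (variation v t) - symplectic u v)
  (fun=> 0) 0 r 0) => //; last by rewrite !variation0 subrr.
- move=> s /Hr Qs; have Os : Om2 (extremal s) by exact: (Psi_Om Qs).
  have eC : is_Ck 2 Om2 energy by exact: energy_smooth.
  have D := is_deriveB (is_deriveB (is_derive_pairing_variation u v Qs)
    (is_derive_pairing_variation v u Qs)) (is_derive_cst (symplectic u v) s 1).
  apply: (is_derive_eq D); rewrite subr0.
  have E u' v' : 'D_(variation v' s) ('D_(variation u' s) energy) (extremal s) =
    'D_(variation v' s) ('D_(((variation u' s).1, 0)) energy) (extremal s) +
    'D_(variation v' s) ('D_((0, (variation u' s).2)) energy) (extremal s).
    apply: (etrans _ (derive2D Om2_open Os eC _ _ _)).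
    exact: (f_equal (fun w => 'D_(variation v' s) ('D_w energy) (extremal s)) (phase_split _)).
  have C := derive2C Om2_open Os eC (variation u s) (variation v s).
  have {}C := etrans (esym (E v u)) (etrans C (E u v)); move: C.
  have alg (p q r' s' : R) : p + q = r' + s' -> q - r' - (s' - p) = 0.
    by move=> /eqP; rewrite -subr_eq0 => /eqP <-; ring.
  exact: alg.
- by move=> s _; rewrite normr0 mul0r.
Qed.

Lemma is_derive_om_variation v t : Q (t, z0) ->
  is_derive (t : R) 1 (fun t => pairing (om (extremal t).1) (variation v t).1)
   (dform om (extremal t).1 (energy_p (extremal t)) (variation v t).1).
Proof.
move=> Qt; have Ot : Om2 (extremal t) by exact: (Psi_Om Qt).
have omd : differentiable om (extremal t).1 by have [+ _] := om_smooth 1; exact.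
have D := is_derive_pairing (is_derive_comp (is_derive_position Qt) omd)
  (is_derive_variation v Qt).
apply: (is_derive_eq D); rewrite (om_derive_energy_p Om_open X_smooth om_smooth om_X)//.
Qed.

End Variations.

(** The hypotheses say M J M^T = J, the form in which the symplectic products of the rows of M are
    known; the Wronskian needs M^T J M = J. The two are equivalent because a one-sided inverse of a
    square matrix is two-sided. *)
Lemma symplectic_mx_tr (R : realType) d (A B C D : 'M[R]_d) :
  A *m C^T = C *m A^T -> B *m D^T = D *m B^T -> A *m D^T - C *m B^T = 1%:M ->
  A^T *m B = B^T *m A /\ A^T *m D - B^T *m C = 1%:M.
Proof.
move=> AC BD AD; pose J : 'M[R]_(d + d) := block_mx 0 1%:M (- 1%:M) 0.
pose M := block_mx A C B D.
have JJ : J *m J = - 1%:M.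
  rewrite mulmx_block !(mul0mx, mulmx0, mulNmx, mulmxN, mul1mx, mulmx1, add0r, addr0).
  have -> : (1%:M : 'M[R]_(d + d)) = block_mx 1%:M 0 0 1%:M by exact: scalar_mx_block.
  by rewrite opp_block_mx oppr0.
have DA : D *m A^T - B *m C^T = 1%:M.
  by rewrite -[RHS]trmx1 -AD linearB /= !trmx_mul !trmxK.
have MJM : M *m J *m M^T = J.
  rewrite tr_block_mx !mulmx_block.
  rewrite !(mul0mx, mulmx0, mulNmx, mulmxN, mul1mx, mulmx1, add0r, addr0).
  rewrite /J AC BD addNr addNr -[in RHS]AD; congr block_mx; first by rewrite addrC.
  by rewrite AD -DA opprB addrC.
have : (M^T *m - J) *m (M *m J) = 1%:M.
  by apply: mulmx1C; rewrite mulmxA MJM mulmxN JJ opprK.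
move=> /(congr1 (mulmx^~ J)); rewrite -!mulmxA JJ.
rewrite !(mulmxN, mulNmx, opprK, mulmx1, mul1mx).
rewrite tr_block_mx !mulmx_block.
rewrite !(mul0mx, mulmx0, mulNmx, mulmxN, mul1mx, mulmx1, add0r, addr0).
move=> /eq_block_mx [+ + _ _].
by move=> /subr0_eq ? ?.
Qed.

Lemma mul_rows_entry (R : realType) n d p (x : 'I_n -> 'rV[R]_d) (K : 'M[R]_(d, p)) i j :
  ((\matrix_(i < n) x i) *m K) i j = (x i *m K) 0 j.
Proof. by rewrite -[x i](rowK x) -row_mul [RHS]mxE. Qed.

Lemma dform_mulmx (R : realType) d n (om : 'rV[R]_d -> 'cV[R]_d) y u (v : 'rV[R]_n)
    (E : 'M[R]_(n, d)) : differentiable om y ->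
  dform om y u (v *m E) = (v *m \col_j dform om y u (row j E)) 0 0.
Proof.
move=> od; rewrite mulmx_sum_row /dform pairing_sumr derive_dir_sum//.
have pairing_suml (c : 'I_n -> 'cV[R]_d) x : pairing (\sum_i c i) x = \sum_i pairing (c i) x.
  by rewrite /pairing mulmx_sumr summxE.
rewrite pairing_suml -sumrB mxE; apply: eq_bigr => k _.
by rewrite mxE /dform derive_dirZ// pairingZr pairingZl -mulrBr.
Qed.

(** In the application L is the mixed Hessian of the energy, G the vertical one and N1 the
    derivative of N. Both L and N1 are multiplied by A^T B - B^T A, so only G survives. *)
Lemma wronskian_mx (R : realType) d (A B C D L G N N1 : 'M[R]_d) :
  A^T *m B = B^T *m A -> A^T *m D - B^T *m C = 1%:M ->
  (A *m N)^T *m ((B *m L + D *m G) *m N + B *m N1) -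
  (B *m N)^T *m ((A *m L + C *m G) *m N + A *m N1) = N^T *m G *m N.
Proof.
move=> AB AD; rewrite !trmx_mul -!mulmxA -mulmxBr; congr (_ *m _).
rewrite !mulmxDr !mulmxDl !mulmxDr !mulmxA AB.
rewrite opprD addrACA subrr addr0 opprD addrACA subrr add0r.
by rewrite -mulmxBl -mulmxBl AD mul1mx.
Qed.

Section SymplecticRows.
Context {R : realType} {d : nat}.
Implicit Types u v : 'I_d -> 'rV[R]_d * 'cV[R]_d.

Let mul_rows u v i j :
  ((\matrix_(i < d) (u i).1) *m (\matrix_(i < d) ((v i).2)^T)^T) i j =
  pairing (v j).2 (u i).1.
Proof. by rewrite mul_rows_entry mxE pairingE; apply: eq_bigr => k _; rewrite !mxE. Qed.

Let mul_rows' u v i j :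
  ((\matrix_(i < d) ((u i).2)^T) *m (\matrix_(i < d) (v i).1)^T) i j =
  pairing (u i).2 (v j).1.
Proof.
rewrite mul_rows_entry mxE pairingE; apply: eq_bigr => k _.
by rewrite !mxE mulrC.
Qed.

Lemma symplectic_rows u v i j :
  ((\matrix_(i < d) (u i).1) *m (\matrix_(i < d) ((v i).2)^T)^T -
   (\matrix_(i < d) ((u i).2)^T) *m (\matrix_(i < d) (v i).1)^T) i j =
  symplectic (u i) (v j).
Proof. by rewrite mxE [X in _ + X]mxE mul_rows mul_rows'. Qed.

End SymplecticRows.

(** * The Jacobi matrices in a frame moving along the geodesic *)

Section MovingFrame.
Context {R : realType} {m : nat}.
Local Notation d := (1 + m)%N.
Variables (Om : set 'rV[R]_d) (X : 'I_m -> 'rV[R]_d -> 'rV[R]_d) (om : 'rV[R]_d -> 'cV[R]_d).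
Hypothesis Om_open : open Om.
Hypothesis X_smooth : forall k, is_smooth Om (X k).
Hypothesis om_smooth : is_smooth Om om.
Hypothesis om_X : forall k y, Om y -> pairing (om y) (X k y) = 0.
Variables (Q : set (R * ('rV[R]_d * 'cV[R]_d)))
  (Psi : R * ('rV[R]_d * 'cV[R]_d) -> 'rV[R]_d * 'cV[R]_d) (z0 : 'rV[R]_d * 'cV[R]_d).
Hypothesis Q_open : open Q.
Hypothesis Q0 : Q (0, z0).
Hypothesis Psi_smooth : is_smooth Q Psi.
Hypothesis Psi_Om : forall sz, Q sz -> Om (Psi sz).1.
Hypothesis Psi0 : forall z, Q (0, z) -> Psi (0, z) = z.
Hypothesis Psi_ham : forall s z, Q (s, z) ->
  is_derive (s : R) 1 (fun s => Psi (s, z)) (ham_at X (Psi (s, z))).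
Variable v0 : 'rV[R]_d.
Hypothesis om_v0 : pairing (om z0.1) v0 != 0.

Local Opaque derive.

(** The first row is a constant vector rescaled to om = 1, which makes the smoothness of the frame
    immediate. As it is not the Reeb vector for t <> 0 in general, the first component of [w] need
    not vanish. *)
Definition frame_mx (y : 'rV[R]_d) : 'M[R]_d :=
  col_mx ((pairing (om y) v0)^-1 *: v0) (\matrix_(k < m) X k y).

Hypothesis frame_unit : frame_mx z0.1 \in unitmx.

Let z t := extremal Psi z0 t.
Let y t := (z t).1.
Let E t := frame_mx (y t).
Let N t := invmx (E t).
Let e0 : 'cV[R]_d := col_mx 1%:M 0.
(* The initial directions (row i E(0), 0), (0, col j N(0)) form a symplectic
   basis for which A N = 1 and B N = 0 at t = 0. *)
Let A t : 'M[R]_d := \matrix_(i < d) (variation Psi z0 (row i (E 0), 0) t).1.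
Let B t : 'M[R]_d := \matrix_(i < d) (variation Psi z0 (0, col i (N 0)) t).1.
Let C t : 'M[R]_d := \matrix_(i < d) ((variation Psi z0 (row i (E 0), 0) t).2)^T.
Let D t : 'M[R]_d := \matrix_(i < d) ((variation Psi z0 (0, col i (N 0)) t).2)^T.
Let Xm t : 'M[R]_(m, d) := \matrix_(k < m) X k (y t).
Let L t : 'M[R]_d := \matrix_(j < d) 'D_((delta_mx 0 j, 0)) (energy_p X) (z t).
Let ydot t := energy_p X (z t).
Let w t : 'cV[R]_d := \col_j dform om (y t) (ydot t) (row j (E t)).

Let z_0 : z 0 = z0.
Proof. exact: Psi0. Qed.

Let nearQ : \forall t \near (0 : R), Q (t, z0).
Proof. exact: near_domain. Qed.

Let nearOm : \forall t \near (0 : R), Om (y t).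
Proof. by apply: filterS nearQ => t Qt; exact: (Psi_Om Qt). Qed.

Let dnear_coord (L' : {linear ('rV[R]_d * 'cV[R]_d)%type -> R})
    (f : R * ('rV[R]_d * 'cV[R]_d) -> 'rV[R]_d * 'cV[R]_d) k :
  continuous L' -> is_Ck k Q f -> dnear k (fun t => L' (f (t, z0))).
Proof.
move=> Lc fC; apply: (dnear_line (f := L' \o f) nearQ).
exact: is_Ck_postcomp.
Qed.

Let dnear_variation v k : dnear k (fun t => (variation Psi z0 v t).1).
Proof.
apply: dnear_mx => i j; rewrite ord1.
apply: (@dnear_coord (@xcoord R d j) ('D_((0, v)) Psi)); first exact: xcoord_continuous.
by have [_ +] := Psi_smooth k.+1; exact.
Qed.

Let dnear_A k : dnear k A.
Proof.
apply: dnear_mx => i j; under eq_fun do rewrite mxE.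
exact/dnear_entry/dnear_variation.
Qed.

Let dnear_B k : dnear k B.
Proof.
apply: dnear_mx => i j; under eq_fun do rewrite mxE.
exact/dnear_entry/dnear_variation.
Qed.

Let dnear_y k : dnear k y.
Proof.
apply: dnear_mx => i j; rewrite ord1.
exact: (@dnear_coord (@xcoord R d j) Psi k (@xcoord_continuous _ _ j) (Psi_smooth k)).
Qed.

Let dnear_q k : dnear k (fun t => (z t).2).
Proof.
apply: dnear_mx => i j; rewrite ord1.
exact: (@dnear_coord (@pcoord R d i) Psi k (@pcoord_continuous _ _ i) (Psi_smooth k)).
Qed.

Let dnear_along k p q (f : 'rV[R]_d -> 'M[R]_(p, q)) : is_Ck k Om f ->
  dnear k (fun t => f (y t)).
Proof.
move=> fC; apply: dnear_mx => i j.
apply: (dnear_comp (f := fun x => f x i j) nearOm) => //.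
exact: is_Ck_entry.
Qed.

Let dnear_pairing k (p : R -> 'cV[R]_d) (v : R -> 'rV[R]_d) : dnear k p -> dnear k v ->
  dnear k (fun t => pairing (p t) (v t)).
Proof.
by move=> pk vk; exact: (dnear_entry 0 0 (dnear_mulmx vk pk)).
Qed.

Let dnear_scale k p q (f : R -> R) (v : R -> 'M[R]_(p, q)) : dnear k f -> dnear k v ->
  dnear k (fun t => f t *: v t).
Proof.
move=> fk vk; apply: dnear_mx => i j; under eq_fun do rewrite mxE.
by apply: dnearM => //; exact: dnear_entry.
Qed.

Let dnear_E k : dnear k E.
Proof.
apply: dnear_mx => i j.
have [i' iE|i' iE] := split_ordP i.
  have -> : (fun t => E t i j) = fun t => ((pairing (om (y t)) v0)^-1 *: v0) 0 j.
    by apply/funext => t; rewrite iE /E /frame_mx col_mxEu ord1.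
  apply: dnear_entry; apply: dnear_scale; last exact: dnear_cst.
  apply: dnearV; first by rewrite /y z_0.
  by apply: dnear_pairing; [exact: dnear_along|exact: dnear_cst].
have -> : (fun t => E t i j) = fun t => X i' (y t) 0 j.
  by apply/funext => t; rewrite iE /E /frame_mx col_mxEd mxE.
by apply: dnear_entry; apply: dnear_along; exact: X_smooth.
Qed.

Let E0_unit : E 0 \in unitmx.
Proof. by rewrite /E /y z_0. Qed.

Let dnear_N k : dnear k N.
Proof. exact: (dnear_invmx E0_unit (dnear_E k)). Qed.

Let nearE : \forall t \near (0 : R), E t \in unitmx.
Proof. exact: (near_unitmx E0_unit (dnear_E 1)). Qed.

Let dnear_ydot k : dnear k ydot.
Proof.
rewrite /ydot /energy_p; apply: dnear_sum => l _.
have Xk : dnear k (fun t => X l (y t)) by apply: dnear_along; exact: X_smooth.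
by apply: dnear_scale => //; apply: dnear_pairing => //; exact: dnear_q.
Qed.

Let dnear_derive_om k (u : R -> 'rV[R]_d) : dnear k u ->
  dnear k (fun t => 'D_(u t) om (y t)).
Proof.
move=> uk; apply: (@dnear_eq _ _ _ (fun t => \sum_j u t 0 j *: 'D_(delta_mx 0 j) om (y t))).
  apply: filterS nearOm => t Ot; rewrite -derive_coord//.
  by have [+ _] := om_smooth 1; exact.
apply: dnear_sum => j _; apply: dnear_scale; first exact: dnear_entry.
apply: (@dnear_along k d 1 ('D_(delta_mx 0 j) om)).
by have [_ +] := om_smooth k.+1; exact.
Qed.

Let dnear_w k : dnear k w.
Proof.
apply: dnear_mx => i j; under eq_fun do rewrite mxE /dform.
have Ei : dnear k (fun t => row i (E t)).
  by apply: dnear_mx => a b; under eq_fun do rewrite mxE; exact: dnear_entry.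
have H1 : dnear k (fun t => pairing ('D_(ydot t) om (y t)) (row i (E t))).
  by apply: dnear_pairing => //; exact: dnear_derive_om.
have H2 : dnear k (fun t => pairing ('D_(row i (E t)) om (y t)) (ydot t)).
  by apply: dnear_pairing => //; exact: dnear_derive_om.
have -> : (fun t => pairing ('D_(ydot t) om (y t)) (row i (E t)) -
    pairing ('D_(row i (E t)) om (y t)) (ydot t)) =
  fun t => pairing ('D_(ydot t) om (y t)) (row i (E t)) +
    -1 * pairing ('D_(row i (E t)) om (y t)) (ydot t).
  by apply/funext => t; rewrite mulN1r.
by apply: dnearD => //; apply: dnearM => //; exact: dnear_cst.
Qed.

Let near_symplectic : \forall t \near (0 : R),
  (A t)^T *m B t = (B t)^T *m A t /\ (A t)^T *m D t - (B t)^T *m C t = 1%:M.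
Proof.
have S u v := symplectic_variation Om_open X_smooth Q_open Q0 Psi_smooth Psi_Om Psi0 Psi_ham u v.
pose u i : 'rV[R]_d * 'cV[R]_d := (row i (E 0), 0).
pose v i : 'rV[R]_d * 'cV[R]_d := (0, col i (N 0)).
have SF (a b : 'I_d -> 'rV[R]_d * 'cV[R]_d) : \forall t \near (0 : R), forall ij : 'I_d * 'I_d,
   symplectic (variation Psi z0 (a ij.1) t) (variation Psi z0 (b ij.2) t) =
   symplectic (a ij.1) (b ij.2).
  exact: (@filter_forall R ('I_d * 'I_d)%type (fun ij t =>
    symplectic (variation Psi z0 (a ij.1) t) (variation Psi z0 (b ij.2) t) =
    symplectic (a ij.1) (b ij.2)) (nbhs (0 : R)) _ (fun ij => S (a ij.1) (b ij.2))).
have /near0P[r1 r10 H1] := SF u u.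
have /near0P[r2 r20 H2] := SF v v.
have /near0P[r3 r30 H3] := SF u v.
apply/near0P; exists (Num.min r1 (Num.min r2 r3)); first by rewrite !lt_min r10 r20.
move=> t; rewrite !lt_min => /and3P[/H1 {}H1 /H2 {}H2 /H3 {}H3].
have uu i j : symplectic (u i) (u j) = 0.
  by rewrite /symplectic /= !pairing0l subrr.
have vv i j : symplectic (v i) (v j) = 0.
  by rewrite /symplectic /= !pairing0r subrr.
have uv i j : symplectic (u i) (v j) = (i == j)%:R.
  rewrite /symplectic /= pairing0l subr0 /pairing -row_mul mxE.
  have -> : (i == j)%:R = (E 0 *m N 0) i j by rewrite mulmxV// mxE.
  by rewrite [RHS]mxE [LHS]mxE; apply: eq_bigr => k _; rewrite !mxE.
apply: symplectic_mx_tr.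
- apply/matrixP => i j; apply/eqP; rewrite -subr_eq0; apply/eqP.
  have := symplectic_rows (fun i => variation Psi z0 (u i) t) (fun i => variation Psi z0 (u i) t) i j.
  rewrite (H1 (i, j)) uu mxE => <-; congr (_ + _).
  by rewrite [RHS]mxE.
- apply/matrixP => i j; apply/eqP; rewrite -subr_eq0; apply/eqP.
  have := symplectic_rows (fun i => variation Psi z0 (v i) t) (fun i => variation Psi z0 (v i) t) i j.
  rewrite (H2 (i, j)) vv mxE => <-; congr (_ + _).
  by rewrite [RHS]mxE.
- apply/matrixP => i j.
  have := symplectic_rows (fun i => variation Psi z0 (u i) t) (fun i => variation Psi z0 (v i) t) i j.
  by rewrite (H3 (i, j)) uv => H; rewrite [RHS]mxE; exact: H.
Qed.

Let derive_energy_p_mx v t : Q (t, z0) ->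
  'D_v (energy_p X) (z t) = v.1 *m L t + v.2^T *m ((Xm t)^T *m Xm t).
Proof.
move=> Qt; have Ot : Om (y t) by exact: (Psi_Om Qt).
have ed := energy_p_diff Om_open X_smooth Ot.
rewrite {1}(phase_split v) derive_dirD//; congr (_ + _).
  rewrite position_sum_delta derive_dir_sum// mulmx_sum_row.
  by apply: eq_bigr => j _; rewrite derive_dirZ// rowK.
rewrite (derive_energy_pp X _ Ot) mulmxA mulmx_sum_row; apply: eq_bigr => k _.
rewrite rowK; congr (_ *: _); rewrite pairingE mxE; apply: eq_bigr => j _.
by rewrite !mxE mulrC.
Qed.

Let is_derive_rows (v : 'I_d -> 'rV[R]_d * 'cV[R]_d) t : Q (t, z0) ->
  is_derive (t : R) 1 (fun t => \matrix_(i < d) (variation Psi z0 (v i) t).1)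
   ((\matrix_(i < d) (variation Psi z0 (v i) t).1) *m L t +
    (\matrix_(i < d) ((variation Psi z0 (v i) t).2)^T) *m ((Xm t)^T *m Xm t)).
Proof.
move=> Qt; apply/is_derive_mxP => i j.
have H := is_derive_variation Om_open X_smooth Q_open Psi_smooth Psi_Om Psi_ham (v i) Qt.
have /is_derive_mxP/(_ 0 j) := H.
rewrite derive_energy_p_mx// => H'.
under eq_fun do rewrite mxE.
apply: (is_derive_eq H'); rewrite mxE [RHS]mxE; congr (_ + _).
  exact/esym/mul_rows_entry.
exact/esym/mul_rows_entry.
Qed.

(** The form om kills the X k and is 1 on the first frame vector, that is E om = [e0]. Hence the
    first column of F N consists of the values of om on the rows of F. *)
Let near_Nom : \forall t \near (0 : R), N t *m e0 = om (y t).
Proof.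
have nv : \forall t \near (0 : R), pairing (om (y t)) v0 != 0.
  have H : dnear 1 (fun t => pairing (om (y t)) v0).
    by apply: dnear_pairing; [exact: dnear_along|exact: dnear_cst].
  by apply: (cvgr_neq0 _ (dnear_cvg H)); rewrite /y z_0.
near=> t; have Et : E t \in unitmx by near: t.
have Ot : Om (y t) by near: t.
have vt : pairing (om (y t)) v0 != 0 by near: t.
suff <- : E t *m om (y t) = e0 by rewrite mulKmx.
rewrite /E /frame_mx mul_col_mx /e0; congr col_mx; apply/matrixP => i j; rewrite !ord1.
  have := pairingZr (om (y t)) (pairing (om (y t)) v0)^-1 v0.
  by rewrite /pairing => ->; rewrite [RHS]mxE eqxx mulVf.
by rewrite mul_rows_entry [RHS]mxE; exact: om_X.
Unshelve. all: by end_near. Qed.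

Let dform_row t (v : 'rV[R]_d) : Q (t, z0) ->
  dform om (y t) (ydot t) (v *m E t) = (v *m w t) 0 0.
Proof.
move=> Qt; have Ot : Om (y t) by exact: (Psi_Om Qt).
by apply: dform_mulmx; have [+ _] := om_smooth 1; exact.
Qed.

(** By [near_Nom] the first column is om(xi), with derivative d om(ydot, xi); expanding xi = (xi N)
    E in the frame turns this into a row of F N times [w]. *)
Let col_identity (v : 'I_d -> 'rV[R]_d * 'cV[R]_d) F1 :
  let F t := \matrix_(i < d) (variation Psi z0 (v i) t).1 in
  (\forall t \near (0 : R), is_derive (t : R) 1 (fun t => F t *m N t) (F1 t)) ->
  \forall t \near (0 : R), F1 t *m e0 = F t *m N t *m w t.
Proof.
move=> F HF.
apply: (@near0_derive_eq R _ (fun t => F t *m N t *m e0) (fun t => F t *m om (y t))).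
- by apply: filterS near_Nom => t Nt; rewrite -mulmxA Nt.
- apply: filterS HF => t Ft.
  have := is_derive_mulmx Ft (is_derive_cst e0 t (1 : R)).
  by rewrite mulmx0 addr0.
- near=> t; have Qt : Q (t, z0) by near: t.
  have Et : E t \in unitmx by near: t.
  apply/is_derive_mxP => i j; rewrite ord1.
  have H := is_derive_om_variation Om_open X_smooth om_smooth om_X Q_open Psi_smooth Psi_Om
    Psi_ham (v i) Qt.
  have -> : (fun t => (F t *m om (y t)) i 0) =
    fun t => pairing (om (extremal Psi z0 t).1) (variation Psi z0 (v i) t).1.
    by apply/funext => s; rewrite pairingE mxE; apply: eq_bigr => k _; rewrite mxE.
  apply: (is_derive_eq H).
  rewrite -[(variation Psi z0 (v i) t).1](mulmxKV Et) (dform_row _ Qt).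
  by rewrite -[F t *m _ *m _]mulmxA mul_rows_entry mulmxA.
Unshelve. all: by end_near. Qed.

(* The derivative of [N] cancels in the Wronskian because A^T B is symmetric. *)
Let near_wronskian a1 b1 :
  (\forall t \near (0 : R), is_derive (t : R) 1 (fun t => A t *m N t) (a1 t)) ->
  (\forall t \near (0 : R), is_derive (t : R) 1 (fun t => B t *m N t) (b1 t)) ->
  \forall t \near (0 : R),
    (A t *m N t)^T *m b1 t - (B t *m N t)^T *m a1 t = corner_proj.
Proof.
move=> Ha Hb; have [N1 HN _] := dnear_N 1.
near=> t.
have Qt : Q (t, z0) by near: t.
have Et : E t \in unitmx by near: t.
have [AB AD] : (A t)^T *m B t = (B t)^T *m A t /\ (A t)^T *m D t - (B t)^T *m C t = 1%:M.
  by near: t; exact: near_symplectic.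
have HNt : is_derive (t : R) 1 N (N1 t) by near: t.
have [_ a1E] : is_derive (t : R) 1 (fun t => A t *m N t) (a1 t) by near: t.
have [_ b1E] : is_derive (t : R) 1 (fun t => B t *m N t) (b1 t) by near: t.
have [_ a1E'] := is_derive_mulmx (is_derive_rows (fun i => (row i (E 0), 0)) Qt) HNt.
have [_ b1E'] := is_derive_mulmx (is_derive_rows (fun i => (0, col i (N 0))) Qt) HNt.
set G := (Xm t)^T *m Xm t in a1E' b1E'.
have a1F : a1 t = (A t *m L t + C t *m G) *m N t + A t *m N1 t := etrans (esym a1E) a1E'.
have b1F : b1 t = (B t *m L t + D t *m G) *m N t + B t *m N1 t := etrans (esym b1E) b1E'.
(* These are the lower rows of E N = 1. In frame coordinates the X k are the last m unit vectors, so
   the vertical Hessian becomes the projection onto D. *)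
have XN : Xm t *m N t = row_mx 0 1%:M.
  have : E t *m N t = 1%:M by rewrite mulmxV.
  rewrite {1}/E /frame_mx mul_col_mx (@scalar_mx_block _ 1 m 1) /block_mx.
  by move=> /eq_col_mx [].
have -> : corner_proj = (N t)^T *m G *m N t.
  rewrite /G -!mulmxA XN mulmxA -trmx_mul XN tr_row_mx trmx0 trmx1 mul_col_row.
  by rewrite !mul0mx mulmx0 mul1mx.
by rewrite a1F b1F; exact: wronskian_mx.
Unshelve. all: by end_near. Qed.

Lemma exp_jacobian_expansion :
  let wv t : 'cV[R]_m := \col_k dform om (y t) (ydot t) (X k (y t)) in
  exists2 w1 : 'cV[R]_m, is_derive (0 : R) 1 wv w1 &
  ((wv 0)^T *m wv 0) 0 0 != 0 ->
  is_derive (0 : R) 1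
    (fun t => if t == 0 then ((wv 0)^T *m wv 0) 0 0 / 12 else \det (B t *m N t) / t ^+ (m + 3))
    (((wv 0)^T *m w1) 0 0 / 12).
Proof.
have wE t : \col_k dform om (y t) (ydot t) (X k (y t)) = dsubmx (w t).
  apply/matrixP => i j; rewrite [LHS]mxE [RHS]mxE [RHS]mxE; congr (dform _ _ _ _).
  by apply/matrixP => a b; rewrite ord1 [RHS]mxE /E /frame_mx col_mxEd mxE.
(* The corner entry of b is needed up to its fourth derivative; the identities differentiated on the
   way involve three derivatives of a and of w. *)
have [w1 Hw [w2 Hw1 [w3 Hw2 _]]] := dnear_w 3.
have [a1 Ha [a2 Ha1 [a3 Ha2 _]]] : dnear 3 (fun t => A t *m N t).
  exact: (dnear_mulmx (dnear_A 3) (dnear_N 3)).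
have [b1 Hb [b2 Hb1 [b3 Hb2 [b4 Hb3 _]]]] : dnear 4 (fun t => B t *m N t).
  exact: (dnear_mulmx (dnear_B 4) (dnear_N 4)).
have v0E v : (variation Psi z0 v 0) = v.
  exact: (variation0 Q_open Q0 Psi0).
have a0 : A 0 *m N 0 = 1%:M.
  rewrite -[RHS](mulmxV E0_unit); congr (_ *m _); apply/matrixP => i j.
  by rewrite mxE v0E mxE.
have b0 : B 0 *m N 0 = 0.
  suff -> : B 0 = 0 by rewrite mul0mx.
  by apply/matrixP => i j; rewrite mxE v0E !mxE.
exists (dsubmx (w1 0)).
  under eq_fun do rewrite wE.
  apply/is_derive_mxP => i j; rewrite mxE; under eq_fun do rewrite mxE.
  exact: (iffLR (is_derive_mxP _ _ _ _) (nbhs_singleton Hw)).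
rewrite wE => s0.
apply: (is_derive_det_expansion Ha Ha1 Ha2 Hb Hb1 Hb2 Hb3 Hw Hw1 Hw2 a0 b0) => //.
- exact: near_wronskian.
- exact: (col_identity Ha).
- exact: (col_identity Hb).
Qed.

End MovingFrame.

(** * Contact linear algebra and conservation of energy *)

Section EnergyConservation.
Context {R : realType} {d m : nat}.
Variables (Om : set 'rV[R]_d) (X : 'I_m -> 'rV[R]_d -> 'rV[R]_d).
Hypothesis Om_open : open Om.
Hypothesis X_smooth : forall k, is_smooth Om (X k).

Local Opaque derive.

Lemma derive_energy_ham z : Om z.1 -> 'D_(ham_at X z) (energy X) z = 0.
Proof.
move=> Oz; have ed : differentiable (energy X) z.
  by have [+ _] := energy_smooth Om_open X_smooth 1; exact.
pose a j := 'D_((0, delta_mx j 0)) (energy X) z.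
pose b j := 'D_((delta_mx 0 j, 0)) (energy X) z.
have H1 : 'D_(((ham_at X z).1, 0)) (energy X) z = \sum_j a j * b j.
  apply: (etrans (f_equal (fun w => 'D_w (energy X) z) (position_sum_delta _))).
  apply: (etrans (derive_dir_sum _ _ _ ed)); apply: eq_bigr => j _.
  by apply: (etrans (derive_dirZ _ _ ed)); rewrite mxE.
have H2 : 'D_((0, (ham_at X z).2)) (energy X) z = \sum_j - b j * a j.
  apply: (etrans (f_equal (fun w => 'D_w (energy X) z) (momentum_sum_delta _))).
  apply: (etrans (derive_dir_sum _ _ _ ed)); apply: eq_bigr => j _.
  by apply: (etrans (derive_dirZ _ _ ed)); rewrite !mxE.
apply: (etrans (f_equal (fun w => 'D_w (energy X) z) (phase_split _))).
apply: (etrans (derive_dirD _ _ ed)); rewrite H1 H2.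
move: a b {H1 H2} => a b; rewrite -big_split /= big1// => j _.
by rewrite mulNr mulrC subrr.
Qed.

Lemma energy_eq0 z : energy X z = 0 -> forall k, frame_coord X k z = 0.
Proof.
move=> /eqP; rewrite /energy mulf_eq0 invr_eq0 pnatr_eq0 /= psumr_eq0; last first.
  by move=> k _; exact: sqr_ge0.
by move=> /allP H k; have := H k (mem_index_enum k); rewrite sqrf_eq0 => /eqP.
Qed.

Lemma energy_p_eq0 z : energy X z = 0 -> energy_p X z = 0.
Proof.
by move=> /energy_eq0 H; rewrite /energy_p big1// => k _; rewrite H scale0r.
Qed.

End EnergyConservation.

(** * From local to global constancy *)

Section LocallyConstant.
Context {R : realType}.

Lemma near_derive0_cst (f : R -> R) (t : R) :
  (\forall s \near t, is_derive (s : R) 1 f 0) -> \forall s \near t, f s = f t.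
Proof.
move=> H; have /near0P[r r0 Hr] := near_translate H.
suff Hs : \forall h \near (0 : R), f (t + h) = f t.
  have /near0P[r' r'0 Hr'] := Hs.
  apply/nbhs_ballP; exists r' => //= s; rewrite /ball /= => st.
  by rewrite -[s](addrNK t) addrC Hr'// distrC.
apply/near0P; exists r => // h hr.
apply/eqP; rewrite -subr_eq0 -normr_le0 -(mul0r (`|h| ^+ 1)).
apply: (@mvt_bound R (fun h => f (t + h) - f t) (fun=> 0) 0 r 0) => //.
- move=> s sr; have D := Hr s sr.
  have L : is_derive (s : R) 1 (fun s : R => t + s *: (1 : R)) 1 by exact: is_derive_line.
  have LE : (fun s : R => t + s *: (1 : R)) = fun s => t + s.
    by apply/funext => x; rewrite /GRing.scale /= mulr1.
  rewrite LE in L.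
  have fd : differentiable f (t + s) by apply/derivable1_diffP; have [] := D.
  have := is_derive_comp L fd; have [_ ->] := D => H1.
  have := is_deriveB H1 (is_derive_cst (f t) s 1).
  by rewrite subr0.
- by move=> s _; rewrite normr0 mul0r.
- by rewrite addr0 subrr.
Qed.

Lemma near_derive0_cst_mx m n (f : R -> 'M[R]_(m, n)) (t : R) :
  (\forall s \near t, is_derive (s : R) 1 f 0) -> \forall s \near t, f s = f t.
Proof.
move=> H; have E (ij : 'I_m * 'I_n) : \forall s \near t, f s ij.1 ij.2 = f t ij.1 ij.2.
  apply: near_derive0_cst; apply: filterS H => s /is_derive_mxP/(_ ij.1 ij.2).
  by rewrite mxE.
have F := filter_forall (nbhs_filter t) E.
by apply: filterS F => s Hs; apply/matrixP => i j; exact: (Hs (i, j)).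
Qed.

(** The 0-1 indicator of P has zero derivative at every point of I, so by the mean value theorem it
    takes a single value there. *)
Lemma locally_constant_interval (I : set R) (P : R -> Prop) : is_interval I ->
  (forall t, I t -> \forall s \near t, P s <-> P t) ->
  forall s t, I s -> I t -> P s -> P t.
Proof.
move=> itvI H s t Is It Ps.
pose g r : R := if `[< P r >] then 1 else 0.
have gd r : I r -> is_derive (r : R) 1 g 0.
  move=> /H Hr; apply: near_eq_is_derive (is_derive_cst (g r) r 1).
  apply: filterS Hr => r' PP; rewrite /g /cst.
  by rewrite (asbool_equiv_eq PP).
have gE a b : a < b -> I a -> I b -> g a = g b.
  move=> ab Ia Ib; have Iab r : a <= r -> r <= b -> I r.
    by move=> ar rb; apply: (itvI a b) => //; rewrite ar rb.
  have [r||c _] := @MVT R g (fun=> 0) a b ab.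
  - rewrite in_itv /= => /andP[/ltW ar /ltW rb]; exact/gd/Iab.
  - apply: continuous_in_subspaceT => r; rewrite inE /= in_itv /= => /andP[ar rb].
    by apply/differentiable_continuous/derivable1_diffP; have [] := gd r (Iab r ar rb).
  by rewrite mul0r => /eqP; rewrite subr_eq0 => /eqP.
have gst : g s = g t.
  by have [st|ts|->//] := ltgtP s t; [exact: gE|exact/esym/gE].
move: gst; rewrite /g; case: asboolP => // _; case: asboolP => // _ /eqP.
by rewrite oner_eq0.
Qed.

End LocallyConstant.

(** * Orthonormal bases of the contact distribution *)

Section ContactLinearAlgebra.
Context {R : realType} {n : nat} {M : contact_manifold R n}.
Notation N := n.*2.+1.
Implicit Types (x : M) (u v : 'rV[R]_N).
Notation omega := (contact_form (c:=M)).

Lemma distrD x u v : distr x u -> distr x v -> distr x (u + v).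
Proof. by rewrite /distr /in_kernel => uD vD; rewrite pairingDr uD vD addr0. Qed.

Lemma distrZ x (a : R) u : distr x u -> distr x (a *: u).
Proof. by rewrite /distr /in_kernel => uD; rewrite pairingZr uD mulr0. Qed.

Lemma distr0 x : distr x (0 : 'rV[R]_N).
Proof. by rewrite /distr /in_kernel pairing0r. Qed.

Lemma distr_sum x (I : Type) (r : seq I) (P : pred I) (f : I -> 'rV[R]_N) :
  (forall i, distr x (f i)) -> distr x (\sum_(i <- r | P i) f i).
Proof.
move=> H; elim/big_ind: _ => //; [exact: distr0|exact: distrD].
Qed.

Lemma metric0l x v : distr x v -> metric x 0 v = 0.
Proof.
move=> vD; have := metric_linear 1 (distr0 x) (distr0 x) vD.
rewrite scaler0 addr0 mul1r => E.
by apply: (@addrI _ (metric x 0 v)); rewrite addr0 -E.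
Qed.

Lemma metric_suml x (I : Type) (r : seq I) (c : I -> R) (f : I -> 'rV[R]_N) v :
  (forall i, distr x (f i)) -> distr x v ->
  metric x (\sum_(i <- r) c i *: f i) v = \sum_(i <- r) c i * metric x (f i) v.
Proof.
move=> fD vD; elim: r => [|i r IH]; first by rewrite !big_nil metric0l.
rewrite !big_cons metric_linear// ?IH//; first exact: fD.
by apply: (@distr_sum x) => j; exact: distrZ.
Qed.

Section Basis.
Variables (x : M) (e : 'I_(n.*2) -> 'rV[R]_N) (w0 : 'rV[R]_N).
Hypothesis eO : orthonormal_basis x e.
Hypothesis w0E : pairing (omega x) w0 = 1.

Definition basis_mx : 'M[R]_(1 + n.*2) := col_mx w0 (\matrix_(k < n.*2) e k).

Let combination (u : 'rV[R]_(1 + n.*2)) :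
  u *m basis_mx = u 0 0 *: w0 + \sum_k u 0 (rshift 1 k) *: e k.
Proof.
rewrite -[u in LHS]hsubmxK /basis_mx mul_row_col; congr (_ + _).
  by rewrite [lsubmx u]mx11_scalar mul_scalar_mx mxE lshift0.
by rewrite mulmx_sum_row; apply: eq_bigr => k _; rewrite rowK mxE.
Qed.

Let combination_coords (c : 'I_(n.*2) -> R) j :
  metric x (\sum_k c k *: e k) (e j) = c j.
Proof.
have [eD eM] := eO; rewrite metric_suml// (bigD1 j)//= big1 ?addr0 => [|k kj].
  by rewrite eM eqxx mulr1.
by rewrite eM (negbTE kj) mulr0.
Qed.

Lemma basis_mx_unit : basis_mx \in unitmx.
Proof.
rewrite -row_free_unit -kermx_eq0; apply/rowV0P => u /sub_kermxP.
have [eD eM] := eO; rewrite combination => uE.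
have u0 : u 0 0 = 0.
  have := congr1 (pairing (omega x)) uE; rewrite pairingDr pairingZr w0E mulr1 pairing0r.
  have := distr_sum (index_enum 'I_(n.*2)) xpredT (fun k => distrZ (u 0 (rshift 1 k)) (eD k)).
  by rewrite /distr /in_kernel => ->; rewrite addr0.
rewrite u0 scale0r add0r in uE.
apply/matrixP => i j; rewrite ord1 mxE.
have [j' ->|j' ->] := split_ordP (j : 'I_(1 + n.*2)); first by rewrite ord1 lshift0.
by rewrite -(combination_coords (fun k => u 0 (rshift 1 k))) uE metric0l.
Qed.

(** [orthonormal_basis] does not assert spanning. It follows from the invertibility of [basis_mx],
    once omega has shown that the [w0]-coefficient of a vector of D is 0. *)
Lemma distr_basis u : distr x u -> u = \sum_k metric x u (e k) *: e k.
Proof.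
move=> uD; have [eD eM] := eO.
pose c := u *m invmx basis_mx.
have uE : u = c 0 0 *: w0 + \sum_k c 0 (rshift 1 k) *: e k.
  by rewrite -combination mulmxKV//; exact: basis_mx_unit.
have c0 : c 0 0 = 0.
  have := congr1 (pairing (omega x)) uE; rewrite pairingDr pairingZr w0E mulr1.
  have := distr_sum (index_enum 'I_(n.*2)) xpredT (fun k => distrZ (c 0 (rshift 1 k)) (eD k)).
  by move: uD; rewrite /distr /in_kernel => -> ->; rewrite addr0.
rewrite c0 scale0r add0r in uE.
rewrite [LHS]uE; apply: eq_bigr => k _; congr (_ *: _).
by rewrite [in RHS]uE combination_coords.
Qed.

Lemma gnorm_basis u : distr x u -> gnorm x u = Num.sqrt (\sum_k metric x u (e k) ^+ 2).
Proof.
move=> uD; have [eD eM] := eO; rewrite /gnorm {1}(distr_basis uD) metric_suml//.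
congr (Num.sqrt _); apply: eq_bigr => k _.
by rewrite (metric_sym (eD k) uD).
Qed.

End Basis.
End ContactLinearAlgebra.

Lemma is_Ck_sub {R : realType} {V W : normedModType R} k (A B : set V) (f : V -> W) :
  A `<=` B -> is_Ck k B f -> is_Ck k A f.
Proof.
move=> AB; elim: k f => [|k IH] f; first by move=> fc x /AB; exact: fc.
by move=> [fd fC]; split=> [x Ax|v]; [exact/fd/AB|exact: IH (fC v)].
Qed.

Section LocalFrame.
Context {R : realType} {n : nat} {M : contact_manifold R n}.
Notation N := n.*2.+1.
Notation omega := (contact_form (c:=M)).
Variables (H : cotangent M -> R) (i : chart_index M) (U : set M) (Xf : 'I_(n.*2) -> vfield M).
Hypothesis U_open : open U.
Hypothesis X_section : forall k, section_on U (Xf k).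
Hypothesis X_orthonormal : forall y, U y -> orthonormal_basis y (fun k => Xf k y).
Hypothesis H_ham : is_hamiltonian H.

Definition chart_dom : set 'rV[R]_N := chart i @` (U `&` dom i).
Definition chart_frame (k : 'I_(n.*2)) : 'rV[R]_N -> 'rV[R]_N := vfield_in i (Xf k).

Local Opaque derive.

Lemma chart_dom_open : open chart_dom.
Proof. exact: image_chart_open. Qed.

Lemma chart_frame_smooth k : is_smooth chart_dom (chart_frame k).
Proof. by have [_ + _] := X_section k; exact. Qed.

Lemma chart_form_smooth : is_smooth chart_dom (form_in i omega).
Proof.
move=> k; apply: is_Ck_sub (contact_form_smooth i k).
by move=> _ [x [Ux ix] <-]; exists x.
Qed.

Lemma chart_form_frame k y : chart_dom y -> pairing (form_in i omega y) (chart_frame k y) = 0.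
Proof.
move=> [x [Ux ix] <-]; rewrite /chart_frame form_in_chart// vfield_in_chart// covec_inE//.
by have [_ _ +] := X_section k; exact.
Qed.

Lemma H_energy z : chart_dom z.1 -> H (cotangent_of i z) = energy chart_frame z.
Proof.
case: z => y q /= [x [Ux ix] <-]; have [p -> pE] := cotangent_of_chart q ix.
rewrite (H_ham p (X_orthonormal Ux)) /energy; congr (_ * _); apply: eq_bigr => k _.
by rewrite pE /frame_coord /chart_frame vfield_in_chart.
Qed.

Lemma ham_vfield_chart z : chart_dom z.1 -> ham_vfield H i z = ham_at chart_frame z.
Proof.
case: z => y q /= Oy; rewrite /ham_vfield /ham_at; congr pair.
  apply/matrixP => a j; rewrite !mxE -derive_snd.
  have E : (fun q => H (cotangent_of i (y, q))) = (fun q => energy chart_frame (y, q)).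
    by apply/funext => q'; exact: H_energy.
  exact: (f_equal (fun f => 'D_(delta_mx j 0) f q) E).
congr (- _); apply/matrixP => j a; rewrite !mxE -derive_fst; apply: near_derive_eq.
by apply: filterS (open_near chart_dom_open Oy) => y' Oy'; exact: H_energy.
Qed.

End LocalFrame.

(** * Conservation of energy along the flow *)

Section FlowFacts.
Context {R : realType} {n : nat} {M : contact_manifold R n}.
Notation N := n.*2.+1.
Variables (X0 : vfield M) (mu : M -> ('I_N -> 'rV[R]_N) -> R).
Variables (H : cotangent M -> R) (W : set (R * cotangent M)).
Variable (Phi : R -> cotangent M -> cotangent M).
Hypothesis popp : is_popp X0 mu.
Hypothesis H_ham : is_hamiltonian H.
Hypothesis flow : is_ham_flow H W Phi.

Local Opaque derive.

Lemma local_frame (x : M) : exists (U : set M) (X : 'I_(n.*2) -> vfield M),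
  [/\ open U, U x, forall k, section_on U (X k) &
      forall y, U y -> orthonormal_basis y (fun k => X k y)].
Proof.
have [U [X [Ux XU eU _]]] := popp x.
(* Openness of U is recorded only inside [section_on], hence the separate treatment of an empty
   frame. *)
have [n0|n0] := posnP n.*2.
  have no (k : 'I_(n.*2)) : False by case: k => k; rewrite n0.
  exists setT, X; split=> //; exact: openT.
by exists U, X; split=> //; have [] := XU (Ordinal n0).
Qed.

Lemma flow_near t (l : cotangent M) j : W (t, l) -> dom j (Phi t l).1 ->
  \forall s \near t, W (s, l) /\ dom j (Phi s l).1.
Proof.
move=> Wtl jt; have [_ _ flow3 _] := flow.
have il := dom_chart_at l.1.
have [Q [Qo Qt QW _]] := flow3 _ _ Wtl _ _ il jt.
have C : {for t, continuous (fun s : R => (s, cotangent_in (chart_at l.1) l))}.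
  apply/differentiable_continuous; exact: differentiable_pair.
have nQ : \forall s \near t, Q (s, cotangent_in (chart_at l.1) l).
  exact: (C _ (open_near Qo Qt)).
by apply: filterS nQ => s /QW[_]; rewrite cotangent_inK.
Qed.

(** Inside one chart the energy has zero derivative along the flow; at energy zero so has the
    position, because [energy_p] vanishes there. The passage to the whole time interval, during
    which the chart may have to change, is left to [locally_constant_interval]. *)
Lemma flow_local t (l : cotangent M) : W (t, l) ->
  \forall s \near t, [/\ W (s, l), H (Phi s l) = H (Phi t l) &
    H (Phi t l) = 0 -> (Phi s l).1 = (Phi t l).1].
Proof.
move=> Wtl; have [_ _ _ flow4] := flow.
pose j := chart_at (Phi t l).1; have jt : dom j (Phi t l).1 := dom_chart_at _.
have [U [X [Uo Ut XU eU]]] := local_frame (Phi t l).1.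
pose z s := cotangent_in j (Phi s l).
have nW := flow_near Wtl jt.
have zd s : W (s, l) -> dom j (Phi s l).1 -> is_derive (s : R) 1 z (ham_vfield H j (z s)).
  by move=> Ws js; exact: flow4.
have Ot : chart_dom j U (z t).1 by exists (Phi t l).1.
have Oo1 : open (chart_dom j U) by exact: chart_dom_open.
have Oo : open [set z : 'rV[R]_N * 'cV[R]_N | chart_dom j U z.1].
  exact: phase_open.
have nO : \forall s \near t, chart_dom j U (z s).1.
  have C : {for t, continuous z}.
    by apply/differentiable_continuous/derivable1_diffP; have [] := zd t Wtl jt.
  exact: (C _ (open_near Oo Ot)).
have XS := chart_frame_smooth j XU.
have Hz s : dom j (Phi s l).1 -> chart_dom j U (z s).1 ->
    H (Phi s l) = energy (chart_frame j X) (z s).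
  by move=> js Os; rewrite -(H_energy eU H_ham)// cotangent_inK.
have nzd : \forall s \near t, is_derive (s : R) 1 z (ham_at (chart_frame j X) (z s)).
  apply: filterS2 nW nO => s [Ws js] Os.
  by rewrite -(ham_vfield_chart Uo eU H_ham Os); exact: zd.
have nE : \forall s \near t, energy (chart_frame j X) (z s) = energy (chart_frame j X) (z t).
  apply: (@near_derive0_cst R (fun s => energy (chart_frame j X) (z s))).
  apply: filterS2 nzd nO => s zs Os.
  have ed : differentiable (energy (chart_frame j X)) (z s).
    by have [+ _] := energy_smooth Oo1 XS 1; exact.
  have := is_derive_comp zs ed.
  by rewrite (derive_energy_ham Oo1 XS).
have nH : \forall s \near t, H (Phi s l) = H (Phi t l).
  apply: filterS3 nW nO nE => s [Ws js] Os Es.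
  by rewrite (Hz s)// (Hz t).
have nG : H (Phi t l) = 0 -> \forall s \near t, (Phi s l).1 = (Phi t l).1.
  move=> H0; have nz : \forall s \near t, (z s).1 = (z t).1.
    apply: (@near_derive0_cst_mx R _ _ (fun s => (z s).1)).
    apply: filterS3 nzd nO nE => s zs Os Es.
    have D := is_derive_linear (@position_continuous R N) zs.
    apply: (is_derive_eq D); apply: (etrans (hamE1 Oo1 XS Os)).
    by rewrite energy_p_eq0// Es -Hz.
  apply: filterS2 nz nW => s zs [Ws js].
  by rewrite -(chartK js) -[RHS](chartK jt); congr (chart_inv _ _).
have [H0|H0] := pselect (H (Phi t l) = 0).
  by apply: filterS3 nW nH (nG H0) => s [Ws _] Hs Gs; split.
by apply: filterS2 nW nH => s [Ws _] Hs; split.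
Qed.

Lemma energy_constant s t (l : cotangent M) : W (s, l) -> W (t, l) ->
  H (Phi s l) = H (Phi t l).
Proof.
move=> Ws Wt; have [_ itv _ _] := flow.
apply: (@locally_constant_interval R [set r | W (r, l)] (fun r => H (Phi s l) = H (Phi r l)) (itv l) _ s t) => //.
move=> r Wr; apply: filterS (flow_local Wr) => r' [_ -> _]; by split.
Qed.

Lemma nonconstant_energy (l : cotangent M) :
  (exists2 t, W (t, l) & (Phi t l).1 <> (Phi 0 l).1) -> H l <> 0.
Proof.
move=> [t Wt gt] H0; have [flow0 itv _ _] := flow.
have [W0 P0] := flow0 l; apply: gt.
(* Both properties are propagated together, because the position is known to be locally constant
   only where the energy is 0. *)
suff [] : H (Phi t l) = 0 /\ (Phi t l).1 = (Phi 0 l).1 by [].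
apply: (@locally_constant_interval R [set r | W (r, l)]
  (fun r => H (Phi r l) = 0 /\ (Phi r l).1 = (Phi 0 l).1) (itv l) _ 0 t) => //.
  move=> r Wr; apply: filterS (flow_local Wr) => s [_ -> E].
  by split=> -[Hr gr]; split=> //; rewrite -gr E.
by rewrite P0.
Qed.

End FlowFacts.

(** * The geodesic dimension *)

Section Flag.
Context {R : realType} {n : nat} {M : contact_manifold R n}.
Notation N := n.*2.+1.
Notation omega := (contact_form (c:=M)).
Implicit Types (x : M) (U : set M) (T Y : vfield M).

Local Opaque derive.

Lemma ext_derivDr x u v w :
  ext_deriv omega x u (v + w) = ext_deriv omega x u v + ext_deriv omega x u w.
Proof.
have wd : differentiable (form_in (chart_at x) omega) (chart (chart_at x) x).
  have [+ _] := contact_form_smooth (c := M) (chart_at x) 1; apply.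
  by exists x => //; exact: dom_chart_at.
rewrite /ext_deriv derive_dirD// pairingDr pairingDl.
by rewrite opprD addrACA.
Qed.

Lemma ext_derivZr x u (a : R) v :
  ext_deriv omega x u (a *: v) = a * ext_deriv omega x u v.
Proof.
have wd : differentiable (form_in (chart_at x) omega) (chart (chart_at x) x).
  have [+ _] := contact_form_smooth (c := M) (chart_at x) 1; apply.
  by exists x => //; exact: dom_chart_at.
by rewrite /ext_deriv derive_dirZ// pairingZr pairingZl mulrBr.
Qed.

Lemma ext_deriv_sumr x u (I : Type) (r : seq I) (c : I -> R) (v : I -> 'rV[R]_N) :
  ext_deriv omega x u (\sum_(k <- r) c k *: v k) = \sum_(k <- r) c k * ext_deriv omega x u (v k).
Proof.
elim: r => [|k r IH]; last by rewrite !big_cons ext_derivDr ext_derivZr IH.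
by rewrite !big_nil -(scale0r (0 : 'rV[R]_N)) ext_derivZr mul0r.
Qed.

Lemma nondegenerate_basis x (e : 'I_(n.*2) -> 'rV[R]_N) w0 v :
  orthonormal_basis x e -> pairing (omega x) w0 = 1 -> distr x v ->
  (forall k, ext_deriv omega x v (e k) = 0) -> v = 0.
Proof.
move=> eO w0E vD H; apply: (contact_nondegenerate vD) => u uD.
by rewrite (distr_basis eO w0E uD) ext_deriv_sumr big1// => k _; rewrite H mulr0.
Qed.

Let om_derive_section x U Y u : section_on U Y -> U x ->
  pairing (omega x) ('D_u (vfield_in (chart_at x) Y) (chart (chart_at x) x)) =
  - pairing ('D_u (form_in (chart_at x) omega) (chart (chart_at x) x)) (Y x).
Proof.
move=> [Uo Ys YD] Ux; set c := chart_at x; have cx : dom c x := dom_chart_at x.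
apply/eqP; rewrite -addr_eq0 addrC; apply/eqP.
have wd : differentiable (form_in c omega) (chart c x).
  by have [+ _] := contact_form_smooth (c := M) c 1; apply; exists x.
have Yd : differentiable (vfield_in c Y) (chart c x).
  by have [+ _] := Ys c 1; apply; exists x.
have [_ E] := is_derive_pairing (is_derive_diff u wd) (is_derive_diff u Yd).
have -> : Y x = vfield_in c Y (chart c x) by rewrite vfield_in_chart// vec_in_at.
have -> : omega x = form_in c omega (chart c x) by rewrite form_in_chart// covec_in_at.
rewrite -E; have -> : (0 : R) = 'D_u (cst 0 : _ -> R) (chart c x) by rewrite derive_cst.
apply: near_derive_eq.
have Oo : open (chart c @` (U `&` dom c)) by exact: image_chart_open.
have Ox : (chart c @` (U `&` dom c)) (chart c x) by exists x.
apply: filterS (open_near Oo Ox) => _ [x' [Ux' cx'] <-] /=.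
rewrite form_in_chart// vfield_in_chart// covec_inE//; exact: YD.
Qed.

(** Cartan's formula for two sections of D, for which the terms T(omega(Y)) and Y(omega(T))
    vanish. *)
Lemma om_lie_bracket x U U' T Y : section_on U T -> U x -> section_on U' Y -> U' x ->
  pairing (omega x) (lie_bracket T Y x) = - ext_deriv omega x (T x) (Y x).
Proof.
move=> TS Ux YS U'x; rewrite /lie_bracket /ext_deriv pairingDr pairingNr.
by rewrite (om_derive_section _ YS U'x) (om_derive_section _ TS Ux) opprB opprK addrC.
Qed.

(** F 1 is D, and non-degeneracy provides a frame section whose bracket with T leaves D, so that F 2
    is the whole tangent space. The sum is 1 * 2n + 3 * 1. *)
Lemma geodesic_dimE (c : R -> M) k (e : 'I_(n.*2) -> vfield M) U w0 :
  open U -> U (c 0) -> (forall k, section_on U (e k)) ->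
  orthonormal_basis (c 0) (fun k => e k (c 0)) -> pairing (omega (c 0)) w0 = 1 ->
  velocity c 0 != 0 -> is_geodesic_dim c k -> k = (n.*2 + 3)%N.
Proof.
move=> Uo Uc eS eO w0E v0 [T [F [m [[[U' U'c TS] Tv] FS Fm ->]]]].
set x := c 0 in Uc eO w0E TS U'c FS *.
have Tx : T x = velocity c 0 by exact: (nbhs_singleton Tv).
have TD : distr x (T x) by have [_ _ +] := TS; exact.
have [eD eM] := eO.
have Fmono i j : (i <= j)%N -> (F i <= F j)%VS.
  move=> ij; have [_] := FS i; apply => v [V [Y [l [Vx YS li ->]]]].
  have [+ _] := FS j; apply; exists V, Y, l; split=> //.
  exact: leq_trans ij.
have F0 : F 0 = 0%VS.
  apply/eqP; rewrite -subv0; have [_] := FS 0; apply => v [V [Y [l [_ _]]]].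
  by rewrite ltn0.
pose b := [tuple e k x | k < n.*2].
have be (j : 'I_(n.*2)) : b`_(nat_of_ord j) = e j x by rewrite -tnth_nth tnth_mktuple.
have sub_span v : distr x v -> v \in <<b>>%VS.
  move=> vD; rewrite (distr_basis eO w0E vD); apply: memv_suml => j _.
  by apply: memvZ; rewrite -be; apply: memv_span; rewrite mem_nth// size_tuple.
have F1 : F 1 = <<b>>%VS.
  apply/eqP; rewrite eqEsubv; apply/andP; split.
    have [_] := FS 1; apply => v [V [Y [l [Vx [_ _ YD]]]]]; rewrite ltnS leqn0 => /eqP-> ->.
    by apply: sub_span; exact: YD.
  apply/span_subvP => v /(nthP 0)[j]; rewrite size_tuple => jn <-.
  have -> : b`_j = e (Ordinal jn) x by rewrite -(be (Ordinal jn)).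
  by have [+ _] := FS 1; apply; exists U, (e (Ordinal jn)), 0.
have bfree : free b.
  apply/freeP => a aE j.
  have := congr1 (fun u => metric x u (e j x)) aE.
  rewrite /= metric0l//; under eq_bigr do rewrite be.
  rewrite metric_suml// (bigD1 j)//= eM eqxx mulr1 big1 ?addr0// => i ij.
  by rewrite eM (negbTE ij) mulr0.
have d1 : \dim (F 1) = n.*2 by rewrite F1; move: bfree => /eqP ->; rewrite size_tuple.
have dfull : \dim (fullv : {vspace 'rV[R]_N}) = N by rewrite dimvf /dim /= mul1n.
have [k0 k0E] : exists k0, ext_deriv omega x (T x) (e k0 x) != 0.
  apply: contrapT => /forallNP H; move/eqP: v0; apply; rewrite -Tx.
  apply: (nondegenerate_basis eO w0E TD) => j.
  by have /negP := H j; rewrite negbK => /eqP.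
pose w := lie_bracket T (e k0) x.
have wF : w \in F 2.
  by have [+ _] := FS 2; apply; exists U, (e k0), 1; split=> //; exact: eS.
have ow : pairing (omega x) w != 0.
  by rewrite (om_lie_bracket TS U'c (eS k0) Uc) oppr_eq0.
have F2 : F 2 = fullv.
  apply/eqP; rewrite eqEsubv subvf /=; apply/subvP => u _.
  pose a := pairing (omega x) u / pairing (omega x) w.
  have -> : u = a *: w + (u - a *: w) by rewrite addrC subrK.
  apply: memvD; first exact: memvZ.
  apply: (subvP (Fmono 1 2 isT)); rewrite F1; apply: sub_span.
  by rewrite /distr /in_kernel pairingDr pairingNr pairingZr /a mulfVK// subrr.
have Ffull i : (2 <= i)%N -> F i = fullv.
  by move=> i2; apply/eqP; rewrite eqEsubv subvf /= -F2 Fmono.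
(* The definition admits any m with F m full, so the sum has to be shown to reach i = 2; all later
   terms are 0. *)
have m2 : (1 < m)%N.
  rewrite ltnNge; apply/negP => m1.
  have : (\dim (F m) <= \dim (F 1))%N by apply: dimvS; exact: Fmono.
  by rewrite Fm dfull d1 ltnn.
rewrite big_ltn; last by rewrite ltnS ltnW.
rewrite big_ltn; last by rewrite !ltnS.
rewrite big_nat big1 => [|i /andP[i3 _]]; last first.
  by rewrite !Ffull ?subnn ?muln0//; case: i i3 => [|[|[|]]].
rewrite /= F0 dimv0 subn0 d1 F2 dfull mul1n subSnn muln1 addn0 addnC.
by rewrite addnC.
Qed.

End Flag.

(** * Popp volume *)

Section Determinants.
Context {R : realType}.

Lemma wedge_det d (nu : 'I_d -> 'cV[R]_d) (v : 'I_d -> 'rV[R]_d) :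
  wedge nu v = \det (\matrix_i v i) * \det (\matrix_(a, i) nu i a 0).
Proof.
rewrite -det_mulmx -det_tr /wedge; congr (\det _); apply/matrixP => i j.
by rewrite !mxE /pairing !mxE; apply: eq_bigr => a _; rewrite !mxE.
Qed.

Lemma det_delta d : \det (\matrix_i (delta_mx 0 i : 'rV[R]_d)) = 1.
Proof.
rewrite -[RHS](det1 R d); congr (\det _).
by apply/matrixP => i j; rewrite !mxE eqxx eq_sym.
Qed.

(** By linearity in the first row, the two determinants differ by that of a matrix annihilating p,
    which is nonzero because it is 1 on u. Consequently any vector with omega = 1 can stand for the
    Reeb vector in a frame determinant. *)
Lemma det_col_mx_ker m (p : 'cV[R]_(1 + m)) (E : 'M[R]_(m, 1 + m)) (u v : 'rV[R]_(1 + m)) :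
  pairing p u = 1 -> pairing p v = 1 -> E *m p = 0 ->
  \det (col_mx u E : 'M[R]_(1 + m)) = \det (col_mx v E : 'M[R]_(1 + m)).
Proof.
move=> pu pv Ep.
have rowE (w : 'rV[R]_(1 + m)) : row 0 (col_mx w E : 'M[R]_(1 + m)) = w.
  have -> : 0 = lshift m 0 :> 'I_(1 + m) by exact: val_inj.
  by apply: (etrans (rowKu _ _ _)); exact: row_id.
have row'E (w w' : 'rV[R]_(1 + m)) : row' 0 (col_mx w E : 'M[R]_(1 + m)) = row' 0 (col_mx w' E : 'M[R]_(1 + m)).
  apply/matrixP => a b; rewrite [LHS]mxE [RHS]mxE; have -> : lift 0 a = rshift 1 a by exact: val_inj.
  exact: (etrans (col_mxEd w E a b) (esym (col_mxEd w' E a b))).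
rewrite (@determinant_multilinear _ _ _ (col_mx v E : 'M[R]_(1 + m)) (col_mx (u - v) E : 'M[R]_(1 + m)) 0 1 1); last 3 first.
- by rewrite !rowE !scale1r addrC subrK.
- exact: row'E.
- exact: row'E.
rewrite !mul1r; suff -> : \det (col_mx (u - v) E : 'M[R]_(1 + m)) = 0 by rewrite addr0.
have z : (col_mx (u - v) E : 'M[R]_(1 + m)) *m p = 0.
  rewrite mul_col_mx; have -> : (u - v) *m p = 0.
    apply/matrixP => a b; rewrite !ord1 [RHS]mxE.
    by apply: (etrans (pairingDr p u (- v))); rewrite pairingNr pu pv subrr.
  by rewrite Ep col_mx0.
apply/eqP; apply: contraT => d0.
have pz : p = 0.
  by rewrite -(mulKmx (_ : (col_mx (u - v) E : 'M[R]_(1 + m)) \in unitmx) p) ?z ?mulmx0// unitmxE unitfE.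
by move: pu; rewrite pz pairing0l => /esym/eqP; rewrite oner_eq0.
Qed.

End Determinants.

Section PoppVolume.
Context {R : realType} {n : nat} {M : contact_manifold R n}.
Notation N := n.*2.+1.
Notation omega := (contact_form (c:=M)).
Variables (X0 : vfield M) (mu : M -> ('I_N -> 'rV[R]_N) -> R).
Hypothesis reeb : is_reeb X0.
Hypothesis popp : is_popp X0 mu.
Hypothesis n_gt0 : (0 < n)%N.

(* [basis_mx] lists X0 first, [adapted_frame] lists it last. *)
Definition popp_sign : R := (-1) ^+ (lift_perm ord_max ord0 1 : 'S_N).

Let X0E x : pairing (omega x) (X0 x) = 1. Proof. by have [] := reeb x. Qed.

Lemma adapted_frame_det X x :
  \det (\matrix_k adapted_frame X0 X x k) = popp_sign * \det (basis_mx (X^~ x) (X0 x) : 'M[R]_N).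
Proof.
rewrite /popp_sign -det_perm -det_mulmx -row_permE; congr (\det _).
apply/row_matrixP => k; rewrite rowK row_permE -row_permE.
apply/rowP => j; rewrite [RHS]mxE [RHS]mxE.
rewrite /adapted_frame; case: unliftP => [k'|] ->.
  rewrite lift_perm_lift perm1.
  have -> : lift ord0 k' = rshift 1 k' by exact: val_inj.
  by apply: esym; apply: (etrans (col_mxEd _ _ _ _)); rewrite !mxE.
rewrite lift_perm_id.
have -> : (ord0 : 'I_N) = lshift n.*2 (ord0 : 'I_1) by exact: val_inj.
by apply: esym; apply: (etrans (col_mxEu _ _ _ _)).
Qed.

Lemma popp_frame x : exists (U : set M) (X : 'I_(n.*2) -> vfield M),
  [/\ open U, U x, forall k, section_on U (X k),
      forall y, U y -> orthonormal_basis y (fun k => X k y) &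
      forall y v, U y -> mu y v =
        popp_sign * \det (\matrix_i v i) / \det (basis_mx (X^~ y) (X0 y) : 'M[R]_N)].
Proof.
have [U [X [Ux XU eU mE]]] := popp x.
exists U, X; split=> //.
  have k0 : 'I_(n.*2) by exists 0; rewrite double_gt0.
  by have [] := XU k0.
move=> y v Uy; pose Ad := \matrix_k adapted_frame X0 X y k.
have Fu : basis_mx (X^~ y) (X0 y) \in unitmx by exact: (basis_mx_unit (eU y Uy) (X0E y)).
have sE : popp_sign * popp_sign = 1 by rewrite /popp_sign -expr2 sqrr_sign.
have s0 : popp_sign != 0 by rewrite /popp_sign signr_eq0.
have dF : \det (basis_mx (X^~ y) (X0 y) : 'M[R]_N) != 0 by rewrite -unitfE -unitmxE.
have Au : Ad \in unitmx by rewrite unitmxE adapted_frame_det unitfE mulf_neq0.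
(* The covectors dual to the adapted frame are the columns of the inverse of its matrix. *)
rewrite (mE y Uy (fun i => col i (invmx Ad))) => [|i j]; last first.
  have -> : pairing (col i (invmx Ad)) (adapted_frame X0 X y j) = (Ad *m invmx Ad) j i.
    rewrite /pairing !mxE; apply: eq_bigr => a _; congr (_ * _); last by rewrite mxE.
    by rewrite /Ad mxE.
  by rewrite mulmxV// mxE eq_sym.
rewrite wedge_det.
have -> : \matrix_(a, i) col i (invmx Ad) a 0 = invmx Ad by apply/matrixP => a i; rewrite !mxE.
rewrite det_inv adapted_frame_det invfM.
have -> : popp_sign^-1 = popp_sign by apply: (mulfI s0); rewrite sE divff.
by rewrite mulrCA mulrA.
Qed.

(** The coefficient of mu relative to the coordinates of [chart_at x]; as the chart may jump with x,
    it need not be continuous in x. *)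
Definition popp_density x : R := mu x (fun i => delta_mx 0 i).

Lemma popp_det x v : mu x v = \det (\matrix_i v i) * popp_density x.
Proof.
have [U [X [_ Ux _ _ mE]]] := popp_frame x.
by rewrite /popp_density !mE// det_delta mulr1 mulrA; congr (_ / _); rewrite mulrC.
Qed.

Lemma popp_density_neq0 x : popp_density x != 0.
Proof.
have [U [X [_ Ux _ eU mE]]] := popp_frame x.
rewrite /popp_density mE// det_delta mulr1 mulf_neq0 ?invr_eq0 ?signr_eq0//.
have := basis_mx_unit (eU x Ux) (X0E x).
by rewrite unitmxE unitfE.
Qed.

End PoppVolume.

(** * The exponential map in a chart *)

Section ChartMaps.
Context {R : realType} {d : nat} {M : manifold R d}.
Implicit Types (x : M) (i : chart_index M).
Local Opaque derive vec_in.

(** [velocity] and [exp_diff] are computed in the chart chosen at the moving end point. This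
    transports them to a fixed chart i, where derivatives at different times can be compared. *)
Lemma derive_chart_map (V : normedModType R) (g : V -> M) i (v a : V) :
  (\forall u \near v, dom i (g u)) -> differentiable (chart i \o g) v ->
  differentiable (chart (chart_at (g v)) \o g) v /\
  vec_in i (g v) ('D_a (chart (chart_at (g v)) \o g) v) = 'D_a (chart i \o g) v.
Proof.
move=> ng gd; set c := chart_at (g v).
have iv : dom i (g v) by exact: (nbhs_singleton ng).
have cv : dom c (g v) by exact: dom_chart_at.
have td : differentiable (chart c \o chart_inv i) ((chart i \o g) v) by exact: transition_diff.
have E : \forall u \near v, ((chart c \o chart_inv i) \o (chart i \o g)) u = (chart c \o g) u.
  by apply: filterS ng => u iu /=; rewrite chartK.
split; first exact: (near_differentiable E (differentiable_comp gd td)).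
have -> : 'D_a (chart c \o g) v = 'D_('D_a (chart i \o g) v) (chart c \o chart_inv i) (chart i (g v)).
  by rewrite -(near_derive_eq a E); exact: derive_comp.
exact: vec_in_inv.
Qed.

Lemma vec_in0 i x : vec_in i x 0 = 0.
Proof. exact: linear0. Qed.

Lemma vec_in_inj i x (u v : 'rV[R]_d) : dom i x -> vec_in i x u = vec_in i x v -> u = v.
Proof. by move=> ix E; rewrite -(vec_inK u ix) -(vec_inK v ix) E. Qed.

Definition vec_mx i x : 'M[R]_d :=
  lin1_mx ('d (chart i \o chart_inv (chart_at x)) (chart (chart_at x) x)).

Lemma mul_vec_mx i x v : v *m vec_mx i x = vec_in i x v.
Proof. exact: mul_rV_lin1. Qed.

Lemma vec_mx_unit i x : dom i x -> vec_mx i x \in unitmx.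
Proof.
move=> ix; rewrite -row_free_unit -kermx_eq0; apply/rowV0P => u /sub_kermxP.
by rewrite mul_vec_mx => E; apply: (vec_in_inj ix); rewrite E vec_in0.
Qed.

Lemma vec_mx_at x : vec_mx (chart_at x) x = 1%:M.
Proof. by apply/row_matrixP => k; rewrite !rowE mul_vec_mx vec_in_at mulmx1. Qed.

End ChartMaps.

(** * The Hamiltonian flow read in one chart *)

Section FlowInChart.
Context {R : realType} {d : nat} {M : manifold R d}.
Variables (H : cotangent M -> R) (W : set (R * cotangent M)).
Variable (Phi : R -> cotangent M -> cotangent M).
Hypothesis flow : is_ham_flow H W Phi.

Definition flow_in i (sz : R * ('rV[R]_d * 'cV[R]_d)) : 'rV[R]_d * 'cV[R]_d :=
  cotangent_in i (Phi sz.1 (cotangent_of i sz.2)).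

Lemma flow_in_domain i (l : cotangent M) (O : set 'rV[R]_d) : dom i l.1 -> open O ->
  O (chart i l.1) -> exists Q : set (R * ('rV[R]_d * 'cV[R]_d)),
  [/\ open Q, Q (0, cotangent_in i l), is_smooth Q (flow_in i) &
     forall s z, Q (s, z) -> [/\ (chart i @` dom i) z.1, W (s, cotangent_of i z),
        dom i (Phi s (cotangent_of i z)).1 & O (flow_in i (s, z)).1]].
Proof.
move=> il Oo Ol; have [flow0 _ flow3 _] := flow.
have [W0 P0] := flow0 l.
have il' : dom i (Phi 0 l).1 by rewrite P0.
have [Q [Qo Q0 QW Qs]] := flow3 _ _ W0 _ _ il il'.
exists (Q `&` [set sz | O (flow_in i sz).1]); split.
- rewrite openE => sz [Qsz Osz]; rewrite /interior; apply: filterI; first exact: (open_near Qo Qsz).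
  have C : {for sz, continuous (flow_in i)}.
    by apply: differentiable_continuous; have [+ _] := Qs 1; exact.
  have Po : open [set z : 'rV[R]_d * 'cV[R]_d | O z.1] by exact: phase_open.
  exact: (C _ (open_near Po Osz)).
- by split=> //; rewrite /flow_in /= cotangent_inK// P0.
- by move=> k; apply: is_Ck_sub (Qs k) => sz [].
- by move=> s z [/QW[? ? ?] Os].
Qed.

Lemma flow_in0 i z : (chart i @` dom i) z.1 -> flow_in i (0, z) = z.
Proof.
by move=> iz; have [flow0 _ _ _] := flow; rewrite /flow_in /= (flow0 _).2 cotangent_ofK.
Qed.

Lemma is_derive_flow_in i s z : W (s, cotangent_of i z) ->
  dom i (Phi s (cotangent_of i z)).1 ->
  is_derive (s : R) 1 (fun s => flow_in i (s, z)) (ham_vfield H i (flow_in i (s, z))).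
Proof. by have [_ _ _ flow4] := flow; move=> Ws js; exact: (flow4 _ _ Ws i js). Qed.

End FlowInChart.

Lemma exp_diff_rows {R : realType} {n : nat} {M : contact_manifold R n}
    (Phi : R -> cotangent M -> cotangent M) l t (a : 'I_(n.*2.+1) -> 'cV[R]_(n.*2.+1)) :
  \matrix_k exp_diff Phi l t (a k) = (\matrix_(k, j) a k j 0) *m (\matrix_j exp_diff Phi l t (delta_mx j 0)).
Proof.
apply/row_matrixP => k; rewrite rowK row_mul mulmx_sum_row.
rewrite {1}[a k]matrix_sum_delta /exp_diff linear_sum; apply: eq_bigr => j _.
by rewrite big_ord1 linearZ !mxE rowK.
Qed.

Definition velocity_form {R : realType} {n : nat} {M : contact_manifold R n}
    (X : 'I_(n.*2) -> vfield M) (c : R -> M) (t : R) : 'cV[R]_(n.*2) :=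
  \col_k ext_deriv (contact_form (c := M)) (c t) (velocity c t) (X k (c t)).

(** * The Jacobian of the exponential map along a geodesic *)

Section Geodesic.
Context {R : realType} {n : nat} {M : contact_manifold R n}.
Notation N := n.*2.+1.
Notation omega := (contact_form (c:=M)).
Variables (X0 : vfield M) (mu : M -> ('I_N -> 'rV[R]_N) -> R).
Variables (H : cotangent M -> R) (W : set (R * cotangent M)).
Variables (Phi : R -> cotangent M -> cotangent M) (l : cotangent M).
Hypothesis reeb : is_reeb X0.
Hypothesis popp : is_popp X0 mu.
Hypothesis H_ham : is_hamiltonian H.
Hypothesis flow : is_ham_flow H W Phi.
Hypothesis Hl : H l <> 0.
Variables (U : set M) (X : 'I_(n.*2) -> vfield M).
Hypothesis U_open : open U.
Hypothesis Ul : U l.1.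
Hypothesis X_section : forall k, section_on U (X k).
Hypothesis X_orthonormal : forall y, U y -> orthonormal_basis y (fun k => X k y).

Let i := chart_at l.1.
Let Om := chart_dom i U.
Let Xc := chart_frame i X.
Let om := form_in i omega.
Let Psi := flow_in Phi i.
Let z0 := cotangent_in i l.

Variable Q : set (R * ('rV[R]_N * 'cV[R]_N)).
Hypothesis Q_open : open Q.
Hypothesis Q0 : Q (0, z0).
Hypothesis Q_smooth : is_smooth Q Psi.
Hypothesis Q_flow : forall s z, Q (s, z) -> [/\ (chart i @` dom i) z.1,
  W (s, cotangent_of i z), dom i (Phi s (cotangent_of i z)).1 & Om (Psi (s, z)).1].

Local Opaque derive vec_in covec_in form_in pairing.

Let gamma t : M := (Phi t l).1.

Let il : dom i l.1. Proof. exact: dom_chart_at. Qed.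
Let Om_open : open Om. Proof. exact: chart_dom_open. Qed.
Let Xc_smooth k : is_smooth Om (Xc k). Proof. exact: chart_frame_smooth. Qed.
Let om_smooth : is_smooth Om om. Proof. exact: chart_form_smooth. Qed.
Let om_Xc k y : Om y -> pairing (om y) (Xc k y) = 0.
Proof. exact: chart_form_frame. Qed.
Let z0K : cotangent_of i z0 = l. Proof. exact: cotangent_inK. Qed.
Let Psi_Om sz : Q sz -> Om (Psi sz).1. Proof. by case: sz => s z /Q_flow[]. Qed.
Let Psi0 z : Q (0, z) -> Psi (0, z) = z.
Proof. by move=> /Q_flow[iz _ _ _]; exact: (flow_in0 flow iz). Qed.
Let Psi_ham s z : Q (s, z) ->
  is_derive (s : R) 1 (fun s => Psi (s, z)) (ham_at Xc (Psi (s, z))).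
Proof.
move=> Qsz; have [_ Ws js Os] := Q_flow Qsz.
rewrite -(ham_vfield_chart U_open X_orthonormal H_ham Os).
exact: (is_derive_flow_in flow Ws js).
Qed.

Let near_Q : \forall t \near (0 : R), Q (t, z0).
Proof.
have C : {for (0 : R), continuous (fun s : R => (s, z0))}.
  apply/differentiable_continuous; exact: differentiable_pair.
exact: (C _ (open_near Q_open Q0)).
Qed.

Let Psi_gamma t : Psi (t, z0) = cotangent_in i (Phi t l).
Proof. by rewrite /Psi /flow_in /= z0K. Qed.

Let in_chart t : Q (t, z0) -> [/\ W (t, l), dom i (gamma t), U (gamma t) & Om (chart i (gamma t))].
Proof.
move=> Qt; have [_ Wt jt Ot] := Q_flow Qt; move: Wt jt Ot.
rewrite z0K Psi_gamma /= => Wt jt Ot; split=> //.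
by have [x [Ux ix] E] := Ot; rewrite /gamma -(chartK jt) -E chartK.
Qed.

Let X0E x : pairing (omega x) (X0 x) = 1. Proof. by have [] := reeb x. Qed.

Let y t := (extremal Psi z0 t).1.
Let yE t : y t = chart i (gamma t).
Proof. by rewrite /y /extremal Psi_gamma. Qed.

Let gamma0 : gamma 0 = l.1.
Proof. by have [flow0 _ _ _] := flow; rewrite /gamma (flow0 l).2. Qed.

Let velocity_in t : Q (t, z0) ->
  vec_in i (gamma t) (velocity gamma t) = energy_p Xc (extremal Psi z0 t).
Proof.
move=> Qt; have D := is_derive_position Om_open Xc_smooth Psi_Om Psi_ham Qt.
have [Wt it _ _] := in_chart Qt.
have D' : is_derive (t : R) 1 (chart i \o gamma) (energy_p Xc (extremal Psi z0 t)).
  have -> : chart i \o gamma = fun t => (extremal Psi z0 t).1 by apply/funext => s /=; rewrite -yE.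
  exact: D.
have nd : \forall s \near t, dom i (gamma s).
  by apply: filterS (flow_near flow Wt it) => s [].
have [dd DE] := D'.
have cd : differentiable (chart i \o gamma) t by apply/derivable1_diffP.
have [_ E] := @derive_chart_map R N M _ gamma i t (1 : R) nd cd.
by rewrite /velocity E DE.
Qed.

Let velocity_distr t : Q (t, z0) -> distr (gamma t) (velocity gamma t).
Proof.
move=> Qt; have [Wt it Ut Ot] := in_chart Qt.
rewrite /distr /in_kernel -(covec_inE _ _ it) (velocity_in Qt) -form_in_chart//.
have Oy : Om (extremal Psi z0 t).1 by rewrite -/(y t) yE.
have E := om_energy_p om_Xc Oy.
by rewrite -yE; exact: E.
Qed.

(** In the chart chosen at [l.1] the covectors at [l.1] keep their components, so varying the
    momentum by a means moving in the direction (0, a) of phase space. The chart at the end point is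
    changed by [derive_chart_map]. *)
Let exp_diff_in t a : Q (t, z0) ->
  vec_in i (gamma t) (exp_diff Phi l t a) = (variation Psi z0 (0, a) t).1.
Proof.
move=> Qt; set y0 := chart i l.1.
have z0E : z0 = (y0, l.2) by rewrite /z0 /cotangent_in covec_in_at.
pose g (q : 'cV[R]_N) : M := (Phi t (l.1, q)).1.
have gl : g l.2 = gamma t by rewrite /g -surjective_pairing.
have ofE q : cotangent_of i (y0, q) = (l.1, q).
  by rewrite -[LHS]/(cotangent_of i (chart i (l.1, q).1, q)) -{2}(covec_in_at l.1 q)
    -[(_, covec_in _ _ _)]/(cotangent_in i (l.1, q)) cotangent_inK.
have gE : chart i \o g = fun q => (Psi (t, (y0, q))).1.
  by apply/funext => q; rewrite /Psi /flow_in /= ofE.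
pose f q : R * ('rV[R]_N * 'cV[R]_N) := (t, (y0, q)).
have fd q : differentiable f q by apply: differentiable_pair => //; exact: differentiable_pair.
have Psid : differentiable Psi (f l.2).
  by have [+ _] := Q_smooth 1; apply; rewrite /f -z0E.
have nd : \forall q \near l.2, dom i (g q).
  have nQ : \forall q \near l.2, Q (f q).
    by apply: (differentiable_continuous (fd l.2) (open_near Q_open _)); rewrite /f -z0E.
  by apply: filterS nQ => q /Q_flow[_ _]; rewrite ofE.
have gd : differentiable (chart i \o g) l.2.
  rewrite gE; apply: (@differentiable_comp _ _ _ _ (Psi \o f) (@position R N)).
    exact: differentiable_comp.
  exact/linear_differentiable/position_continuous.
have [_ E] := derive_chart_map a nd gd.
have cgd := (derive_chart_map a nd gd).1.
rewrite -gl /exp_diff.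
rewrite -[Phi t l]/(Phi t l) -deriveE; last first.
  by move: cgd; rewrite gl.
move: E; rewrite gl => ->.
rewrite gE /variation z0E.
have -> : (fun q => (Psi (t, (y0, q))).1) = @position R N \o (Psi \o f) by [].
have [_ ->] := is_derive_linear (@position_continuous R N) (is_derive_diff a (differentiable_comp (fd l.2) Psid)).
have E2 : 'D_a (Psi \o f) l.2 = 'D_((0, (0, a))) Psi (t, (y0, l.2)).
  exact: (etrans (derive_snd (fun z => Psi (t, z)) y0 l.2 a) (derive_snd Psi t (y0, l.2) (0, a))).
exact: (f_equal (@position R N) E2).
Qed.

Let B t : 'M[R]_N := \matrix_j exp_diff Phi l t (delta_mx j 0).

Let v0 := X0 l.1.
Let F t : 'M[R]_N := basis_mx (X^~ (gamma t)) (X0 (gamma t)).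
Let E t : 'M[R]_N := frame_mx Xc om v0 (y t).

Let F_unit t : Q (t, z0) -> F t \in unitmx.
Proof.
by move=> /in_chart[_ _ Ut _]; exact: (basis_mx_unit (X_orthonormal Ut) (X0E _)).
Qed.

(** Up to the change of chart [vec_mx], the frames E and F differ in their first vector only, and
    omega is 1 on both choices, so [det_col_mx_ker] applies. *)
Let frame_det t : Q (t, z0) -> pairing (om (y t)) v0 != 0 ->
  \det (E t) = \det (F t) * \det (vec_mx i (gamma t)).
Proof.
move=> Qt v0t; have [Wt it Ut Ot] := in_chart Qt; rewrite -det_mulmx.
have FE : F t *m vec_mx i (gamma t) =
    col_mx (vec_in i (gamma t) (X0 (gamma t))) (\matrix_(k < n.*2) Xc k (y t)) :> 'M[R]_(1 + n.*2).
  apply: (etrans (mul_col_mx _ _ _)); congr col_mx; first exact: mul_vec_mx.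
  apply/row_matrixP => k; rewrite row_mul !rowK yE /Xc /chart_frame vfield_in_chart//.
  exact: mul_vec_mx.
rewrite FE /E /frame_mx; apply: (@det_col_mx_ker _ _ (om (y t))).
- by rewrite pairingZr mulVf.
- by rewrite yE /om form_in_chart// covec_inE.
apply/row_matrixP => k; rewrite row_mul rowK row0.
apply/rowP => j; rewrite ord1 [RHS]mxE.
by apply: om_Xc; rewrite yE.
Qed.

Hypothesis muE : forall y v, U y -> mu y v =
  @popp_sign R n * \det (\matrix_i v i) / \det (basis_mx (X^~ y) (X0 y) : 'M[R]_N).

Let y_0 : y 0 = chart i l.1. Proof. by rewrite yE gamma0. Qed.

Let v0_0 : pairing (om (y 0)) v0 = 1.
Proof. by rewrite y_0 /om form_in_chart// covec_in_at. Qed.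

Let near_v0 : \forall t \near (0 : R), pairing (om (y t)) v0 != 0.
Proof.
have [_ _ _ O0] := in_chart Q0.
have omd : differentiable om (y 0).
  by have [+ _] := om_smooth 1; apply; rewrite y_0 -gamma0.
have D := is_derive_position Om_open Xc_smooth Psi_Om Psi_ham Q0.
have [cd _] := is_derive_pairing (is_derive_comp D omd) (is_derive_cst v0 (0 : R) 1).
have C : {for (0 : R), continuous (fun t => pairing (om (y t)) v0)}.
  by apply/differentiable_continuous/derivable1_diffP.
have P1 : pairing (om (y 0)) v0 != 0 by rewrite v0_0 oner_neq0.
exact: (C _ (open_near (@open_neq R 0) P1)).
Qed.

Let densityE t : Q (t, z0) -> popp_density mu (gamma t) = @popp_sign R n / \det (F t).
Proof.
by move=> /in_chart[_ _ Ut _]; rewrite /popp_density muE// det_delta mulr1.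
Qed.

(** This is f_lambda. The density at the end point comes from mu; the one at the initial point
    appears as a factor because [dual_volume] divides by it. *)
Definition exp_jacobian (t : R) : R :=
  \det (\matrix_j exp_diff Phi l t (delta_mx j 0)) *
  popp_density mu (Phi t l).1 * popp_density mu l.1.

(** Each density is [popp_sign] over a frame determinant. The two signs multiply to 1 and the chart
    Jacobian at [gamma t] cancels, which leaves the determinant of the Jacobi matrix in the moving
    frame. *)
Let exp_jacobianE t : Q (t, z0) -> pairing (om (y t)) v0 != 0 ->
  exp_jacobian t = \det (\matrix_k (variation Psi z0 (0, col k (invmx (E 0))) t).1 *m invmx (E t)).
Proof.
move=> Qt v0t; have [_ it _ _] := in_chart Qt.
have -> : \matrix_k (variation Psi z0 (0, col k (invmx (E 0))) t).1 =
    (invmx (E 0))^T *m B t *m vec_mx i (gamma t).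
  have -> : (invmx (E 0))^T = \matrix_(k, j) col k (invmx (E 0)) j 0.
    by apply/matrixP => a b; rewrite !mxE.
  rewrite -exp_diff_rows; apply/row_matrixP => k.
  by rewrite row_mul !rowK mul_vec_mx exp_diff_in.
have v00 : pairing (om (y 0)) v0 != 0 by rewrite v0_0 oner_neq0.
have dT : \det (vec_mx i (gamma t)) != 0 by rewrite -unitfE -unitmxE vec_mx_unit.
rewrite 3!det_mulmx det_tr !det_inv (frame_det Qt v0t) (frame_det Q0 v00).
have -> : vec_mx i (gamma 0) = 1%:M by rewrite gamma0 vec_mx_at.
rewrite det1 mulr1 /exp_jacobian -/(gamma t) -[in popp_density mu l.1]gamma0.
rewrite (densityE Qt) (densityE Q0) -/(B t).
have s2 : @popp_sign R n * @popp_sign R n = 1 by rewrite /popp_sign -expr2 sqrr_sign.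
have E1 (b s f t0 f0 : R) : t0 != 0 -> s * s = 1 ->
  b * (s / f) * (s / f0) = f0^-1 * b * t0 * (f * t0)^-1.
  move=> t00 ss; rewrite invfM.
  have -> : b * (s / f) * (s / f0) = (s * s) * (b * f^-1 * f0^-1) by ring.
  have -> : f0^-1 * b * t0 * (f^-1 * t0^-1) = (t0 * t0^-1) * (b * f^-1 * f0^-1) by ring.
  by rewrite ss divff.
exact: E1.
Qed.

Let w := velocity_form X gamma.

Let wE t : Q (t, z0) -> \col_k dform om (extremal Psi z0 t).1
  (energy_p Xc (extremal Psi z0 t)) (Xc k (extremal Psi z0 t).1) = w t.
Proof.
move=> Qt; have [_ it _ _] := in_chart Qt.
apply/matrixP => k j; rewrite [LHS]mxE /w /velocity_form [RHS]mxE.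
have XE : vec_in i (gamma t) (X k (gamma t)) = Xc k (y t).
  by rewrite yE; apply: esym; exact: vfield_in_chart.
apply: esym; apply: (etrans (ext_deriv_chart _ _ (@contact_form_smooth _ _ M) it)).
exact: (f_equal3 (dform om) (esym (yE t)) (velocity_in Qt) XE).
Qed.

Lemma exp_jacobian_derive : exists2 w1, is_derive (0 : R) 1 w w1 &
  ((w 0)^T *m w 0) 0 0 != 0 ->
  is_derive (0 : R) 1 (fun t => if t == 0 then ((w 0)^T *m w 0) 0 0 / 12
     else exp_jacobian t / t ^+ (n.*2 + 3)) (((w 0)^T *m w1) 0 0 / 12).
Proof.
have v00 : pairing (om z0.1) v0 != 0 by have := oner_neq0 R; rewrite -v0_0 yE gamma0.
have Eu : frame_mx Xc om v0 z0.1 \in unitmx.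
  have v00' : pairing (om (y 0)) v0 != 0 by rewrite v0_0 oner_neq0.
  have E0 := frame_det Q0 v00'.
  have -> : frame_mx Xc om v0 z0.1 = E 0 by rewrite /E y_0.
  have [_ i0 _ _] := in_chart Q0.
  rewrite unitmxE unitfE E0 mulf_neq0// -unitfE -unitmxE; first exact: F_unit.
  exact: vec_mx_unit.
have [w1 D1 D2] := exp_jacobian_expansion Om_open Xc_smooth om_smooth om_Xc Q_open Q0
  Q_smooth Psi_Om Psi0 Psi_ham v00 Eu.
have w00 := wE Q0.
exists w1.
  apply: near_eq_is_derive D1; apply: filterS near_Q => t Qt; exact: wE.
rewrite -w00 => S0; have D3 := D2 S0; apply: near_eq_is_derive D3.
apply: filterS2 near_Q near_v0 => t Qt v0t.
by rewrite (exp_jacobianE Qt v0t).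
Qed.

Lemma velocity_neq0 : velocity gamma 0 != 0.
Proof.
apply/eqP => v00; apply: Hl.
have Oz0 : chart_dom i U z0.1 by exists l.1.
have e0 : energy_p Xc z0 = 0.
  have := velocity_in Q0; rewrite v00 /extremal Psi0// => <-.
  exact: vec_in0.
rewrite -[l in H l]z0K (H_energy X_orthonormal H_ham Oz0) /energy.
(* Euler's relation for the quadratic Hamiltonian: p paired with dH/dp is 2 H, so zero velocity
   would force H = 0. *)
have <- : pairing z0.2 (energy_p Xc z0) = \sum_k frame_coord Xc k z0 ^+ 2.
  rewrite /energy_p pairing_sumr; apply: eq_bigr => k _.
  by rewrite pairingZr expr2.
by rewrite e0 pairing0r mulr0.
Qed.

Lemma wronskian_gt0 : 0 < ((w 0)^T *m w 0) 0 0.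
Proof.
have [_ _ U0 _] := in_chart Q0; rewrite mxE.
have ge0 (k : 'I_(n.*2)) : true -> 0 <= (w 0)^T 0 k * w 0 k 0 by rewrite mxE -expr2 sqr_ge0.
rewrite lt_def sumr_ge0// andbT psumr_eq0//; apply/negP => /allP Z.
move/eqP: velocity_neq0; apply.
apply: (nondegenerate_basis (X_orthonormal U0) (X0E _) (velocity_distr Q0)) => k.
have := Z k (mem_index_enum k); rewrite mxE -expr2 sqrf_eq0 /w /velocity_form mxE.
by move=> /eqP.
Qed.

Variable J : M -> 'rV[R]_N -> 'rV[R]_N.
Hypothesis J_spec : is_J J.

Lemma gnorm_J_velocity : \forall t \near (0 : R),
  gnorm (gamma t) (J (gamma t) (velocity gamma t)) = Num.sqrt (((w t)^T *m w t) 0 0).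
Proof.
apply: filterS near_Q => t Qt; have [_ _ Ut _] := in_chart Qt.
have vD := velocity_distr Qt; have [JD JE] := J_spec vD.
have [XD _] := X_orthonormal Ut.
rewrite (gnorm_basis (X_orthonormal Ut) (X0E _) JD); congr Num.sqrt.
by rewrite mxE; apply: eq_bigr => k _; rewrite JE// /w /velocity_form !mxE expr2.
Qed.

Lemma gnorm_velocity : \forall t \near (0 : R), distr (gamma t) (velocity gamma t) /\
  gnorm (gamma t) (velocity gamma t) = Num.sqrt (2 * H l).
Proof.
have [flow0 _ _ _] := flow.
apply: filterS near_Q => t Qt; have [Wt it Ut Ot] := in_chart Qt.
have vD := velocity_distr Qt; have [XD XM] := X_orthonormal Ut; split=> //.
rewrite (gnorm_basis (X_orthonormal Ut) (X0E _) vD); congr Num.sqrt.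
have -> : H l = H (Phi t l).
  have [W0 P0] := flow0 l; rewrite -{1}P0.
  exact: (energy_constant popp H_ham flow W0 Wt).
rewrite [Phi t l]surjective_pairing (H_ham _ (X_orthonormal Ut)).
rewrite mulrA divff ?pnatr_eq0// mul1r; apply: eq_bigr => k _; congr (_ ^+ 2).
(* The velocity is dH/dp, whose k-th coordinate in the orthonormal frame is p paired with X k; the
   squares of these coordinates add up to 2 H. *)
have -> : velocity gamma t = \sum_j pairing (Phi t l).2 (X j (gamma t)) *: X j (gamma t).
  apply: (vec_in_inj it); rewrite (velocity_in Qt) vec_in_sum; apply: eq_bigr => j _.
  rewrite vec_inZ /frame_coord /extremal Psi_gamma /=.
  by rewrite /Xc /chart_frame vfield_in_chart// covec_inE.
rewrite metric_suml// (bigD1 k)//= XM eqxx mulr1 big1 ?addr0// => j jk.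
by rewrite XM (negbTE jk) mulr0.
Qed.

End Geodesic.

(** * Logarithmic derivatives and conclusion *)

Lemma is_derive_ln_comp {R : realType} (g : R -> R) (t dg : R) :
  is_derive (t : R) 1 g dg -> 0 < g t -> is_derive (t : R) 1 (fun s => ln (g s)) (dg / g t).
Proof.
move=> D g0; rewrite mulrC; exact: (is_derive1_comp (is_derive1_ln g0) D).
Qed.

Lemma ln_sqrt {R : realType} (x : R) : 0 < x -> ln (Num.sqrt x) = 2^-1 * ln x.
Proof.
move=> x0; have s0 : 0 < Num.sqrt x by rewrite sqrtr_gt0.
rewrite -{2}(sqr_sqrtr (ltW x0)) expr2 lnM ?posrE//.
by field.
Qed.

Lemma is_derive_near_cvg {R : realType} (f g : R -> R) (df : R) :
  is_derive (0 : R) 1 f df -> (\forall t \near (0 : R)^', f t = g t) ->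
  g @ (0 : R)^' --> f 0.
Proof.
move=> [fd _] fg.
have C : f @ (0 : R) --> f 0 by apply/differentiable_continuous/derivable1_diffP.
have C' : f @ (0 : R)^' --> f 0 by apply: cvg_within_filter.
by apply: cvg_trans C'; exact: near_eq_cvg.
Qed.

Lemma is_derive_ln_norm {R : realType} m (w : R -> 'cV[R]_m) (w1 : 'cV[R]_m) :
  is_derive (0 : R) 1 w w1 -> 0 < ((w 0)^T *m w 0) 0 0 ->
  is_derive (0 : R) 1 (fun t => ln (Num.sqrt (((w t)^T *m w t) 0 0)))
    (((w 0)^T *m w1) 0 0 / ((w 0)^T *m w 0) 0 0).
Proof.
move=> D S0; have Dt := is_derive_mulmx (is_derive_trmx D) D.
have /is_derive_mxP /(_ 0 0) D1 := Dt.
have gc : {for (0 : R), continuous (fun t => ((w t)^T *m w t) 0 0)}.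
  by have [+ _] := D1 => gd; apply/differentiable_continuous/derivable1_diffP.
have gp : \forall t \near (0 : R), 0 < ((w t)^T *m w t) 0 0.
  exact: (gc _ (open_near (@open_gt R 0) S0)).
have D2 := is_derive_ln_comp D1 S0.
have D3 := is_deriveM (is_derive_cst (2^-1 : R) (0 : R) 1) D2.
apply: near_eq_is_derive (is_derive_eq D3 _).
  by apply: filterS gp => t gt /=; rewrite ln_sqrt.
have sym : (w1^T *m w 0) 0 0 = ((w 0)^T *m w1) 0 0.
  by rewrite -{1}[w 0]trmxK -trmx_mul mxE.
rewrite scaler0 addr0 [(w1^T *m w 0 + _) 0 0]mxE sym.
have half (a s : R) : 2^-1 * ((a + a) / s) = a / s.
  by rewrite mulrA; congr (_ / _); field.
exact: half.
Qed.

(** |Jv|^2 = d omega(v, Jv) = - d omega(Jv, v) = - <JJv, v> = |v|^2. *)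
Lemma gnorm_J {R : realType} {n : nat} {M : contact_manifold R n}
    (J : M -> 'rV[R]_(n.*2.+1) -> 'rV[R]_(n.*2.+1)) x v :
  is_J J -> distr x v -> J x (J x v) = - v -> gnorm x (J x v) = gnorm x v.
Proof.
move=> J_spec vD J2; have [JD JE] := J_spec _ _ vD; have [_ JE'] := J_spec _ _ JD.
have anti : ext_deriv (contact_form (c := M)) x v (J x v) =
    - ext_deriv (contact_form (c := M)) x (J x v) v by rewrite /ext_deriv opprB.
rewrite /gnorm JE// anti -JE'// J2; congr (Num.sqrt _).
have := metric_linear (-1) vD (distr0 x) vD.
by rewrite addr0 scaleN1r metric0l// addr0 mulN1r => ->; rewrite opprK.
Qed.

Theorem proposition7p7 (R : realType) (n : nat) (M : contact_manifold R n)
    (X0 : vfield M) (J : M -> 'rV[R]_(n.*2.+1) -> 'rV[R]_(n.*2.+1))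
    (mu : M -> ('I_(n.*2.+1) -> 'rV[R]_(n.*2.+1)) -> R)
    (H : cotangent M -> R) (W : set (R * cotangent M))
    (Phi : R -> cotangent M -> cotangent M) (lambda : cotangent M) (k : nat) :
  is_reeb X0 -> (forall x : M, quotient_norm x (X0 x) = 1) ->
  is_J J -> is_popp X0 mu -> is_hamiltonian H -> is_ham_flow H W Phi ->
  let gamma : R -> M := fun t => (Phi t lambda).1 in
  (exists2 t, W (t, lambda) & gamma t <> gamma 0) ->
  is_geodesic_dim gamma k ->
  exists rho : R,
    [/\ is_vol_geod_deriv mu W Phi k lambda rho,
        is_derive (0 : R) 1
          (fun t => ln (gnorm (gamma t) (J (gamma t) (velocity gamma t)))) rho &
        (forall (x : M) (v : 'rV[R]_(n.*2.+1)), distr x v -> J x (J x v) = - v) ->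
        rho = 0].
Proof.
move=> reeb _ J_spec popp H_ham flow gamma nonc dimk.
have Hl : H lambda <> 0 by exact: (nonconstant_energy popp H_ham flow nonc).
have [flow0 _ _ _] := flow; have [W0 P0] := flow0 lambda.
have gamma0 : gamma 0 = lambda.1 by rewrite /gamma P0.
(* For n = 0 an orthonormal frame is empty and H is identically 0, against [Hl]. *)
have n0 : (0 < n)%N.
  rewrite lt0n; apply/negP => /eqP nE; apply: Hl.
  have [V [Y [_ Vl _ YO]]] := local_frame popp lambda.1.
  rewrite [lambda]surjective_pairing (H_ham _ _ _ (YO _ Vl)) big1 ?mulr0// => j _.
  have n2 : (n.*2 <= 0)%N by rewrite nE.
  by have := leq_trans (ltn_ord j) n2.
have [U [X [Uo Ul XS XO muE]]] := popp_frame reeb popp n0 lambda.1.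
pose i := chart_at lambda.1; have il : dom i lambda.1 := dom_chart_at _.
have Oo : open (chart_dom i U) by exact: chart_dom_open.
have Ol : chart_dom i U (chart i lambda.1) by exists lambda.1.
have [Q [Qo Q0 Qs QF]] := flow_in_domain flow il Oo Ol.
have v0 : velocity gamma 0 != 0.
  exact: (velocity_neq0 H_ham flow Hl Uo Ul XS XO Q0 QF).
have X0E : pairing (contact_form (gamma 0)) (X0 (gamma 0)) = 1 by have [] := reeb (gamma 0).
have Ug : U (gamma 0) by rewrite gamma0.
have kE : k = (n.*2 + 3)%N.
  exact: (geodesic_dimE Uo Ug XS (XO _ Ug) X0E v0 dimk).
have [w1 D1 D2] := exp_jacobian_derive reeb H_ham flow Uo XS XO Qo Q0 Qs QF muE.
have S0 := wronskian_gt0 reeb H_ham flow Hl Uo Ul XS XO Q0 QF.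
have D3 := D2 (lt0r_neq0 S0).
have nJ := gnorm_J_velocity reeb H_ham flow Uo XS XO Qo Q0 QF J_spec.
have nv := gnorm_velocity reeb popp H_ham flow Uo XS XO Qo Q0 QF.
set w := velocity_form X gamma in D1 D2 D3 S0 nJ.
pose S := ((w 0)^T *m w 0) 0 0.
pose rho := ((w 0)^T *m w1) 0 0 / S.
have C0 : 0 < S / 12 by rewrite divr_gt0.
have DJ : is_derive (0 : R) 1
    (fun t => ln (gnorm (gamma t) (J (gamma t) (velocity gamma t)))) rho.
  apply: near_eq_is_derive (is_derive_ln_norm D1 S0).
  by apply: filterS nJ => t ->.
exists rho; split=> //.
  (* The limit of t^-k f(t) is the determinant of the leading matrix, which is |w(0)|^2 / 12. *)
  exists (exp_jacobian mu Phi lambda), (S / 12); split=> //.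
  - move=> t Wt a; rewrite (popp_det reeb popp n0) exp_diff_rows det_mulmx.
    rewrite /dual_volume -/(popp_density mu lambda.1) /exp_jacobian wedge_det det_delta mul1r.
    have -> : \det (\matrix_(k0, j) a k0 j 0) = \det (\matrix_(b, i0) a i0 b 0).
      by rewrite -det_tr; congr (\det _); apply/matrixP => b c; rewrite !mxE.
    have d0 := popp_density_neq0 reeb popp n0 lambda.1.
    by field.
  - have := is_derive_near_cvg D3; rewrite /= eqxx; apply.
    rewrite kE; apply: filterS (nbhs_dnbhs_neq _) => t t0.
    by rewrite (negbTE t0) mulrC.
  rewrite kE; have D4 := is_derive_ln_comp D3.
  rewrite /= eqxx in D4; have D5 := D4 C0.
  apply: near_eq_is_derive (is_derive_eq D5 _).
    by apply: filterS nJ => t _; rewrite [_^-1 * exp_jacobian _ _ _ _]mulrC.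
  have S0' := lt0r_neq0 S0.
  by rewrite /rho -/S; field.
(* Near 0 the norm of J gamma' equals that of gamma', which is sqrt (2 H) by conservation of energy;
   uniqueness of the derivative then gives rho = 0. *)
move=> J2; have D0 : is_derive (0 : R) 1
    (fun t => ln (gnorm (gamma t) (J (gamma t) (velocity gamma t)))) 0.
  apply: near_eq_is_derive (is_derive_cst (ln (Num.sqrt (2 * H lambda))) (0 : R) 1).
  by apply: filterS nv => t [vD <-]; rewrite -(gnorm_J J_spec vD (J2 _ _ vD)).
by have [_ <-] := DJ; have [_ ->] := D0.
Qed.
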